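(* Let $g\ge3$, $d=2g+1$, and let $\pi^{(d)}$ be $\tau^{(d)}$ or $\sigma^{(d)}$ (their suspensions lie in non-hyperelliptic components of $\mathcal{H}(g-1,g-1)$, and every such component is obtained this way); write $\Omega^{(d)}=\Omega_{\pi^{(d)}}$, $Q^{(d)}=Q_{\pi^{(d)}}$. Then $\mathrm{RV}(\pi^{(d)})$ equals the preimage of $O(Q^{(d)})$ under the modulus-two reduction $\mathrm{Sp}(\Omega^{(d)},\mathbb{Z})\cap\mathrm{SL}(\mathbb{Z}^{\mathcal{A}})\to\mathrm{Sp}(\overline{\Omega}^{(d)},\mathbb{Z}/2\mathbb{Z})$. If $g$ is odd, it is isomorphic to a semidirect product $\mathrm{RV}(\pi^{(d-1)})\ltimes\mathbb{Z}^{d-1}$ (with $\pi^{(d-1)}$ from the same family as $\pi^{(d)}$). If $g$ is even, it is isomorphic to a finite-index subgroup of a semidirect product $\mathrm{Sp}(\Omega^{(d-1)},\mathbb{Z})\ltimes\mathbb{Z}^{d-1}$. Moreover, $\mathrm{RV}(\pi^{(d)})$ is generated by $\{T_{e_\alpha}\}_{\alpha\in\mathcal{A}}$.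
   Context: Alphabet $\mathcal{A}=\{1,\dots,d\}$; $\tau^{(n)}$ ($n\ge6$) has top row $1,2,\dots,n$ and bottom row $n,n-1,\dots,6,3,2,5,4,1$; $\sigma^{(n)}$ ($n\ge8$) has top row $1,\dots,n$ and bottom row $n,n-1,\dots,8,3,2,7,6,5,4,1$ (rows list letters in order of $\pi_{\mathrm t}$, $\pi_{\mathrm b}$). $(\Omega_\pi)_{\alpha\beta}=+1$ if $\pi_{\mathrm t}(\alpha)<\pi_{\mathrm t}(\beta)$ and $\pi_{\mathrm b}(\alpha)>\pi_{\mathrm b}(\beta)$, $-1$ if the reverse inequalities hold, $0$ otherwise; $\langle u,v\rangle=u\Omega_\pi v^{\intercal}$; $\mathrm{Sp}(\Omega,\mathbb{Z})=\{S\in\mathrm{GL}(\mathbb{Z}^{\mathcal{A}}):S\Omega S^{\intercal}=\Omega\}$, acting on row vectors; $T_v(u)=u+\langle v,u\rangle v$. Bar denotes reduction mod 2; $Q_\pi(u)=\sum_{\pi_{\mathrm t}(\alpha)<\pi_{\mathrm t}(\beta)}u_\alpha(\Omega_\pi)_{\alpha\beta}u_\beta+\sum_\alpha u_\alpha\bmod2$; $O(Q_\pi)$ the invertible linear maps of $(\mathbb{Z}/2\mathbb{Z})^{\mathcal{A}}$ preserving $Q_\pi$. $\mathrm{RV}(\pi)$ is the Rauzy–Veech group: products $B_{\gamma_n}\cdots B_{\gamma_1}$ over closed walks at $\pi$ in its Rauzy class (arrows = top/bottom Rauzy operations, $B_\gamma=\mathrm{Id}+E_{\alpha_{\mathrm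 l}\alpha_{\mathrm w}}$ with loser $\alpha_{\mathrm l}$, winner $\alpha_{\mathrm w}$; reversed arrows with inverse matrices). Here $\sigma^{(d)}$ is only considered when $d\ge8$. *)

(* Defs.v *)
From HB Require Import structures.
From mathcomp Require Import all_boot all_order all_algebra.
Set Implicit Arguments. Unset Strict Implicit. Unset Printing Implicit Defensive.
Import Order.TTheory GRing.Theory Num.Theory.
Local Open Scope ring_scope.

(* Letters of the alphabet {1,...,n} are encoded as 'I_n (letter k <-> ordinal k-1).
   Positions in a row are encoded by natural numbers 0,...,n-1.
   A (generalized) permutation is a pair (pi_t, pi_b) of maps letters -> positions. *)
Definition pperm (n : nat) := ({ffun 'I_n -> nat} * {ffun 'I_n -> nat})%type.

Definition pt n (p : pperm n) : 'I_n -> nat := p.1.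
Definition pb n (p : pperm n) : 'I_n -> nat := p.2.

(* Build a permutation from its bottom row (a list of 1-based letters);
   the top row is 1,2,...,n. *)
Definition pperm_of_bottom (n : nat) (bot : seq nat) : pperm n :=
  ([ffun a : 'I_n => val a], [ffun a : 'I_n => index (val a).+1 bot]).

Definition tau_bottom (n : nat) : seq nat :=
  [seq (n - i)%N | i <- iota 0 (n - 5)] ++ [:: 3; 2; 5; 4; 1]%N.
Definition sigma_bottom (n : nat) : seq nat :=
  [seq (n - i)%N | i <- iota 0 (n - 7)] ++ [:: 3; 2; 7; 6; 5; 4; 1]%N.

Definition tau (n : nat) : pperm n := pperm_of_bottom n (tau_bottom n).
Definition sigma (n : nat) : pperm n := pperm_of_bottom n (sigma_bottom n).

Definition fam (isTau : bool) (n : nat) : pperm n :=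
  if isTau then tau n else sigma n.

Definition Omega n (p : pperm n) : 'M[int]_n :=
  \matrix_(a, b)
    (if ((pt p a < pt p b)%N && (pb p b < pb p a)%N) then 1
     else if ((pt p b < pt p a)%N && (pb p a < pb p b)%N) then -1 else 0).

Definition form n (Om : 'M[int]_n) (u v : 'rV[int]_n) : int := (u *m Om *m v^T) 0 0.

(* the matrix of the transvection T_v(u) = u + <v,u> v, acting on row vectors:
   row i is T_v(e_i) *)
Definition Tv n (Om : 'M[int]_n) (v : 'rV[int]_n) : 'M[int]_n :=
  \matrix_(i, j) ((delta_mx 0 i : 'rV[int]_n) + form Om v (delta_mx 0 i) *: v) 0 j.

Definition e_ n (a : 'I_n) : 'rV[int]_n := delta_mx 0 a.

Definition last_top n (p : pperm n) : option 'I_n := [pick a | pt p a == n.-1].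
Definition last_bot n (p : pperm n) : option 'I_n := [pick a | pb p a == n.-1].

(* row r : move the loser l (last letter in row r) right after the winner w in row r *)
Definition move_after n (r : {ffun 'I_n -> nat}) (w l : 'I_n) : {ffun 'I_n -> nat} :=
  [ffun x => if x == l then (r w).+1 else if (r w < r x)%N then (r x).+1 else r x].

(* [rauzy_step top p = Some (q, B)] : the arrow of top type (top = true) or bottom
   type (top = false) starting at p ends at q, and B = Id + E_{loser, winner}.
   None if the arrow is undefined (the two last letters coincide). *)
Definition rauzy_step n (top : bool) (p : pperm n) : option (pperm n * 'M[int]_n) :=
  match last_top p, last_bot p with
  | Some atop, Some ab =>
      if atop == ab then None
      else if top then
        Some ((p.1, move_after p.2 atop ab), 1%:M + delta_mx ab atop)
      else
        Some ((move_after p.1 ab atop, p.2), 1%:M + delta_mx atop ab)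
  | _, _ => None
  end.

(* [walk p r M] : there is a walk from p to r in the Rauzy diagram (arrows possibly
   traversed backwards) whose product B_{gamma_k} ... B_{gamma_1} is M, where
   reversed arrows contribute the inverse matrix. *)
Inductive walk n : pperm n -> pperm n -> 'M[int]_n -> Prop :=
| walk_nil p : walk p p 1%:M
| walk_fwd p q r (top : bool) B M :
    rauzy_step top p = Some (q, B) -> walk q r M -> walk p r (M *m B)
| walk_bwd p q r (top : bool) B M :
    rauzy_step top q = Some (p, B) -> walk q r M -> walk p r (M *m invmx B).

Definition RV n (p : pperm n) (S : 'M[int]_n) : Prop := walk p p S.

Definition Sp n (Om : 'M[int]_n) (S : 'M[int]_n) : Prop :=
  S \in unitmx /\ S *m Om *m S^T = Om.
Definition SpSL n (Om : 'M[int]_n) (S : 'M[int]_n) : Prop :=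
  Sp Om S /\ \det S = 1.

Definition red2 n (S : 'M[int]_n) : 'M['Z_2]_n := map_mx (fun z : int => z%:~R) S.

Definition Qform n (p : pperm n) (u : 'rV['Z_2]_n) : 'Z_2 :=
  \sum_(a < n) \sum_(b < n)
     (if (pt p a < pt p b)%N then u 0 a * ((Omega p a b)%:~R) * u 0 b else 0)
  + \sum_(a < n) u 0 a.

Definition OQ n (p : pperm n) (M : 'M['Z_2]_n) : Prop :=
  M \in unitmx /\ forall u : 'rV['Z_2]_n, Qform p (u *m M) = Qform p u.

(* Semidirect product G ⋉ Z^m of a matrix group with Z^m (row vectors),
   G acting on row vectors by right multiplication:
   (A, v) (B, w) = (A B, v B + w), i.e. the block matrices [[A, 0], [v, 1]]. *)
Definition sd_mul m (x y : 'M[int]_m * 'rV[int]_m) : 'M[int]_m * 'rV[int]_m :=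
  (x.1 *m y.1, x.2 *m y.1 + y.2).
Definition sd_one m : 'M[int]_m * 'rV[int]_m := (1%:M, 0).
Definition sd_inv m (x : 'M[int]_m * 'rV[int]_m) : 'M[int]_m * 'rV[int]_m :=
  (invmx x.1, - (x.2 *m invmx x.1)).

Definition group_iso (A B : Type) (mulA : A -> A -> A) (mulB : B -> B -> B)
  (P : A -> Prop) (Q : B -> Prop) (f : A -> B) : Prop :=
  [/\ (forall x, P x -> Q (f x)),
      (forall y, Q y -> exists2 x, P x & f x = y),
      (forall x y, P x -> P y -> f x = f y -> x = y) &
      (forall x y, P x -> P y -> f (mulA x y) = mulB (f x) (f y))].

Definition sd_finite_index_subgroup m (G H : 'M[int]_m * 'rV[int]_m -> Prop) : Prop :=
  [/\ (forall x, H x -> G x),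
      H (sd_one m),
      (forall x y, H x -> H y -> H (sd_mul x y)),
      (forall x, H x -> H (sd_inv x)) &
      (exists s : seq ('M[int]_m * 'rV[int]_m),
          (forall y, y \in s -> G y) /\
          (forall x, G x -> exists2 y, y \in s & H (sd_mul (sd_inv y) x)))].

Inductive generated n (X : 'M[int]_n -> Prop) : 'M[int]_n -> Prop :=
| gen_one : generated X 1%:M
| gen_mul x M : X x -> generated X M -> generated X (x *m M)
| gen_inv x M : X x -> generated X M -> generated X (invmx x *m M).

(* Main.v *)
Require Import Defs.
From HB Require Import structures.
From mathcomp Require Import all_boot all_order all_algebra.
From mathcomp Require Import zify ring lra.
Set Implicit Arguments. Unset Strict Implicit. Unset Printing Implicit Defensive.
Import Order.TTheory GRing.Theory Num.Theory.
Local Open Scope ring_scope.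

(* The Rauzy-Veech group is generated by transvections and preserves Q, so everything rests
   on the converse: a form-preserving S with Q o S = Q lies in the group generated by the
   T_{e_a}. This is proved along a chain of unimodular sublattices U of Z^d spanned by letters,
   each obtained from the previous one by adding a hyperbolic plane <k, f> with Q f = 1,
   together with the transvections T_f and T_{x+k}, where x in U is the vector representing the
   form against the new letter. A Euclidean descent shows that the enlarged group is
   transitive on the primitive vectors of each Q-value: if Q x = 1 it contains the Eichler
   transformations along k; if Q x = 0 and U contains enough singular vectors it contains T_k,
   hence SL_2(Z) on the plane. Fixing f and then k reduces S to U.
   For d = 2g+1 the form has the radical Z k with k = sum (-1)^i e_i, and an S fixing k is a
   pair (A, psi) with A in Sp(2g, Z). Since Q k = 0 exactly when g is odd, Q leaves psi free if
   g is odd, and determines psi mod 2 from A if g is even. In the latter case Q o A = Q + <w, .>,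
   and a Gauss sum (the Arf invariant) gives Q w = 0, so that A T_w^{-1} preserves Q. *)

(** * Transvections *)

(** The order of the chain is dictated by the one irregularity of the form: with letters counted
    from 0, the letters 1, 2 do not meet 3, ..., c - 1. Two letters i < j can be added to U when
    <E_i, E_j> = 1 and both pair alike with U: then f = E_j - E_i is orthogonal to U, and Q f = 1 +
    1 + 1 = 1 holds automatically. The letters 0 and c meet every other letter and span the first
    plane; after them come {1, 2}, {3, 4}, ..., {c - 2, c - 1}, {c + 1, c + 2}, ..., where no pair
    straddles the blocks {1, 2} and {3, ..., c - 1}. This works because c is odd. For the first
    three planes the vector x is explicit. From then on only its existence is known, so Q x may take
    either value and both kinds of step are needed; the case Q x = 0 draws its singular vectors from
    the letters 0, ..., 4 and c. The determinant condition matters only for the radical: an isometry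
    sends k to k or -k, and in even dimension every isometry already has determinant 1, so
    determinant 1 means exactly that k is fixed. *)

Definition par (z : int) : bool := odd `|z|%N.

Lemma par0 : par 0 = false. Proof. by []. Qed.
Lemma par1 : par 1 = true. Proof. by []. Qed.
Lemma parN z : par (- z) = par z. Proof. by rewrite /par abszN. Qed.
Lemma parD a b : par (a + b) = par a (+) par b.
Proof. rewrite /par; lia. Qed.
Lemma parM a b : par (a * b) = par a && par b.
Proof. by rewrite /par abszM oddM. Qed.
Lemma par_evenE z : ~~ par z -> exists c : int, z = c + c.
Proof. rewrite /par => h; exists (z %/ 2)%Z; lia. Qed.
Definition parE := (parN, parD, parM, par0, par1).

Lemma invmx_mul (R : comUnitRingType) n (A B : 'M[R]_n) :
  A \in unitmx -> B \in unitmx -> invmx (A *m B) = invmx B *m invmx A.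
Proof.
move=> uA uB; have uAB : A *m B \in unitmx by rewrite unitmx_mul uA.
apply: (can_inj (mulKmx uAB)).
by rewrite mulmxV // mulmxA mulmxK // mulmxV.
Qed.

Lemma generated_mul n (X : 'M[int]_n -> Prop) M N :
  generated X M -> generated X N -> generated X (M *m N).
Proof.
move=> gM gN; elim: gM => [|x M' Xx _ IH|x M' Xx _ IH].
- by rewrite mul1mx.
- by rewrite -mulmxA; apply: gen_mul.
- by rewrite -mulmxA; apply: gen_inv.
Qed.

Lemma generated_in n (X : 'M[int]_n -> Prop) M : X M -> generated X M.
Proof. by move=> XM; rewrite -[M]mulmx1; apply: gen_mul => //; apply: gen_one. Qed.

Lemma generated_inv n (X : 'M[int]_n -> Prop) M :
  (forall x, X x -> x \in unitmx) -> generated X M -> generated X (invmx M).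
Proof.
move=> Xu gM; suff [//] : M \in unitmx /\ generated X (invmx M).
elim: gM => [|x M' Xx _ [uM IH]|x M' Xx _ [uM IH]]; split.
- exact: unitmx1.
- by rewrite invmx1; apply: gen_one.
- by rewrite unitmx_mul Xu.
- have ux := Xu _ Xx; rewrite invmx_mul //; apply: generated_mul => //.
  by rewrite -[invmx x]mulmx1; apply: gen_inv => //; exact: gen_one.
- by rewrite unitmx_mul unitmx_inv Xu.
- have ux := Xu _ Xx; rewrite invmx_mul ?unitmx_inv // invmxK.
  by apply: generated_mul => //; apply: generated_in.
Qed.

Lemma eq_mulmx_row n m (M N : 'M[int]_(n, m)) :
  (forall v : 'rV_n, v *m M = v *m N) -> M = N.
Proof. by move=> h; apply/row_matrixP => i; rewrite !rowE h. Qed.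

Section Transvections.
Variables (n : nat) (Om : 'M[int]_n).
Hypothesis skew : Om^T = - Om.
Implicit Types (u v w z : 'rV[int]_n) (M S : 'M[int]_n) (c m : int).

Local Notation form := Defs.form.
Local Notation "<< u , v >>" := (form Om u v) (at level 0, format "<< u ,  v >>").

Lemma formDl u v w : <<u + v, w>> = <<u, w>> + <<v, w>>.
Proof. by rewrite /form !mulmxDl mxE. Qed.
Lemma formDr u v w : <<u, v + w>> = <<u, v>> + <<u, w>>.
Proof. by rewrite /form linearD /= mulmxDr mxE. Qed.
Lemma formZl c u v : <<c *: u, v>> = c * <<u, v>>.
Proof. by rewrite /form -!scalemxAl mxE. Qed.
Lemma formZr c u v : <<u, c *: v>> = c * <<u, v>>.
Proof. by rewrite /form linearZ /= -scalemxAr mxE. Qed.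
Lemma formNl u v : <<- u, v>> = - <<u, v>>.
Proof. by rewrite -scaleN1r formZl mulN1r. Qed.
Lemma formNr u v : <<u, - v>> = - <<u, v>>.
Proof. by rewrite -scaleN1r formZr mulN1r. Qed.
Lemma form0l v : <<0, v>> = 0.
Proof. by rewrite /form !mul0mx mxE. Qed.
Lemma form0r v : <<v, 0>> = 0.
Proof. by rewrite /form trmx0 mulmx0 mxE. Qed.
Definition formE := (formDl, formDr, formZl, formZr, formNl, formNr, form0l, form0r).

Lemma form_skew u v : <<u, v>> = - <<v, u>>.
Proof.
rewrite /form; have -> : u *m Om *m v^T = - (v *m Om *m u^T)^T.
  by rewrite !trmx_mul trmxK skew mulNmx mulmxN opprK mulmxA.
by rewrite !mxE.
Qed.

Lemma formvv v : <<v, v>> = 0.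
Proof. by have := form_skew v v; lia. Qed.

Lemma form_eq0 u v : <<u, v>> = 0 -> <<v, u>> = 0.
Proof. by rewrite form_skew => h; lia. Qed.

Lemma mul_Tv v u : u *m Tv Om v = u + <<v, u>> *: v.
Proof.
suff -> : Tv Om v = 1%:M - Om *m v^T *m v.
  rewrite mulmxBr mulmx1 !mulmxA [X in _ - X *m _]mx11_scalar mul_scalar_mx.
  by rewrite form_skew scaleNr.
apply/row_matrixP => i; rewrite !rowE /Tv mulmxBr mulmx1 !mulmxA.
rewrite [X in _ - X *m _]mx11_scalar mul_scalar_mx -scaleNr.
rewrite -[(_ *m _ *m _) 0 0]/(form Om (delta_mx 0 i) v) -form_skew -rowE.
by apply/rowP => j; rewrite !mxE.
Qed.

Lemma eq_Tv v M : (forall u, u *m M = u + <<v, u>> *: v) -> M = Tv Om v.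
Proof. by move=> h; apply: eq_mulmx_row => u; rewrite h mul_Tv. Qed.

Lemma TvK v : Tv Om v *m (1%:M + Om *m v^T *m v) = 1%:M.
Proof.
apply: eq_mulmx_row => u; rewrite mulmxA mul_Tv mulmx1 mulmxDr mulmx1 !mulmxA.
rewrite [X in _ + X *m _]mx11_scalar mul_scalar_mx -/(form Om _ v) !formE formvv.
by rewrite mulr0 addr0 (form_skew u) scaleNr addrK.
Qed.

Lemma Tv_unit v : Tv Om v \in unitmx.
Proof. by have [] := mulmx1_unit (TvK v). Qed.

Lemma mul_TvV v u : u *m invmx (Tv Om v) = u - <<v, u>> *: v.
Proof.
apply: (can_inj (mulmxK (Tv_unit v))); rewrite mulmxKV ?Tv_unit // mul_Tv.
by rewrite !formE formvv mulr0 subr0 subrK.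
Qed.

Definition isom S := S *m Om *m S^T = Om.

Lemma isomP S : isom S <-> forall u v, <<u *m S, v *m S>> = <<u, v>>.
Proof.
split=> [h u v|h]; rewrite /form.
  by rewrite trmx_mul !mulmxA -(mulmxA u) -(mulmxA u) h.
have E (A : 'M[int]_n) i j : A i j = ((delta_mx 0 i : 'rV_n) *m A *m (delta_mx 0 j : 'rV_n)^T) 0 0.
  by rewrite trmx_delta -rowE -colE !mxE.
apply/matrixP => i j; rewrite !E.
by have := h (delta_mx 0 i) (delta_mx 0 j); rewrite /form trmx_mul !mulmxA.
Qed.

Lemma isom1 : isom 1%:M. Proof. by rewrite /isom trmx1 mul1mx mulmx1. Qed.
Lemma isomM M S : isom M -> isom S -> isom (M *m S).
Proof. by move=> /isomP hM /isomP hS; apply/isomP => u v; rewrite !mulmxA hS hM. Qed.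
Lemma isomV M : M \in unitmx -> isom M -> isom (invmx M).
Proof.
by move=> uM /isomP hM; apply/isomP => u v; rewrite -[LHS]hM !mulmxKV.
Qed.
Lemma isom_Tv v : isom (Tv Om v).
Proof.
apply/isomP => a b; rewrite !mul_Tv !formE formvv (form_skew a v); ring.
Qed.

Lemma Tv_conj v M : M \in unitmx -> isom M ->
  Tv Om (v *m M) = invmx M *m Tv Om v *m M.
Proof.
move=> uM /isomP iM; apply/esym/eq_Tv => u; rewrite !mulmxA mul_Tv mulmxDl mulmxKV //.
by rewrite -scalemxAl -[<<v, _>>]iM mulmxKV.
Qed.
End Transvections.

(** * Groups generated by transvections *)

Section Groups.
Variables (n : nat) (Om : 'M[int]_n).
Hypothesis skew : Om^T = - Om.
Local Notation V := 'rV[int]_n.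
Local Notation form := Defs.form.
Local Notation "<< u , v >>" := (form Om u v) (at level 0, format "<< u ,  v >>").
Implicit Types (u v w z : V) (M S : 'M[int]_n) (c m : int) (X Y U : V -> Prop).

Definition grp X := generated (fun T => exists2 v, X v & T = Tv Om v).

Lemma grp_ind X (G : 'M[int]_n -> Prop) :
  G 1%:M -> (forall M N, grp X M -> grp X N -> G M -> G N -> G (M *m N)) ->
  (forall v, X v -> G (Tv Om v)) -> (forall v, X v -> G (invmx (Tv Om v))) ->
  forall M, grp X M -> G M.
Proof.
have gT v : X v -> grp X (Tv Om v) by move=> Xv; apply: generated_in; exists v.
move=> G1 GM GT GV M; elim=> // _ M' [v Xv ->] gM GM'; apply: GM => //; auto.
apply: generated_inv; last exact: gT.
by move=> _ [u _ ->]; apply: Tv_unit.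
Qed.

Lemma grp1 X : grp X 1%:M. Proof. exact: gen_one. Qed.
Lemma grpM X M S : grp X M -> grp X S -> grp X (M *m S).
Proof. exact: generated_mul. Qed.
Lemma grpV X M : grp X M -> grp X (invmx M).
Proof. by apply: generated_inv => _ [v _ ->]; apply: Tv_unit. Qed.
Lemma grpT X v : X v -> grp X (Tv Om v).
Proof. by move=> Xv; apply: generated_in; exists v. Qed.

Lemma grp_unit X M : grp X M -> M \in unitmx.
Proof.
elim/grp_ind => [|A B _ _ uA uB|v _|v _]; rewrite ?unitmx1 ?unitmx_mul ?uA ?uB //.
- exact: Tv_unit.
- by rewrite unitmx_inv Tv_unit.
Qed.

Lemma grp_isom X M : grp X M -> isom Om M.
Proof.
elim/grp_ind => [|A B _ _|v _|v _].
- exact: isom1.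
- exact: isomM.
- exact: isom_Tv.
- by apply: isomV; [apply: Tv_unit | apply: isom_Tv].
Qed.

Lemma grp_form X M u v : grp X M -> <<u *m M, v *m M>> = <<u, v>>.
Proof. by move/grp_isom/isomP. Qed.

Lemma grp_sub X Y M : (forall v, X v -> grp Y (Tv Om v)) -> grp X M -> grp Y M.
Proof.
move=> XY; elim/grp_ind => [|A B _ _|v Xv|v Xv]; [exact: grp1|exact: grpM|exact: XY|].
exact/grpV/XY.
Qed.

Lemma grp_subset X Y M : (forall v, X v -> Y v) -> grp X M -> grp Y M.
Proof. by move=> XY; apply: grp_sub => v /XY; apply: grpT. Qed.

Lemma grp_fix X M z : (forall v, X v -> <<v, z>> = 0) -> grp X M -> z *m M = z.
Proof.
move=> h; elim/grp_ind => [|A B _ _ hA hB|v Xv|v Xv].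
- exact: mulmx1.
- by rewrite mulmxA hA.
- by rewrite mul_Tv // h // scale0r addr0.
- by rewrite mul_TvV // h // scale0r subr0.
Qed.

Definition subgrp U := [/\ U 0, forall u v, U u -> U v -> U (u + v) & forall u, U u -> U (- u)].

Lemma subgrpZ U c u : subgrp U -> U u -> U (c *: u).
Proof.
case=> U0 UD UN Uu; have Un (k : nat) : U (k%:Z *: u).
  elim: k => [|k IH]; first by rewrite scale0r.
  by rewrite intS scalerDl scale1r; apply: UD.
by case: (intP c) => [|k|k]; rewrite ?scaleNr; [rewrite scale0r|apply: Un|apply: UN; apply: Un].
Qed.
Lemma subgrpB U u v : subgrp U -> U u -> U v -> U (u - v).
Proof. by case=> _ UD UN Uu Uv; apply/UD/UN. Qed.

Lemma grp_stab X U M u : subgrp U -> (forall v, X v -> U v) -> grp X M -> U u -> U (u *m M).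
Proof.
move=> sU XU gM; elim/grp_ind: gM u => [|A B _ _ hA hB|v Xv|v Xv] u Uu.
- by rewrite mulmx1.
- by rewrite mulmxA; apply/hB/hA.
- by rewrite mul_Tv //; case: (sU) => _ UD _; apply: UD => //; apply: subgrpZ (XU _ Xv).
- by rewrite mul_TvV //; apply: subgrpB => //; apply: subgrpZ (XU _ Xv).
Qed.

Lemma grp_Tconj X v M : grp X M -> grp X (Tv Om v) -> grp X (Tv Om (v *m M)).
Proof.
move=> gM gT; rewrite Tv_conj //; [|exact: grp_unit gM|exact: grp_isom gM].
by apply: grpM => //; apply: grpM => //; apply: grpV.
Qed.

Lemma grp_pow X z m : grp X (Tv Om z) ->
  exists2 M, grp X M & forall v, v *m M = v + (m * <<z, v>>) *: z.
Proof.
move=> gz; have powN (k : nat) :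
    exists2 M, grp X M & forall v, v *m M = v + (k%:Z * <<z, v>>) *: z.
  elim: k => [|k [M gM hM]].
    by exists 1%:M => [|v]; [exact: grp1 | rewrite mulmx1 mul0r scale0r addr0].
  exists (M *m Tv Om z) => [|v]; first exact: grpM.
  rewrite mulmxA hM mul_Tv // !formE formvv //.
  by apply/rowP => i; rewrite !mxE intS; ring.
case: (intP m) => [|k|k]; try by apply: powN.
have [M gM hM] := powN k.+1; exists (invmx M) => [|v]; first exact: grpV.
apply: (can_inj (mulmxK (grp_unit gM))); rewrite mulmxKV ?(grp_unit gM) // hM.
by rewrite !formE formvv //; apply/rowP => i; rewrite !mxE; ring.
Qed.

Definition orb X v w := exists2 M, grp X M & v *m M = w.

Lemma orb_refl X v : orb X v v.
Proof. by exists 1%:M; [exact: grp1 | rewrite mulmx1]. Qed.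
Lemma orb_trans X v w z : orb X v w -> orb X w z -> orb X v z.
Proof.
by move=> [M gM <-] [S gS <-]; exists (M *m S); [exact: grpM | rewrite mulmxA].
Qed.
Lemma orb_sym X v w : orb X v w -> orb X w v.
Proof.
move=> [M gM <-]; exists (invmx M); first exact: grpV.
by rewrite mulmxK // (grp_unit gM).
Qed.
Lemma orb_step X z m v w : grp X (Tv Om z) -> w = v + (m * <<z, v>>) *: z -> orb X v w.
Proof. by move=> /grp_pow-/(_ m) [M gM hM] ->; exists M. Qed.
Lemma orb_T X v w : orb X v w -> grp X (Tv Om v) -> grp X (Tv Om w).
Proof. by move=> [M gM <-]; apply: grp_Tconj. Qed.

Variable Q : V -> bool.
Hypothesis QD : forall u v, Q (u + v) = Q u (+) Q v (+) par <<u, v>>.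

Lemma Q0 : Q 0 = false.
Proof. by have := QD 0 0; rewrite addr0 !formE; case: (Q 0). Qed.
Lemma QN u : Q (- u) = Q u.
Proof.
by have := QD u (- u); rewrite subrr Q0 !formE formvv // oppr0; case: (Q u); case: (Q _).
Qed.
Lemma QZ c u : Q (c *: u) = par c && Q u.
Proof.
have QZn (k : nat) : Q (k%:Z *: u) = par k && Q u.
  elim: k => [|k IH]; first by rewrite scale0r Q0.
  rewrite intS scalerDl scale1r QD IH !formE formvv // mulr0 parD par1 par0.
  by case: (par _); case: (Q u).
by case: (intP c) => [|k|k]; rewrite ?scaleNr ?QN ?parN; apply: QZn.
Qed.
Definition QE := (QD, QN, QZ, Q0).

Lemma Q_Tv v u : Q v -> Q (u *m Tv Om v) = Q u.
Proof.
move=> Qv; rewrite mul_Tv // QD QZ Qv andbT !formE (form_skew skew v) !parE.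
by case: (par _); case: (Q u).
Qed.
Lemma grp_Q X M u : (forall v, X v -> Q v) -> grp X M -> Q (u *m M) = Q u.
Proof.
move=> XQ gM; elim/grp_ind: gM u => [|A B _ _ hA hB|v Xv|v Xv] u.
- by rewrite mulmx1.
- by rewrite mulmxA hB hA.
- by rewrite Q_Tv // XQ.
- by rewrite -[in RHS](mulmxKV (Tv_unit skew v) u) Q_Tv // XQ.
Qed.
Lemma orb_Q X v w : (forall v, X v -> Q v) -> orb X v w -> Q w = Q v.
Proof. by move=> XQ [M gM <-]; apply: grp_Q gM. Qed.

Definition prim U v := exists2 w, U w & <<v, w>> = 1.

(* The induction hypothesis on a unimodular sublattice [U] spanned by the vectors of [X]. *)
Record stage U X : Prop := Stage {
  st_sub : subgrp U;
  st_XU : forall v, X v -> [/\ U v, Q v & prim U v];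
  st_span : forall P, subgrp P -> (forall v, X v -> P v) -> forall v, U v -> P v;
  st_dual : forall c : 'cV[int]_n, exists2 w, U w & forall u, U u -> <<w, u>> = (u *m c) 0 0;
  st_content : forall u, U u -> u = 0 \/ exists c w, [/\ U w, prim U w & u = c *: w];
  st_tr : forall v w, U v -> U w -> prim U v -> prim U w -> Q v = Q w -> orb X v w;
  st_full : forall S, isom Om S -> (forall u, Q (u *m S) = Q u) ->
    (forall u, U u -> U (u *m S)) ->
    (forall z, (forall u, U u -> <<z, u>> = 0) -> z *m S = z) -> grp X S }.

End Groups.

(** * Adding a hyperbolic plane *)

Section Step.
Variables (n : nat) (Om : 'M[int]_n).
Hypothesis skew : Om^T = - Om.
Local Notation V := 'rV[int]_n.
Local Notation form := Defs.form.
Local Notation "<< u , v >>" := (form Om u v) (at level 0, format "<< u ,  v >>").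
Variable Q : V -> bool.
Hypothesis QD : forall u v, Q (u + v) = Q u (+) Q v (+) par <<u, v>>.
Implicit Types (u v w z : V) (M S : 'M[int]_n) (a b c m : int).

Local Notation QE := (QE skew QD).
Local Notation grp := (grp Om).
Local Notation orb := (orb Om).
Local Notation prim := (prim Om).
Local Notation T := (Tv Om).

Variables (U X : V -> Prop) (k f : V).
Hypothesis st : stage Om Q U X.
Hypothesis kf : <<k, f>> = 1.
Hypothesis Uk : forall u, U u -> <<u, k>> = 0.
Hypothesis Uf : forall u, U u -> <<u, f>> = 0.
Hypothesis Qf : Q f.

Definition plus2 (v : V) := exists u a b, U u /\ v = u + a *: k + b *: f.

Let sU := st_sub st.
Let U0 : U 0. Proof. by case: sU. Qed.
Let UD u v : U u -> U v -> U (u + v). Proof. by case: sU => _ h _; apply: h. Qed.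
Let UN u : U u -> U (- u). Proof. by case: sU => _ _ h; apply: h. Qed.
Let UB u v : U u -> U v -> U (u - v). Proof. exact: subgrpB. Qed.
Let UZ c u : U u -> U (c *: u). Proof. exact: subgrpZ. Qed.

Let fk : <<f, k>> = -1. Proof. by rewrite form_skew // kf. Qed.
Let kk : <<k, k>> = 0. Proof. exact: formvv. Qed.
Let ff : <<f, f>> = 0. Proof. exact: formvv. Qed.
Let kU u : U u -> <<k, u>> = 0. Proof. by move/Uk => h; rewrite form_skew // h oppr0. Qed.
Let fU u : U u -> <<f, u>> = 0. Proof. by move/Uf => h; rewrite form_skew // h oppr0. Qed.

Lemma plus2_sub : subgrp plus2.
Proof.
split.
- by exists 0, 0, 0; rewrite !scale0r !addr0.
- move=> _ _ [u [a [b [Uu ->]]]] [v [c [d [Uv ->]]]].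
  exists (u + v), (a + c), (b + d); split; first exact: UD.
  by apply/rowP => i; rewrite !mxE; ring.
- move=> _ [u [a [b [Uu ->]]]]; exists (- u), (- a), (- b); split; first exact: UN.
  by apply/rowP => i; rewrite !mxE; ring.
Qed.

Lemma plus2_U u : U u -> plus2 u.
Proof. by move=> Uu; exists u, 0, 0; rewrite !scale0r !addr0. Qed.
Lemma plus2_k : plus2 k.
Proof. by exists 0, 1, 0; rewrite scale0r scale1r addr0 add0r. Qed.
Lemma plus2_f : plus2 f.
Proof. by exists 0, 0, 1; rewrite scale0r scale1r addr0 add0r. Qed.
Lemma plus2I u a b : U u -> plus2 (u + a *: k + b *: f).
Proof. by exists u, a, b. Qed.

Lemma form_plus2 u a b w c d : U u -> U w ->
  <<u + a *: k + b *: f, w + c *: k + d *: f>> = <<u, w>> + a * d - b * c.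
Proof.
move=> Uu Uw; rewrite !formE Uk // Uf // kU // fU // kf fk kk ff; ring.
Qed.

Lemma Q_plus2 u a b : U u ->
  Q (u + a *: k + b *: f) = Q u (+) (par a && Q k) (+) par b (+) (par a && par b).
Proof.
move=> Uu; rewrite !QE !formE Uk // Uf // kf Qf !parE !andbF !andbT !addbF.
by case: (Q u); case: (par a); case: (Q k); case: (par b).
Qed.

Lemma prim_plus2 u a b : U u -> prim plus2 (u + a *: k + b *: f) <->
  exists w c d, U w /\ <<u, w>> + a * d - b * c = 1.
Proof.
move=> Uu; split=> [[_ [w [c [d [Uw ->]]]]]|[w [c [d [Uw h]]]]].
  by rewrite form_plus2 // => h; exists w, c, d.
by exists (w + c *: k + d *: f); [exact: plus2I | rewrite form_plus2].
Qed.

Lemma plus2_dual (c : 'cV[int]_n) :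
  exists2 w, plus2 w & forall u, plus2 u -> <<w, u>> = (u *m c) 0 0.
Proof.
have [w Uw hw] := st_dual st c.
exists (w + ((f *m c) 0 0) *: k + (- (k *m c) 0 0) *: f); first exact: plus2I.
move=> _ [u [a [b [Uu ->]]]]; rewrite form_plus2 // hw //.
by rewrite !mulmxDl -!scalemxAl !mxE; ring.
Qed.

Lemma plus2_content v : plus2 v ->
  v = 0 \/ exists c w, [/\ plus2 w, prim plus2 w & v = c *: w].
Proof.
move=> [u [a [b [Uu ->]]]].
(* For u = 0 the hypothesis on U supplies no primitive vector (U may even be zero), so c = 0 is kept
   as a separate alternative. *)
have [c [w [Uw hw uE]]] : exists c w, [/\ U w, (c = 0 \/ exists2 w', U w' & <<w, w'>> = 1) & u = c *: w].
  case: (st_content st Uu) => [->|[c [w [Uw [w' Uw' h] ->]]]].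
    by exists 0, 0; rewrite scaler0; split=> //; left.
  by exists c, w; split=> //; right; exists w'.
have [p [q pq]] := Bezoutz a b; have [r [s rs]] := Bezoutz c (gcdz a b).
set g := gcdz c (gcdz a b) in rs *.
have /dvdzP [c' cE] : (g %| c)%Z by rewrite dvdz_gcdl.
have gab : (g %| gcdz a b)%Z by rewrite dvdz_gcdr.
have /dvdzP [a' aE] : (g %| a)%Z by apply: dvdz_trans gab (dvdz_gcdl _ _).
have /dvdzP [b' bE] : (g %| b)%Z by apply: dvdz_trans gab (dvdz_gcdr _ _).
have [g0|gn0] := eqVneq g 0.
  by left; rewrite uE cE aE bE g0 !mulr0 !scale0r !addr0.
right; exists g, (c' *: w + a' *: k + b' *: f); split.
- by apply/plus2I/UZ.
- have e : r * c' + s * (p * a' + q * b') = 1.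
    by apply: (mulfI gn0); rewrite mulr1 -[in RHS]rs -pq cE aE bE; ring.
  apply/prim_plus2; first exact: UZ.
  case: hw => [c0|[w' Uw' ww']].
    have c'0 : c' = 0 by move: cE; rewrite c0 => /eqP; rewrite eq_sym mulf_eq0 (negbTE gn0) orbF => /eqP.
    exists 0, (- s * q), (s * p); split=> //; rewrite form0r -e c'0; ring.
  exists (r *: w'), (- s * q), (s * p); split; first exact: UZ.
  by rewrite !formE ww' -[RHS]e; ring.
- by rewrite uE cE aE bE; apply/rowP => i; rewrite !mxE; ring.
Qed.

Lemma plus2_span (P : V -> Prop) : subgrp P -> (forall v, X v -> P v) -> P k -> P f ->
  forall v, plus2 v -> P v.
Proof.
move=> sP XP Pk Pf _ [u [a [b [Uu ->]]]]; case: (sP) => _ PD _.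
by apply: (PD); [apply: PD; [exact: (st_span st sP XP Uu) | exact: subgrpZ] | exact: subgrpZ].
Qed.

(* [S] is first corrected so as to fix [f]. Then [k S = k + u + m f] with [Q u = 0], and writing
   [u = c w] with [w] primitive, [u] is killed by T_{f+w} if [Q w = 0], and by T_{w+2f} if [c] is even. *)
Lemma plus2_full (X' : V -> Prop) : (forall v, X v -> X' v) ->
  (forall v, X' v -> plus2 v /\ Q v) -> X' f ->
  (forall v, plus2 v -> prim plus2 v -> Q v -> orb X' v f) ->
  forall S, isom Om S -> (forall u, Q (u *m S) = Q u) ->
    (forall u, plus2 u -> plus2 (u *m S)) ->
    (forall z, (forall u, plus2 u -> <<z, u>> = 0) -> z *m S = z) -> grp X' S.
Proof.
move=> XX' X'U X'f tr.
have X'Q v : X' v -> Q v by case/X'U.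
have D v : plus2 v -> prim plus2 v -> Q v -> grp X' (T v).
  by move=> Uv pv Qv; apply: orb_T (orb_sym skew (tr v Uv pv Qv)) _ => //; apply: grpT.
have fixf z m : <<z, f>> = 0 -> grp X' (T z) ->
    exists M, [/\ grp X' M, f *m M = f & forall v, v *m M = v + (m * <<z, v>>) *: z].
  move=> zf gz; have [M gM hM] := grp_pow skew m gz; exists M; split=> //.
  by rewrite hM zf mulr0 scale0r addr0.
have stab u m : U u -> Q u = false ->
    exists M, [/\ grp X' M, f *m M = f & (k + u + m *: f) *m M = k].
  move=> Uu Qu; have gf : grp X' (T f) by apply: grpT.
  suff [M1 [c [gM1 f1 h1]]] : exists M1 c, [/\ grp X' M1, f *m M1 = f & (k + u + m *: f) *m M1 = k + c *: f].
    have [M2 [gM2 f2 h2]] := fixf f c ff gf.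
    exists (M1 *m M2); split; first exact: grpM.
      by rewrite mulmxA f1 f2.
    rewrite mulmxA h1 h2 !formE ff fk.
    by apply/rowP => i; rewrite !mxE; ring.
  case: (st_content st Uu) => [->|[c [w [Uw pw uE]]]].
    by exists 1%:M, m; rewrite !mulmx1 addr0; split=> //; apply: grp1.
  have [w' Uw' ww'] := pw.
  move: Qu; rewrite uE (QZ skew QD); case Qw: (Q w); last first.
    move=> _; have gw : grp X' (T (f + w)).
      have -> : f + w = w + 0 *: k + 1 *: f by rewrite scale0r addr0 scale1r addrC.
      apply: D; rewrite ?Q_plus2 ?Qw //; first exact: plus2I.
      by apply/prim_plus2 => //; exists 0, (-1), 0; rewrite form0r.
    have [|M [gM fM hM]] := fixf _ c _ gw; first by rewrite !formE ff Uf.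
    exists M, (m - c); split=> //; rewrite hM !formE fk ff fU // Uk // Uf // formvv //.
    by apply/rowP => i; rewrite !mxE; ring.
  rewrite andbT => /negbT/par_evenE [d ->].
  have gw : grp X' (T (w + 0 *: k + 2 *: f)).
    apply: D; rewrite ?Q_plus2 ?Qw //; first exact: plus2I.
    by apply/prim_plus2 => //; exists w', 0, 0; rewrite ww'.
  have [|M [gM fM hM]] := fixf _ d _ gw; first by rewrite !formE ff kf Uf.
  exists M, (m - 4 * d); split=> //.
  rewrite hM !formE fk kk kf ff fU // kU // Uk // Uf // formvv //.
  by apply/rowP => i; rewrite !mxE; ring.
have grp_ok M : grp X' M -> [/\ forall u, plus2 u -> plus2 (u *m M),
    forall z, (forall u, plus2 u -> <<z, u>> = 0) -> z *m M = z & forall u, Q (u *m M) = Q u].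
  move=> gM; split=> [u Uu|z hz|u].
  - by apply: grp_stab plus2_sub _ gM Uu => // v /X'U [].
  - by apply: grp_fix gM => // v /X'U [Uv _]; rewrite form_skew // hz ?oppr0.
  - exact: grp_Q gM.
move=> S iS QS US zS.
have [M1 gM1 fM1] : orb X' (f *m S) f.
  apply: tr; rewrite ?QS //; first exact/US/plus2_f.
  exists (- k *m S); first by apply: US; case: plus2_sub => _ _; apply; apply: plus2_k.
  by move/isomP: iS => ->; rewrite formNr fk opprK.
have [UM1 zM1 QM1] := grp_ok _ gM1.
have [M2 [gM2 fM2 kM2]] : exists M2, [/\ grp X' M2, f *m M2 = f & k *m S *m M1 *m M2 = k].
  have := UM1 _ (US _ plus2_k); case=> u [a [b [Uu kE]]].
  have : <<k *m S *m M1, f *m S *m M1>> = 1.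
    by rewrite (grp_form skew _ _ gM1); move/isomP: iS => ->.
  rewrite fM1 kE !formE Uf // kf ff mulr1 mulr0 addr0 add0r => a1.
  have : Q (k *m S *m M1) = Q k by rewrite QM1 QS.
  rewrite kE Q_plus2 // a1 par1 /= => Qu.
  have {}Qu : Q u = false by move: Qu; case: (Q u); case: (Q k); case: (par b).
  have [M2 [gM2 fM2 hM2]] := stab u b Uu Qu.
  by exists M2; split=> //; rewrite scale1r (addrC u).
have [UM2 zM2 QM2] := grp_ok _ gM2.
pose S2 := S *m M1 *m M2.
have gSE : S = S2 *m invmx M2 *m invmx M1.
  by rewrite /S2 !mulmxK ?(grp_unit skew gM1) ?(grp_unit skew gM2).
suff g2 : grp X' S2.
  by rewrite gSE; apply: grpM; [apply: grpM => //|]; apply: grpV.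
have i2 : isom Om S2 by apply: isomM (grp_isom skew gM2) => //; apply: isomM (grp_isom skew gM1).
have f2 : f *m S2 = f by rewrite /S2 !mulmxA fM1 fM2.
have k2 : k *m S2 = k by rewrite /S2 !mulmxA.
apply: grp_subset XX' _ => //; apply: (st_full st) => //.
- by move=> u; rewrite /S2 !mulmxA QM2 QM1 QS.
- move=> u Uu; have /UM2/= := UM1 _ (US _ (plus2_U Uu)).
  rewrite -!mulmxA [X in u *m X]mulmxA -/S2 => -[v [a [b [Uv uE]]]].
  have : <<u *m S2, f *m S2>> = 0 by move/isomP: i2 => ->; apply: Uf.
  have : <<u *m S2, k *m S2>> = 0 by move/isomP: i2 => ->; apply: Uk.
  rewrite f2 k2 uE !formE Uk // Uf // kk ff fk kf => hb ha.
  have -> : a = 0 by lia.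
  have -> : b = 0 by lia.
  by rewrite !scale0r !addr0.
- move=> z hz.
  (* A vector orthogonal to U need not be orthogonal to the plane. Its component in the plane is
     removed first, which is harmless because [S2] fixes k and f. *)
  have h : (z - <<z, f>> *: k + <<z, k>> *: f) *m S2 = z - <<z, f>> *: k + <<z, k>> *: f.
    have hz' : forall u, plus2 u -> <<z - <<z, f>> *: k + <<z, k>> *: f, u>> = 0.
      move=> _ [u [a [b [Uu ->]]]].
      rewrite !formE hz // kU // fU // kk ff fk kf; ring.
    by rewrite /S2 !mulmxA zS // zM1 // zM2.
  move: h; rewrite !mulmxDl mulNmx -!scalemxAl f2 k2 => /addIr/addIr //.
Qed.
End Step.

(** * Eichler transformations along a vector orthogonal to the lattice *)

Section Eichler.
Variables (n : nat) (Om : 'M[int]_n).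
Hypothesis skew : Om^T = - Om.
Local Notation V := 'rV[int]_n.
Local Notation form := Defs.form.
Local Notation "<< u , v >>" := (form Om u v) (at level 0, format "<< u ,  v >>").
Variable Q : V -> bool.
Hypothesis QD : forall u v, Q (u + v) = Q u (+) Q v (+) par <<u, v>>.
Implicit Types (u v w z : V) (M S : 'M[int]_n) (a b c m : int).

Local Notation QE := (QE skew QD).
Local Notation grp := (grp Om).
Local Notation orb := (orb Om).
Local Notation prim := (prim Om).
Local Notation T := (Tv Om).

Variables (U X X' : V -> Prop) (k x : V).
Hypothesis st : stage Om Q U X.
Hypothesis Uk : forall u, U u -> <<u, k>> = 0.
Hypothesis XX' : forall v, X v -> X' v.
Hypothesis X'xk : X' (x + k).
Hypotheses (Ux : U x) (px : prim U x).

Let sU := st_sub st.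
Let U0 : U 0. Proof. by case: sU. Qed.
Let UD u v : U u -> U v -> U (u + v). Proof. by case: sU => _ h _; apply: h. Qed.
Let UN u : U u -> U (- u). Proof. by case: sU => _ _ h; apply: h. Qed.
Let kk : <<k, k>> = 0. Proof. exact: formvv. Qed.
Let kU u : U u -> <<k, u>> = 0. Proof. by move/Uk => h; rewrite form_skew // h oppr0. Qed.

(** The group of X fixes k, so an element carrying x to v carries x + k to v + k and conjugates the
    two transvections. *)
Lemma T_transport v : U v -> prim U v -> Q v = Q x -> grp X' (T (v + k)).
Proof.
move=> Uv pv Qvx; have [M gM <-] := st_tr st Ux Uv px pv (esym Qvx).
have kM : k *m M = k.
  by apply: (grp_fix skew _ gM) => w Xw; apply: Uk; case: (st_XU st Xw).
rewrite -[in X in _ + X]kM -mulmxDl; apply: grp_Tconj => //.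
  exact: grp_subset gM.
exact: grpT.
Qed.

(* For [f] with [<k, f> = 1] this sends [f] to [f + w + m k], and [u] in [U] to [u + <w, u> k]. *)
Definition eichler w m := exists2 M, grp X' M &
  forall z, z *m M = z + <<k, z>> *: w + (<<w, z>> + m * <<k, z>>) *: k.

(** The composition law is that of a Heisenberg group. Modulo 2 the cocycle <w', w> is the
    polarization of Q, which makes the condition [par m = Q w] stable under products. *)
Lemma eichlerD w m w' m' : U w -> U w' -> eichler w m -> eichler w' m' ->
  eichler (w + w') (m + m' + <<w', w>>).
Proof.
move=> Uw Uw' [M gM hM] [S gS hS]; exists (M *m S); first exact: grpM.
move=> z; rewrite mulmxA hM hS !formE kk (kU Uw) (Uk Uw').
by apply/rowP => i; rewrite !mxE; ring.
Qed.

Lemma eichlerN w m : U w -> eichler w m -> eichler (- w) (- m).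
Proof.
move=> Uw [M gM hM]; exists (invmx M); first exact: grpV.
move=> z; apply: (can_inj (mulmxK (grp_unit skew gM))).
rewrite mulmxKV ?(grp_unit skew gM) // hM !formE kk (kU Uw) (Uk Uw) formvv //.
by apply/rowP => i; rewrite !mxE; ring.
Qed.

Hypothesis Qx : Q x.

(** In T_v^-1 T_{v+k} the terms <v, z> v cancel, and z + <k, z> v + (<v, z> + <k, z>) k remains. T_v
    belongs to the group by fullness of U, since Q v = 1. *)
Lemma eichler1 v : U v -> prim U v -> Q v -> eichler v 1.
Proof.
move=> Uv pv Qv; exists (invmx (T v) *m T (v + k)).
  apply: grpM; last by apply: T_transport; rewrite // Qv.
  have [M gM <-] : orb X x v by apply: (st_tr st); rewrite // Qx.
  apply: grpV => //; apply: (grp_subset skew XX'); apply: grp_Tconj => //.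
  apply: (st_full st).
  - exact: isom_Tv.
  - by move=> u; rewrite (Q_Tv skew QD).
  - by move=> u Uu; rewrite mul_Tv //; apply: UD => //; apply: subgrpZ.
  - by move=> z hz; rewrite mul_Tv // form_skew // hz // oppr0 scale0r addr0.
move=> z; rewrite mulmxA mul_TvV // mul_Tv // !formE formvv // (kU Uv).
by apply/rowP => i; rewrite !mxE; ring.
Qed.

(** Since Q (-x) = Q x = 1, both x and -x have an Eichler transformation with constant 1; in their
    product the vectors cancel and the constants add up to 2. *)
Lemma eichler0_2 c : eichler 0 (c + c).
Proof.
have e2 : eichler 0 2.
  have ex := eichler1 Ux px Qx.
  have := eichlerD Ux (UN Ux) ex (eichler1 (UN Ux) _ _).
  rewrite subrr formNl formvv // oppr0 addr0; apply.
  - by case: px => y Uy xy; exists (- y); [exact: UN | rewrite !formE opprK].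
  - by rewrite (QN skew QD).
have eN (j : nat) : eichler 0 (j%:Z + j%:Z).
  elim: j => [|j IH].
    exists 1%:M => [|z]; first exact: grp1.
    by rewrite mulmx1 scaler0 form0l !addr0 mul0r scale0r addr0.
  have -> : j.+1%:Z + j.+1%:Z = 2 + (j%:Z + j%:Z) by lia.
  by have := eichlerD U0 U0 e2 IH; rewrite addr0 form0r addr0.
case: (intP c) => [|j|j]; rewrite ?addr0; [exact: (eN 0)|exact: eN|].
by rewrite -oppr0 -opprD; apply: eichlerN.
Qed.

(** When Q k = 0 the parity of m is forced: for <k, f> = 1, the image f + w + m k of f has Q-value Q
    f + Q w + m. Every such m is reached, because the generators of U realize one value of m and
    [eichler0_2] supplies the even corrections. *)
Lemma eichlerP w m : U w -> par m = Q w -> eichler w m.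
Proof.
move=> Uw pm.
suff [m' pm' e] : exists2 m', par m' = Q w & eichler w m'.
  have [|c cE] := @par_evenE (m - m'); first by rewrite !parE pm pm' addbb.
  by have := eichlerD Uw U0 e (eichler0_2 c); rewrite addr0 form0l addr0 -cE addrC subrK.
suff [] : U w /\ exists2 m', par m' = Q w & eichler w m' by [].
apply: (st_span st (P := fun w => U w /\ exists2 m', par m' = Q w & eichler w m')) Uw.
- split.
  + by split=> //; exists 0; [rewrite (Q0 QD) | exact: (eichler0_2 0)].
  + move=> u v [Uu [a pa eu]] [Uv [b pb ev]]; split; first exact: UD.
    exists (a + b + <<v, u>>); last exact: eichlerD.
    by rewrite !parE pa pb QD form_skew // parN.
  + move=> u [Uu [a pa eu]]; split; first exact: UN.
    by exists (- a); [rewrite parN (QN skew QD) | exact: eichlerN].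
- move=> v Xv; have [Uv Qv pv] := st_XU st Xv; split=> //.
  by exists 1; [rewrite Qv | exact: eichler1].
Qed.
End Eichler.

(** * Singular vectors of a unimodular lattice *)

Section SingularVectors.
Variables (n : nat) (Om : 'M[int]_n).
Hypothesis skew : Om^T = - Om.
Local Notation V := 'rV[int]_n.
Local Notation form := Defs.form.
Local Notation "<< u , v >>" := (form Om u v) (at level 0, format "<< u ,  v >>").
Variable Q : V -> bool.
Hypothesis QD : forall u v, Q (u + v) = Q u (+) Q v (+) par <<u, v>>.
Local Notation prim := (prim Om).
Variables (U X : V -> Prop) (p q : V).
Hypothesis st : stage Om Q U X.
Hypotheses (Up : U p) (Uq : U q) (Qp : Q p = false) (Qq : Q q) (pq : <<p, q>> = 1).

Let sU := st_sub st.
Let UD u v : U u -> U v -> U (u + v). Proof. by case: sU => _ h _; apply: h. Qed.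
Let UN u : U u -> U (- u). Proof. by case: sU => _ _ h; apply: h. Qed.

Let grp_U M u : grp Om X M -> U u -> U (u *m M).
Proof. by move=> gM; apply: grp_stab gM => // v /(st_XU st) []. Qed.
Let grp_Q' M u : grp Om X M -> Q (u *m M) = Q u.
Proof. by move=> gM; apply: grp_Q gM => // v /(st_XU st) []. Qed.

(** Transitivity carries q to w, and the image of p is then the desired s. *)
Lemma dual_singular w : U w -> prim U w -> Q w ->
  exists s, [/\ U s, prim U s, Q s = false & <<s, w>> = 1].
Proof.
move=> Uw pw Qw.
have prim_q : prim U q by exists (- p); [exact: UN | rewrite formNr form_skew // pq opprK].
have [|M gM <-] := st_tr st Uq Uw prim_q pw; first by rewrite Qq Qw.
exists (p *m M); split; first exact: grp_U.
- by exists (q *m M); [exact: grp_U | rewrite (grp_form skew _ _ gM)].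
- by rewrite grp_Q'.
- by rewrite (grp_form skew _ _ gM).
Qed.

(** Here p is carried to w. Its partner is the image of -(p + q), which is singular because Q p + Q
    q + <p, q> = 0 + 1 + 1. *)
Lemma pair_singular w : U w -> prim U w -> Q w = false ->
  exists s, [/\ U s, prim U s, Q s = false & <<s, w>> = 1].
Proof.
move=> Uw pw Qw; have prim_p : prim U p by exists q.
have [|M gM <-] := st_tr st Up Uw prim_p pw; first by rewrite Qp.
have h : <<- (p + q), p>> = 1 by rewrite !formE formvv // form_skew // pq.
exists (- (p + q) *m M); split; first exact/grp_U/UN/UD.
- exists (- q *m M); first exact/grp_U/UN.
  by rewrite (grp_form skew _ _ gM) !formE pq formvv.
- by rewrite grp_Q' // !(QE skew QD) Qp Qq pq.
- by rewrite (grp_form skew _ _ gM).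
Qed.

(** A generator v has Q v = 1. With s singular and <s, v> = 1, the vector v + s is singular too, and
    v = (v + s) - s. *)
Lemma singular_span (P : V -> Prop) : subgrp P ->
  (forall s, U s -> prim U s -> Q s = false -> P s) -> forall u, U u -> P u.
Proof.
move=> sP PS u Uu; apply: (st_span st sP) => // v Xv.
have [Uv Qv pv] := st_XU st Xv; have [s [Us ps Qs sv]] := dual_singular Uv pv Qv.
rewrite -(addrK s v); apply: subgrpB; [by []| |exact: PS].
apply: PS; first exact: UD.
  by exists v => //; rewrite formDl formvv // sv.
by rewrite QD Qv Qs form_skew // sv.
Qed.
End SingularVectors.

(** Only even multiples of b can be added in the descent, so a is reduced modulo 2b to absolute
    value at most |b|; the values 0 and |b| are excluded since b does not divide a. *)
Lemma centered_residue (a b : int) : b != 0 -> ~~ (b %| a)%Z ->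
  exists c : int, (0 < `|(a + (c + c) * b)%R| < `|b|)%N.
Proof.
move=> b0 nba.
have nb c : `|(a + c * b)%R|%N != `|b|%N /\ `|(a + c * b)%R|%N != 0%N.
  suff h d : a + c * b <> d * b by split; apply/eqP => e; [have := h 1; have := h (-1)|have := h 0]; lia.
  by move=> e; case/negP: nba; apply/dvdzP; exists (d - c); rewrite mulrBl -e addrK.
have rE := divz_eq a (b + b); set q := (a %/ (b + b))%Z in rE.
set r := (a %% (b + b))%Z in rE.
have r0 : 0 <= r by apply: modz_ge0; lia.
have rb : r < `|b + b| by apply: ltz_mod; lia.
have [rle|rgt] := lerP r `|b|.
  exists (- q); have e : a + (- q + - q) * b = r by rewrite rE; ring.
  by have := nb (- q + - q); rewrite e; lia.
have [b1|b1] := lerP 0 b.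
  exists (- q - 1); have e : a + (- q - 1 + (- q - 1)) * b = r - (b + b) by rewrite rE; ring.
  by have := nb (- q - 1 + (- q - 1)); rewrite e; lia.
exists (- q + 1); have e : a + (- q + 1 + (- q + 1)) * b = r + (b + b) by rewrite rE; ring.
by have := nb (- q + 1 + (- q + 1)); rewrite e; lia.
Qed.

(** The remainder 0 is replaced by a itself: the descent has to keep its second coordinate
    nonzero. *)
Lemma positive_residue (a b : int) : a != 0 ->
  exists m : int, (0 < `|(b - m * a)%R| <= `|a|)%N.
Proof.
move=> a0; have := divz_eq b a; set q := (b %/ a)%Z; set r := (b %% a)%Z => rE.
have r0 : 0 <= r by apply: modz_ge0.
have rb : r < `|a| by apply: ltz_mod.
have [r1|r1] := eqVneq r 0.
  by exists (q - 1); have -> : b - (q - 1) * a = a by [rewrite rE r1; ring]; lia.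
by exists q; have -> : b - q * a = r by [rewrite rE; ring]; lia.
Qed.

(** * Transitivity on the enlarged lattice *)

Section AddTwo.
Variables (n : nat) (Om : 'M[int]_n).
Hypothesis skew : Om^T = - Om.
Local Notation V := 'rV[int]_n.
Local Notation form := Defs.form.
Local Notation "<< u , v >>" := (form Om u v) (at level 0, format "<< u ,  v >>").
Variable Q : V -> bool.
Hypothesis QD : forall u v, Q (u + v) = Q u (+) Q v (+) par <<u, v>>.
Implicit Types (u v w z : V) (M S : 'M[int]_n) (a b c m : int).

Local Notation QE := (QE skew QD).
Local Notation grp := (grp Om).
Local Notation orb := (orb Om).
Local Notation prim := (prim Om).
Local Notation T := (Tv Om).

Definition add2 (X : V -> Prop) (e f v : V) := [\/ X v, v = e | v = f].

Variables (U X : V -> Prop) (x k f : V).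
Hypothesis st : stage Om Q U X.
Hypothesis kf : <<k, f>> = 1.
Hypothesis Uk : forall u, U u -> <<u, k>> = 0.
Hypothesis Uf : forall u, U u -> <<u, f>> = 0.
Hypothesis Qf : Q f.
Hypothesis Ux : U x.
Hypothesis Qe : Q (x + k).

Let sU := st_sub st.
Let U0 : U 0. Proof. by case: sU. Qed.
Let UD u v : U u -> U v -> U (u + v). Proof. by case: sU => _ h _; apply: h. Qed.
Let UN u : U u -> U (- u). Proof. by case: sU => _ _ h; apply: h. Qed.
Let UB u v : U u -> U v -> U (u - v). Proof. exact: subgrpB. Qed.
Let UZ c u : U u -> U (c *: u). Proof. exact: subgrpZ. Qed.
Let fk : <<f, k>> = -1. Proof. by rewrite form_skew // kf. Qed.
Let kk : <<k, k>> = 0. Proof. exact: formvv. Qed.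
Let ff : <<f, f>> = 0. Proof. exact: formvv. Qed.
Let kU u : U u -> <<k, u>> = 0. Proof. by move/Uk => h; rewrite form_skew // h oppr0. Qed.
Let fU u : U u -> <<f, u>> = 0. Proof. by move/Uf => h; rewrite form_skew // h oppr0. Qed.

Local Notation U' := (plus2 U k f).
Local Notation X' := (add2 X (x + k) f).
Local Notation tri u a b := (u + a *: k + b *: f).

Lemma add2_X v : X v -> X' v. Proof. by constructor 1. Qed.
Lemma add2_e : X' (x + k). Proof. by constructor 2. Qed.
Lemma add2_f : X' f. Proof. by constructor 3. Qed.

Lemma prim_f : prim U' f.
Proof.
by exists (- k); [case: (plus2_sub k f st) => _ _; apply; apply: plus2_k st | rewrite formNr fk opprK].
Qed.

Lemma add2_in v : X' v -> [/\ U' v, Q v & prim U' v].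
Proof.
case=> [Xv|->|->].
- have [Uv Qv [w Uw vw]] := st_XU st Xv; split=> //; first exact: plus2_U.
  by exists w => //; apply: plus2_U.
- split=> //.
    by exists x, 1, 0; rewrite scale1r scale0r addr0.
  by exists f; [apply: plus2_f st | rewrite formDl kf Uf].
- by split=> //; [apply: plus2_f st | apply: prim_f].
Qed.

Lemma add2_Q v : X' v -> Q v. Proof. by case/add2_in. Qed.
Lemma add2_U v : X' v -> U' v. Proof. by case/add2_in. Qed.

Lemma orb_U' v w : orb X' v w -> U' v -> U' w.
Proof.
by move=> [M gM <-]; apply: grp_stab gM => //; [apply: plus2_sub st | apply: add2_U].
Qed.

Lemma orb_prim v w : orb X' v w -> prim U' v -> prim U' w.
Proof.
move=> [M gM <-] [z Uz vz]; exists (z *m M); last by rewrite (grp_form skew _ _ gM).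
by apply: orb_U' Uz; exists M.
Qed.

(** Transitivity is tested against one representative for each value of Q. The orbit with Q = 1 must
    be that of f, since [plus2_full] normalizes f first; the representative r of the other orbit is
    arbitrary. *)
Lemma add2_stage (r : V) :
  (forall v, U' v -> prim U' v -> Q v -> orb X' v f) ->
  (forall v, U' v -> prim U' v -> Q v = false -> orb X' v r) -> stage Om Q U' X'.
Proof.
move=> tr1 tr0; split.
- exact: plus2_sub st.
- exact: add2_in.
- move=> P sP XP; apply: (plus2_span st) => // [v Xv||]; first by apply/XP/add2_X.
    rewrite -(addKr x k) addrC; apply: subgrpB => //; first exact/XP/add2_e.
    by apply: (st_span st) Ux => // v Xv; apply/XP/add2_X.
  exact/XP/add2_f.
- exact: (plus2_dual skew st kf Uk Uf).
- exact: (plus2_content skew st kf Uk Uf).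
- move=> v w Uv Uw pv pw Qvw; case Qv: (Q v).
    by apply: (orb_trans (tr1 v Uv pv Qv)); apply/(orb_sym skew)/tr1; rewrite -?Qvw.
  by apply: (orb_trans (tr0 v Uv pv Qv)); apply/(orb_sym skew)/tr0; rewrite -?Qvw.
- move=> S; apply: (plus2_full skew QD st) => // [v|v|]; first exact: add2_X.
    by case/add2_in.
  exact: add2_f.
Qed.

Lemma form_kf_tri u a b : U u -> (<<k, tri u a b>> = b) * (<<f, tri u a b>> = - a).
Proof. by move=> Uu; rewrite !formE kU // fU // kf fk kk ff; split; ring. Qed.

Lemma form_U_tri u a b w : U u -> U w -> <<w, tri u a b>> = <<w, u>>.
Proof. by move=> Uu Uw; rewrite !formE Uf // Uk // !mulr0 !addr0. Qed.

Lemma move_f m u a b b' : U u -> b' = b - m * a -> orb X' (tri u a b) (tri u a b').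
Proof.
move=> Uu ->; apply: (orb_step skew (z := f) (m := m)); first exact/grpT/add2_f.
by rewrite form_kf_tri //; apply/rowP => i; rewrite !mxE; ring.
Qed.

Section SingularK.
Hypothesis px : prim U x.
Hypothesis Qx : Q x.

Let eich w m : U w -> par m = Q w -> eichler Om X' k w m.
Proof. by apply: (eichlerP skew QD st Uk add2_X add2_e Ux px Qx). Qed.

Lemma move_eichler w m u a b u' a' : U w -> U u -> par m = Q w ->
  u' = u + b *: w -> a' = a + <<w, u>> + m * b -> orb X' (tri u a b) (tri u' a' b).
Proof.
move=> Uw Uu pm -> ->; have [M gM hM] := eich Uw pm; exists M => //.
rewrite hM form_kf_tri // form_U_tri //.
by apply/rowP => i; rewrite !mxE; ring.
Qed.

Lemma move_2k c u a b a' : U u -> a' = a + (c + c) * b -> orb X' (tri u a b) (tri u a' b).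
Proof.
move=> Uu ->; apply: (@move_eichler 0 (c + c)) => //.
- by rewrite parD addbb (Q0 QD).
- by rewrite scaler0 addr0.
- by rewrite form0l addr0.
Qed.

(** The sign changes on a detour through u = -x: there a = -1, so a move along f turns b = -1 into
    1, and a second Eichler transformation along x removes u and a together. *)
Lemma orb_sign_f : orb X' (tri 0 0 (-1)) (tri 0 0 1).
Proof.
apply: (@orb_trans _ _ _ _ (tri (- x) (-1) (-1))).
  apply: (@move_eichler x 1) => //; first by rewrite add0r scaleN1r.
  by rewrite form0r; ring.
apply: (@orb_trans _ _ _ _ (tri (- x) (-1) 1)).
  by apply: (@move_f 2) => //; exact: UN.
apply: (@move_eichler x 1) => //; [exact: UN|by rewrite scale1r addNr|].
by rewrite formNr formvv.
Qed.

Lemma orb_sign_kf : orb X' (tri 0 (-1) (-1)) (tri 0 1 1).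
Proof.
apply: (@orb_trans _ _ _ _ (tri 0 1 (-1))); first exact: (@move_2k (-1)).
exact: (@move_f (-2)).
Qed.

(* Descent on [|b|]: primitivity yields an Eichler transformation after which [b] does not
   divide [a], unless [|b| = 1]. *)
Lemma orb_descent u a b : U u -> prim U' (tri u a b) -> b != 0 ->
  orb X' (tri u a b) (tri 0 0 1) \/ orb X' (tri u a b) (tri 0 1 1).
Proof.
have [N] := ubnP `|b|%N; elim: N => // N IH in u a b *.
move=> bN Uu pv b0; case: (ltngtP `|b|%N 1) => [||b1]; [lia| |].
  move=> b1.
  suff [u' [a' [b' [Uu' o /andP[b'0 b'b]]]]] : exists u' a' b',
      [/\ U u', orb X' (tri u a b) (tri u' a' b') & (0 < `|b'| < `|b|)%N].
    have [] := IH u' a' b'; rewrite ?(leq_trans b'b) //; [exact: orb_prim pv|lia| |].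
      by left; apply: orb_trans o _.
    by right; apply: orb_trans o _.
  have step u1 a1 : U u1 -> ~~ (b %| a1)%Z -> exists u' a' b',
      [/\ U u', orb X' (tri u1 a1 b) (tri u' a' b') & (0 < `|b'| < `|b|)%N].
    move=> Uu1 /(centered_residue b0) [c hc].
    have a20 : a1 + (c + c) * b != 0 by lia.
    have [m hm] := positive_residue b a20.
    exists u1, (a1 + (c + c) * b), (b - m * (a1 + (c + c) * b)); split=> //; last lia.
    by apply: orb_trans (@move_2k c u1 a1 b _ _ erefl) (@move_f m _ _ _ _ _ erefl).
  have [ba|] := boolP (b %| a)%Z; last exact: step.
  have [w [c [d [Uw hw]]]] := (prim_plus2 skew kf Uk Uf a b Uu).1 pv.
  have nbw : ~~ (b %| <<u, w>>)%Z.
    apply/negP => h; have : (b %| <<u, w>> + a * d - b * c)%Z.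
      by rewrite rpredB ?rpredD // dvdz_mulr.
    by rewrite hw dvdz1; lia.
  have [m pm] : exists m, par m = Q w by exists (Q w : nat); case: (Q w).
  have [|u' [a' [b' [Uu' o h]]]] := step (u + b *: w) (a + <<w, u>> + m * b) (UD Uu (UZ _ Uw)).
    by rewrite rpredDr ?dvdz_mull // rpredDl // form_skew // rpredN.
  exists u', a', b'; split=> //; apply: orb_trans o.
  exact: (@move_eichler w m).
(* With b c = -1, the Eichler transformation along c u cancels the component u. *)
have [c cE] : exists c, b * c = -1 by exists (- b); lia.
have [m pm] : exists m, par m = Q (c *: u) by exists (Q (c *: u) : nat); case: (Q _).
set a1 := a + <<c *: u, u>> + m * b.
have o1 : orb X' (tri u a b) (tri 0 a1 b).
  by apply: (@move_eichler (c *: u) m) => //; [exact: UZ | rewrite scalerA cE scaleN1r subrr].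
(* Moves along k change a by even multiples of b only, so two residues survive: 0 and b. *)
clearbody a1; have [a2 a2b [d dE]] : exists2 a2, a2 = 0 \/ a2 = b & exists d, a2 = a1 + (d + d) * b.
  have bb : b * b = 1 by lia.
  have ev e : par e = par a1 -> exists d, e = a1 + (d + d) * b.
    move=> pe; have [|d dE] := @par_evenE (e - a1); first by rewrite !parE pe addbb.
    exists (d * b); rewrite -mulrDl -dE -mulrA bb; ring.
  case pa: (par a1); [exists b; [by right|apply: ev] | exists 0; [by left|apply: ev]].
    by rewrite pa /par; lia.
  by rewrite pa.
have o2 : orb X' (tri u a b) (tri 0 a2 b) by apply: orb_trans o1 (@move_2k d _ _ _ _ U0 dE).
have [b1'|b1'] : b = 1 \/ b = -1 by lia.
  by case: a2b o2 => ->; rewrite b1'; auto.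
case: a2b o2 => ->; rewrite b1' => o2; [left|right]; apply: orb_trans o2 _.
  exact: orb_sign_f.
exact: orb_sign_kf.
Qed.

(** The descent ends in f or k + f. Since Q k = 0, these have Q-values 1 and 0, so Q alone tells
    which of the two is reached. *)
Lemma singular_stage : stage Om Q U' X'.
Proof.
have o v : U' v -> prim U' v -> orb X' v (tri 0 0 1) \/ orb X' v (tri 0 1 1).
  move=> [u [a [b [Uu ->]]]] pv.
  have [b0|b0] := eqVneq b 0; last exact: orb_descent.
  (* If b = 0, the coordinate a is first made nonzero; a move along f then copies it into b, and the
     descent can start. *)
  suff [u' [a' [Uu' a'0 ov]]] : exists u' a', [/\ U u', a' != 0 & orb X' (tri u a b) (tri u' a' b)].
    have ov2 : orb X' (tri u a b) (tri u' a' a').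
      by apply: orb_trans ov (@move_f (-1) _ _ _ _ _ _) => //; rewrite b0; ring.
    have [o|o] := @orb_descent u' a' a' Uu' (orb_prim ov2 pv) a'0.
      by left; apply: orb_trans o.
    by right; apply: orb_trans o.
  have [a0|a0] := eqVneq a 0; last by exists u, a; split=> //; apply: orb_refl.
  have [w [c [d [Uw hw]]]] := (prim_plus2 skew kf Uk Uf a b Uu).1 pv.
  have [m pm] : exists m, par m = Q w by exists (Q w : nat); case: (Q w).
  exists u, (a + <<w, u>> + m * b); split=> //.
    by move: hw; rewrite (form_skew _ w) // a0 b0; lia.
  by apply: (@move_eichler w m) => //; rewrite b0 scale0r addr0.
have Qk : Q k = false.
  by move: Qe; rewrite QD Qx Uk // par0; case: (Q k).
apply: (@add2_stage (tri 0 1 1)) => v Uv pv Qv.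
  have [ov|ov] := o v Uv pv; first by move: ov; rewrite scale0r scale1r !add0r.
  have := orb_Q skew QD add2_Q ov; rewrite Qv.
  by rewrite (Q_plus2 skew QD kf Uk Uf Qf) // Qk (Q0 QD).
have [ov|//] := o v Uv pv; have := orb_Q skew QD add2_Q ov; rewrite Qv.
by rewrite scale0r scale1r !add0r Qf.
Qed.
End SingularK.

Section WithTk.
Hypothesis gk : grp X' (T k).

Lemma move_k m u a b a' : U u -> a' = a + m * b -> orb X' (tri u a b) (tri u a' b).
Proof.
move=> Uu ->; apply: (orb_step skew (z := k) (m := m)) => //.
by rewrite form_kf_tri //; apply/rowP => i; rewrite !mxE; ring.
Qed.

(** T_k and T_f act on the coordinates (a, b) by the two kinds of elementary matrices, so the
    Euclidean algorithm runs inside the plane; the case a = 0 only adjusts the sign of b. *)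
Lemma orb_gcd u a b : U u -> orb X' (tri u a b) (tri u 0 (gcdz a b)).
Proof.
move=> Uu; have [N] := ubnP `|a|%N; elim: N => // N IH in a b *.
move=> aN; have [->|a0] := eqVneq a 0.
  rewrite gcd0z; have [b0|b0] := lerP 0 b.
    by have -> : Posz `|b|%N = b by [lia]; exact: orb_refl.
  have -> : Posz `|b|%N = - b by lia.
  apply: (@orb_trans _ _ _ _ (tri u b b)); first by apply: (@move_k 1); rewrite // add0r mul1r.
  apply: (@orb_trans _ _ _ _ (tri u b (- b))); first by apply: (@move_f 2) => //; ring.
  by apply: (@move_k 1) => //; ring.
have bE := divz_eq b a; have r0 : 0 <= (b %% a)%Z by apply: modz_ge0.
have rb : (b %% a)%Z < `|a| by apply: ltz_mod.
set q := (b %/ a)%Z in bE; set r := (b %% a)%Z in bE r0 rb.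
apply: (@orb_trans _ _ _ _ (tri u a r)); first by apply: (@move_f q) => //; rewrite bE; ring.
(* Three elementary moves make the quarter turn from (a, r) to (r, -a), which puts the remainder in
   the place of a. *)
apply: (@orb_trans _ _ _ _ (tri u (a + r) r)); first by apply: (@move_k 1); rewrite // mul1r.
apply: (@orb_trans _ _ _ _ (tri u (a + r) (- a))).
  by apply: (@move_f 1) => //; ring.
apply: (@orb_trans _ _ _ _ (tri u r (- a))); first by apply: (@move_k 1) => //; ring.
have -> : gcdz a b = gcdz r (- a) by rewrite gcdzN gcdz_modl gcdzC.
by apply: IH; lia.
Qed.
End WithTk.

(** Start of the chain. Here Q k = Q f = 1, so every primitive vector of the plane has Q-value 1 and
    there is a single orbit; the representative 0 for Q-value 0 is vacuous. *)
Lemma plane_stage : x = 0 -> (forall u, U u -> u = 0) -> stage Om Q U' X'.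
Proof.
move=> x0 Un; have gk : grp X' (T k) by by apply: grpT; constructor 2; rewrite x0 add0r.
have o v : U' v -> prim U' v -> orb X' v f.
  move=> [u [a [b [Uu ->]]]] pv; have ov := orb_gcd gk a b Uu.
  have [w [c [d [/Un-> hw]]]] := (prim_plus2 skew kf Uk Uf _ _ Uu).1 (orb_prim ov pv).
  suff g1 : gcdz a b = 1 by move: ov; rewrite g1 (Un u Uu) scale0r scale1r !add0r.
  have : (gcdz a b %| 0 * d - gcdz a b * c)%Z by rewrite rpredB ?mul0r ?dvdz0 ?dvdz_mulr.
  move: hw; rewrite form0r add0r => ->; rewrite dvdz1.
  by have : 0 <= gcdz a b by []; move: (gcdz a b) => g; lia.
apply: (@add2_stage 0) => v Uv pv Qv; first exact: o.
by have := orb_Q skew QD add2_Q (o v Uv pv); rewrite Qv Qf.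
Qed.

Section NonsingularK.
Hypothesis px : prim U x.
Hypothesis Qx : Q x = false.
Variables p q r : V.
Hypotheses (Up : U p) (Uq : U q) (Ur : U r).
Hypotheses (Qp : Q p = false) (Qq : Q q) (Qr : Q r = false).
Hypotheses (pq : <<p, q>> = 1) (pr : <<p, r>> = 0) (qr : <<q, r>> = 0).
Hypothesis pr_r : prim U r.

Let Qk : Q k. Proof. by move: Qe; rewrite QD Qx Uk // par0 addbF. Qed.

Let D0 s : U s -> prim U s -> Q s = false -> grp X' (T (s + k)).
Proof. by move=> Us ps Qs; apply: (T_transport skew st Uk add2_X add2_e Ux px); rewrite // Qs. Qed.

Let move_s s m u a b u' a' : U s -> prim U s -> Q s = false -> U u ->
  u' = u + (m * (<<s, u>> + b)) *: s -> a' = a + m * (<<s, u>> + b) ->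
  orb X' (tri u a b) (tri u' a' b).
Proof.
move=> Us ps Qs Uu -> ->; apply: (orb_step skew (m := m) (D0 Us ps Qs)).
rewrite formDl form_kf_tri // form_U_tri //.
by apply/rowP => i; rewrite !mxE; ring.
Qed.

Let prim_p : prim U p. Proof. by exists q. Qed.

(* As [r] is singular and orthogonal to [p], [p + f] lies in the orbit of [p + r + k], and [k] is
   the image of [p + k + f] under T_{p+f}. *)
Let gk : grp X' (T k).
Proof.
have gf : grp X' (T f) by apply/grpT/add2_f.
have Uy : U (p + r) by apply: UD.
have py : prim U (p + r) by exists q => //; rewrite formDl pq form_skew // qr oppr0 addr0.
have Qy : Q (p + r) = false by rewrite QD Qp Qr pr.
have tri10 u : u + k = tri u 1 0 by rewrite scale1r scale0r addr0.
have gpf : grp X' (T (p + f)).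
  apply: orb_T (D0 Uy py Qy) => //; rewrite (tri10 (p + r)).
  apply: (@orb_trans _ _ _ _ (tri (p + r) 1 1)); first by apply: (@move_f (-1)).
  have -> : p + f = tri p 0 1 by rewrite scale1r scale0r addr0.
  have rpr : <<r, p + r>> = 0 by rewrite formDr formvv // form_skew // pr.
  apply: (@move_s r (-1)); rewrite ?rpr //.
  by apply/rowP => i; rewrite !mxE; ring.
apply: orb_T (D0 Up prim_p Qp) => //; rewrite (tri10 p).
apply: (@orb_trans _ _ _ _ (tri p 1 1)); first by apply: (@move_f (-1)).
apply: (orb_step skew (m := 1) gpf).
rewrite formDl form_kf_tri // form_U_tri // formvv //.
by apply/rowP => i; rewrite !mxE; ring.
Qed.

Let o_gcd u a b : U u -> orb X' (tri u a b) (tri u 0 (gcdz a b)).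
Proof. exact: orb_gcd. Qed.

Let dual_singular := dual_singular skew QD st Up Uq Qp Qq pq.
Let pair_singular := pair_singular skew QD st Up Uq Qp Qq pq.
Let singular_span := singular_span skew QD st Up Uq Qp Qq pq.

(** Descent on g = gcd(a, b). If g is not 1, primitivity prevents g from dividing all <w, u>; as
    singular vectors span U, it fails to divide <s, u> for some singular s. T_{s+k} then turns (0,
    g) into (<s, u> + g, g), whose gcd is a proper divisor of g. *)
Let orb_one u a b : U u -> prim U' (tri u a b) -> (a, b) <> (0, 0) ->
  exists2 w, U w & orb X' (tri u a b) (tri w 0 1).
Proof.
have [N] := ubnP (gcdn `|a| `|b|); elim: N => // N IH in u a b *.
move=> gN Uu pv ab0; have og := o_gcd a b Uu.
have pg := orb_prim og pv; set g := gcdz a b in og pg.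
have g0 : g != 0 by rewrite gcdz_eq0; apply/negP => /andP[/eqP a0 /eqP b0]; case: ab0; rewrite a0 b0.
have gN' : (`|g| < N.+1)%N by [].
have g_ge0 : 0 <= g by [].
clearbody g.
have [g1|g1] := eqVneq g 1; first by exists u; rewrite // -g1.
have [w [c [d [Uw hw]]]] := (prim_plus2 skew kf Uk Uf _ _ Uu).1 pg.
suff [s [Us ps Qs ngs]] : exists s, [/\ U s, prim U s, Q s = false & ~~ (g %| <<s, u>>)%Z].
  set t := <<s, u>> in ngs.
  have os : orb X' (tri u a b) (tri (u + (t + g) *: s) (t + g) g).
    apply: orb_trans og _; apply: (@move_s s 1) => //; rewrite ?mul1r //.
    by rewrite add0r.
  have [||||w' Uw' ow'] := IH (u + (t + g) *: s) (t + g) g.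
  - have dg : (gcdn `|(t + g)%R| `|g| %| `|g|)%N by apply: dvdn_gcdr.
    have : gcdn `|(t + g)%R| `|g| != `|g|%N.
      apply: contra ngs => /eqP e; have : (g %| t + g)%Z by rewrite dvdzE -{1}e dvdn_gcdl.
      by rewrite rpredDr.
    have : (gcdn `|(t + g)%R| `|g| <= `|g|)%N by apply: dvdn_leq => //; lia.
    lia.
  - exact/UD/UZ.
  - exact: orb_prim os pv.
  - by move=> [_ e]; move: g0; rewrite e eqxx.
  - by exists w' => //; apply: orb_trans os ow'.
pose E := exists s, [/\ U s, prim U s, Q s = false & ~~ (g %| <<s, u>>)%Z].
have [//|gw] : E \/ (g %| <<w, u>>)%Z.
  apply: (singular_span (P := fun v => E \/ (g %| <<v, u>>)%Z)) Uw.
    split=> [|v v' [e|hv] [e'|hv']|v [e|hv]]; try by left.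
    - by right; rewrite form0l dvdz0.
    - by right; rewrite formDl rpredD.
    - by right; rewrite formNl rpredN.
  move=> s Us ps Qs; have [|ns] := boolP (g %| <<s, u>>)%Z; [by right|left].
  by exists s.
have : (g %| <<u, w>> + 0 * d - g * c)%Z.
  by rewrite mul0r addr0 rpredB ?dvdz_mulr // form_skew // rpredN.
by rewrite hw dvdz1; lia.
Qed.

(** With b = 1 a power of T_k resets the coordinate a to 0, so only the component in U has to be
    followed. *)
Let move_1 s m u u' : U s -> prim U s -> Q s = false -> U u ->
  u' = u + (m * (<<s, u>> + 1)) *: s -> orb X' (tri u 0 1) (tri u' 0 1).
Proof.
move=> Us ps Qs Uu u'E; have Uu' : U u' by rewrite u'E; apply/UD/UZ.
apply: orb_trans (@move_s s m u 0 1 u' _ Us ps Qs Uu u'E erefl) _.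
by apply: (move_k gk (m := - (0 + m * (<<s, u>> + 1)))) => //; ring.
Qed.

Let orb_singular c w : U w -> prim U w -> Q w = false -> orb X' (tri (c *: w) 0 1) (tri 0 0 1).
Proof.
move=> Uw pw Qw; apply: (@move_1 w (- c)) => //; first exact: UZ.
by rewrite !formE formvv // mulr0 add0r mulr1 scaleNr subrr.
Qed.

(* For [<s, w> = 1], [c *: w + (c + 1) *: s] is primitive. *)
Let orb_primitive c w : U w -> prim U w -> Q w -> exists w',
  [/\ U w', prim U w', Q w' = par c & orb X' (tri (c *: w) 0 1) (tri w' 0 1)].
Proof.
move=> Uw pw Qw; have [s [Us ps Qs sw]] := dual_singular Uw pw Qw.
have ws : <<w, s>> = -1 by rewrite form_skew // sw.
exists (c *: w + (c + 1) *: s); split.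
- by apply: UD; apply: UZ.
- by exists (w + s); [exact: UD | rewrite !formE !formvv // ws sw; ring].
- by rewrite !QE Qw Qs !formE ws !parE; case: (par c).
- apply: (@move_1 s 1) => //; first exact: UZ.
  by rewrite formZr sw; congr (_ + _ *: _); ring.
Qed.

(** Every primitive vector is moved to u + f with u in U, where Q (u + f) = 1 + Q u. If Q u = 0 then
    u can be removed, which ends in f; if Q u = 1 it can be made primitive and carried to q inside
    U, which ends in q + f. *)
Lemma nonsingular_stage : stage Om Q U' X'.
Proof.
have o1 v : U' v -> prim U' v -> exists c w, [/\ U w, prim U w & orb X' v (tri (c *: w) 0 1)].
  move=> [u [a [b [Uu ->]]]] pv.
  suff [u' [a' [b' [Uu' ov ab0]]]] : exists u' a' b',
      [/\ U u', orb X' (tri u a b) (tri u' a' b') & (a', b') <> (0, 0)].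
    have [w Uw ow] := orb_one Uu' (orb_prim ov pv) ab0.
    have {}ov := orb_trans ov ow.
    case: (st_content st Uw) => [w0|[c [w' [Uw' pw' wE]]]].
      by exists 0, p; have -> : 0 *: p = w by rewrite w0 scale0r.
    by exists c, w'; split=> //; rewrite -wE.
  case: (eqVneq a 0) => [a0|a0]; last first.
    by exists u, a, b; split=> //; [exact: orb_refl | case=> /eqP; rewrite (negbTE a0)].
  case: (eqVneq b 0) => [b0|b0]; last first.
    by exists u, a, b; split=> //; [exact: orb_refl | case=> _ /eqP; rewrite (negbTE b0)].
  (* With a = b = 0 the vector u is itself primitive, and T_{s+k} for a singular s with <s, u> = 1
     makes a = 1. *)
  have [w [c [d [Uw hw]]]] := (prim_plus2 skew kf Uk Uf a b Uu).1 pv.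
  have pu : prim U u by exists w => //; move: hw; rewrite a0 b0; lia.
  have [s [Us ps Qs su]] : exists s, [/\ U s, prim U s, Q s = false & <<s, u>> = 1].
    by case Qu: (Q u); [apply: dual_singular | apply: pair_singular].
  exists (u + s), 1, 0; split=> //; first exact: UD.
  by rewrite a0 b0; apply: (@move_s s 1); rewrite // su ?scale1r.
have Qtri u : U u -> Q (tri u 0 1) = ~~ Q u.
  by move=> Uu; rewrite (Q_plus2 skew QD kf Uk Uf Qf) // par0 par1; case: (Q u).
have tri_f : tri 0 0 1 = f by rewrite scale0r scale1r !add0r.
apply: (@add2_stage (tri q 0 1)) => v Uv pv Qv; have [c [w [Uw pw ov]]] := o1 v Uv pv;
  have := orb_Q skew QD add2_Q ov; rewrite Qv Qtri ?(QZ skew QD); try exact: UZ.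
- move=> h; suff : orb X' v (tri 0 0 1) by rewrite tri_f.
  apply: orb_trans ov _.
  case Qw: (Q w) h => h; last exact: orb_singular.
  have [w' [Uw' pw' Qw' ow']] := orb_primitive c Uw pw Qw.
  apply: orb_trans ow' _; rewrite -[w']scale1r; apply: orb_singular => //.
  by rewrite Qw'; move: h; rewrite andbT; case: (par c).
- case Qw: (Q w); rewrite ?andbF ?andbT // => h.
  have [w' [Uw' pw' Qw' ow']] := orb_primitive c Uw pw Qw.
  apply: orb_trans ov (orb_trans ow' _).
  have [||M gM <-] := st_tr st Uw' Uq pw'.
  + by exists (- p); [exact: UN | rewrite formNr form_skew // pq opprK].
  + by rewrite Qw' Qq; move: h; case: (par c).
  exists M; first by apply: grp_subset gM => //; apply: add2_X.
  have fM : f *m M = f.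
    by apply: (grp_fix skew _ gM) => u Xu; apply: Uf; case: (st_XU st Xu).
  by rewrite !scale0r !addr0 !scale1r mulmxDl fM.
Qed.
End NonsingularK.
End AddTwo.

(** * Chains of letters *)

Definition letter n (i : nat) : 'rV[int]_n := \row_j ((val j == i)%:R).

(* Both families have the same shape: letters [i < j] pair to [1] unless [i] is in {1, 2} and
   [j] in {3, ..., c - 1} (0-based), with [c = 5] for tau and [c = 7] for sigma. *)
Definition nonadjacent (c i j : nat) := [&& (0 < i)%N, (i < 3)%N, (2 < j)%N & (j < c)%N].

Definition pairing (c i j : nat) : int :=
  if (i < j)%N then (if nonadjacent c i j then 0 else 1)
  else if (j < i)%N then (if nonadjacent c j i then 0 else -1) else 0.

Ltac pairing_cases := rewrite /pairing /nonadjacent; 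
  repeat match goal with |- context [if ?b then _ else _] => destruct b eqn:? end; lia.

Section Letters.
Variables (n c : nat) (Om : 'M[int]_n).
Hypothesis skew : Om^T = - Om.
Local Notation V := 'rV[int]_n.
Local Notation form := Defs.form.
Local Notation "<< u , v >>" := (form Om u v) (at level 0, format "<< u ,  v >>").
Variable Q : V -> bool.
Hypothesis QD : forall u v, Q (u + v) = Q u (+) Q v (+) par <<u, v>>.
Local Notation E := (letter n).
Hypothesis form_letter : forall i j, (i < n)%N -> (j < n)%N -> <<E i, E j>> = pairing c i j.
Hypothesis Q_letter : forall i, (i < n)%N -> Q (E i).
Hypotheses (c_odd : odd c) (c_ge5 : (5 <= c)%N) (c_lt : (c < n)%N).
Implicit Types (u v w z : V) (L : pred nat).

Local Notation grp := (grp Om).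
Local Notation orb := (orb Om).
Local Notation prim := (prim Om).
Local Notation T := (Tv Om).

Definition letters (v : V) := exists2 i, (i < n)%N & v = E i.
Definition span L (v : V) := forall j : 'I_n, ~~ L j -> v 0 j = 0.

Lemma span_sub L : subgrp (span L).
Proof.
split=> [j _|u v hu hv j Lj|u hu j Lj]; rewrite !mxE ?hu ?hv ?addr0 ?oppr0 //.
Qed.

Lemma span_letter L i : L i -> span L (E i).
Proof.
by move=> Li j Lj; rewrite mxE; case: eqP => // ji; rewrite -ji (negbTE Lj) in Li.
Qed.

Lemma sum_letters v : v = \sum_j v 0 j *: E (val j).
Proof.
rewrite {1}[v]row_sum_delta; apply: eq_bigr => j _; congr (_ *: _).
by apply/rowP => i; rewrite !mxE eqxx.
Qed.

Lemma span_ind L (P : V -> Prop) : subgrp P -> (forall i, (i < n)%N -> L i -> P (E i)) ->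
  forall v, span L v -> P v.
Proof.
move=> sP PE v hv; rewrite (sum_letters v); elim/big_ind: _ => [|u w|j _].
- by case: sP.
- by case: sP => _ h _; apply: h.
have [Lj|Lj] := boolP (L j); first by apply: (subgrpZ _ sP); apply: PE; rewrite ?ltn_ord.
by rewrite hv // scale0r; case: sP.
Qed.

Lemma perp_sub w : subgrp (fun u => <<u, w>> = 0).
Proof.
split=> [|u v hu hv|u hu]; first exact: form0l.
- by rewrite formDl hu hv.
- by rewrite formNl hu oppr0.
Qed.

Lemma span_perp L w : (forall i, (i < n)%N -> L i -> <<E i, w>> = 0) ->
  forall u, span L u -> <<u, w>> = 0.
Proof. by move=> h u; apply: (span_ind (perp_sub w)). Qed.

(** The generators X of a stage are letters and differences E_j - E_i. It is only asked that their
    transvections be products of letter transvections. *)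
Definition staged L := exists2 X : V -> Prop, stage Om Q (span L) X &
  forall v, X v -> grp letters (T v).

Lemma stage_ext U U2 X : (forall v, U v <-> U2 v) -> stage Om Q U X -> stage Om Q U2 X.
Proof.
move=> e [sU XU sp du co tr fu].
have pe v : prim U v <-> prim U2 v by split=> -[w /e Uw h]; exists w.
split.
- case: sU => U0 UD UN; split=> [|u v|u]; rewrite -?e; [exact: U0|exact: UD|exact: UN].
- by move=> v /XU [/e Uv Qv /pe pv].
- by move=> P sP XP v /e; apply: sp.
- by move=> d; have [w /e Uw h] := du d; exists w => // u /e; apply: h.
- move=> u /e /co [|[d [w [/e Uw /pe pw uE]]]]; first by left.
  by right; exists d, w.
- by move=> v w /e Uv /e Uw /pe pv /pe pw; apply: tr.
- move=> S iS QS US zS; apply: fu => // [u /e /US /e //|z hz].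
  by apply: zS => u /e; apply: hz.
Qed.

Lemma letter_unit i : (i < n)%N -> grp letters (T (E i)).
Proof. by move=> lt_in; apply: grpT; exists i. Qed.

Definition add_letters L i j : pred nat := fun l => [|| L l, l == i | l == j].

Lemma span_add L i j k x f : (i < n)%N -> (j < n)%N -> i != j -> ~~ L i -> ~~ L j ->
  span L x -> x + k = E i -> f = E j - E i ->
  forall v, plus2 (span L) k f v <-> span (add_letters L i j) v.
Proof.
move=> lt_in lt_jn ij Li Lj Lx /(canRL (addKr x)) -> -> v.
have sL := span_sub L; split=> [[u [a [b [Lu ->]]]] l|hv].
  rewrite /add_letters !negb_or => /and3P[Ll li lj].
  by rewrite !mxE Lu // Lx // (negbTE li) (negbTE lj) /= mulr0n; ring.
pose vi := v 0 (Ordinal lt_in); pose vj := v 0 (Ordinal lt_jn).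
exists (v - vi *: E i - vj *: E j + (vi + vj) *: x), (vi + vj), vj; split.
  case: (sL) => _ LD _; apply: LD; last exact: (subgrpZ _ sL).
  move=> l Ll; rewrite !mxE.
  have [li|li] := eqVneq (val l) i.
    have -> : v 0 l = vi by congr (v 0 _); apply: val_inj.
    by rewrite li (negbTE ij) mulr1 mulr0 subr0 subrr.
  have [lj|lj] := eqVneq (val l) j.
    have -> : v 0 l = vj by congr (v 0 _); apply: val_inj.
    by rewrite mulr1 mulr0 subr0 subrr.
  by rewrite hv ?mulr0 ?subr0 // /add_letters !negb_or Ll li.
by apply/rowP => l; rewrite !mxE; ring.
Qed.

(** The plane is spanned by k = E_i - x and f = E_j - E_i: k is orthogonal to U because x represents
    E_i on U, and f because both letters pair alike with U. As f is the image of E_j under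
    T_{E_i}^-1, its transvection is a conjugate of a letter transvection. The last hypothesis stays
    open because the applicable stage theorem depends on x. *)
Lemma staged_add L x i j : staged L -> (i < n)%N -> (j < n)%N -> ~~ L i -> ~~ L j ->
  <<E i, E j>> = 1 -> (forall l, (l < n)%N -> L l -> <<E l, E i>> = <<E l, E j>>) ->
  span L x -> (forall u, span L u -> <<u, x>> = <<u, E i>>) ->
  (forall X k f, stage Om Q (span L) X -> <<k, f>> = 1 ->
      (forall u, span L u -> <<u, k>> = 0) -> (forall u, span L u -> <<u, f>> = 0) ->
      Q f -> span L x -> Q (x + k) -> stage Om Q (plus2 (span L) k f) (add2 X (x + k) f)) ->
  staged (add_letters L i j).
Proof.
move=> [X st XE] lt_in lt_jn Li Lj Eij Lij Lx xE step.
have ij : i != j by apply/eqP => e; move: Eij; rewrite e formvv.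
pose k := E i - x; pose f := E j - E i.
have xk : x + k = E i by rewrite /k addrC subrK.
have Lf u : span L u -> <<u, f>> = 0.
  by apply: span_perp => l lt_ln Ll; rewrite formDr formNr Lij // subrr.
have Lk u : span L u -> <<u, k>> = 0 by move=> Lu; rewrite formDr formNr xE // subrr.
have kf : <<k, f>> = 1 by rewrite formDl formNl (Lf x) // subr0 formDr formNr formvv // subr0.
have Qf : Q f by rewrite QD (QN skew QD) !Q_letter // formNr parN form_skew // Eij.
exists (add2 X (x + k) f).
  apply: (@stage_ext (plus2 (span L) k f)); first exact: span_add xk _.
  by apply: step; rewrite ?xk ?Q_letter.
have -> : f = E j *m invmx (T (E i)) by rewrite mul_TvV // Eij scale1r.
move=> v [/XE//|->|->]; first by rewrite xk; apply: letter_unit.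
by apply: (grp_Tconj skew); [apply: (grpV skew)|]; apply: letter_unit.
Qed.

Lemma staged0 : staged pred0.
Proof.
have z v : span pred0 v -> v = 0 by move=> hv; apply/rowP => j; rewrite hv // mxE.
exists (fun _ => False) => //; split=> //.
- exact: span_sub.
- by move=> P [P0 _ _] _ v /z ->.
- by move=> d; exists 0; [case: (span_sub pred0) | move=> u /z ->; rewrite form0l mul0mx mxE].
- by move=> u /z; left.
- by move=> v w /z -> _ [y _]; rewrite form0l.
- move=> S _ _ _ zS; have -> : S = 1%:M; last exact: grp1.
  by apply: eq_mulmx_row => v; rewrite mulmx1; apply: zS => u /z ->; apply: form0r.
Qed.

Lemma staged_ext L L' : staged L -> (forall l, (l < n)%N -> L l = L' l) -> staged L'.
Proof.
move=> [X st XE] e; exists X => //; apply: stage_ext st => v.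
by split=> hv j; [rewrite -e ?ltn_ord //|rewrite e ?ltn_ord //]; apply: hv.
Qed.

Local Notation x0 := (E 0%N + E c).

Let Q_x0 : Q x0.
Proof.
have lt0n : (0 < n)%N by lia.
rewrite QD !Q_letter // form_letter //.
by rewrite (_ : pairing c 0%N c = 1) //; pairing_cases.
Qed.

(** The vector E_0 + E_c pairs to zero with every letter strictly between 0 and c, since <E_l, E_0>
    = -1 and <E_l, E_c> = 1. It thus represents E_1 on the plane of 0 and c, and represents E_3 once
    1 and 2 are present; its Q-value is 1 + 1 + 1 = 1. *)
Lemma staged2 : staged (fun l => (l == c) || (l <= 2)%N).
Proof.
have s1 : staged (add_letters pred0 0%N c).
  apply: (@staged_add _ 0) => //; try lia.
  - exact: staged0.
  - by rewrite form_letter; [pairing_cases|lia|lia].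
  - by case: (span_sub pred0).
  - by move=> u hu; rewrite form0r; symmetry; apply: (span_perp (L := pred0)) hu.
  - move=> X k f st kf Uk Uf Qf Ux Qe; apply: (plane_stage skew QD st kf Uk Uf Qf Ux Qe) => //.
    by move=> u hu; apply/rowP => j; rewrite hu // mxE.
have Lx : span (add_letters pred0 0%N c) x0.
  by case: (span_sub (add_letters pred0 0%N c)) => _ h _; apply: h; apply: span_letter; rewrite /add_letters eqxx ?orbT.
apply: (@staged_ext (add_letters (add_letters pred0 0%N c) 1%N 2%N)); last first.
  move=> l _; rewrite /add_letters /=; lia.
apply: (staged_add s1 (x := x0)); rewrite /add_letters /=; try lia.
- by rewrite form_letter; [pairing_cases|lia|lia].
- by move=> l lt_ln Ll; rewrite !form_letter; [pairing_cases|lia|lia|lia|lia].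
- by [].
- move=> u hu; apply/eqP; rewrite -subr_eq0 -formNr -formDr; apply/eqP; move: u hu.
  apply: span_perp => l lt_ln Ll; rewrite !formDr formNr !form_letter; [pairing_cases|lia..].
- move=> X k f st kf Uk Uf Qf Ux Qe; apply: (singular_stage skew QD st kf Uk Uf Qf Ux Qe) => //.
  exists (E c); first by apply: span_letter; rewrite /add_letters eqxx orbT.
  by rewrite formDl formvv // addr0 form_letter; [pairing_cases|lia|lia].
Qed.


Lemma staged3 : staged (fun l => (l == c) || (l <= 4)%N).
Proof.
set L := fun l => (l == c) || (l <= 2)%N.
apply: (@staged_ext (add_letters L 3%N 4%N)); last by move=> l _; rewrite /add_letters /L; lia.
apply: (staged_add staged2 (x := x0)); rewrite /L; try lia.
- by rewrite form_letter; [pairing_cases|lia|lia].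
- by move=> l lt_ln Ll; rewrite !form_letter; [pairing_cases|lia..].
- by case: (span_sub L) => _ h _; apply: h; apply: span_letter; rewrite /L ?eqxx ?orbT.
- move=> u hu; apply/eqP; rewrite -subr_eq0 -formNr -formDr; apply/eqP; move: u hu.
  by apply: span_perp => l lt_ln Ll; rewrite !formDr formNr !form_letter; [pairing_cases|lia..].
- move=> X k f st kf Uk Uf Qf Ux Qe; apply: (singular_stage skew QD st kf Uk Uf Qf Ux Qe) => //.
  exists (E c); first by apply: span_letter; rewrite /L eqxx.
  by rewrite formDl formvv // addr0 form_letter; [pairing_cases|lia..].
Qed.

(** Here x comes from unimodularity of U instead of an explicit formula, so Q x has to be split into
    cases. If Q x = 0, the letters up to 4 provide the singular vectors p and r. *)
Lemma staged_next L i : staged L -> (0 < i)%N -> (i.+1 < n)%N -> ~~ L i -> ~~ L i.+1 ->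
  L c -> (forall l, (l <= 4)%N -> L l) -> ~~ nonadjacent c i i.+1 ->
  (forall l, (l < n)%N -> L l -> pairing c l i = pairing c l i.+1) ->
  staged (add_letters L i i.+1).
Proof.
move=> sL i0 lt_in Li Li1 Lc L4 adj Lii.
have [X st XE] := sL.
have [x Lx hx] := st_dual st ((E i) *m Om)^T.
have {}hx u : span L u -> <<x, u>> = <<E i, u>>.
  move=> /hx ->; rewrite /form; have -> : u *m (E i *m Om)^T = (E i *m Om *m u^T)^T.
    by rewrite !trmx_mul trmxK.
  by rewrite mxE.
have LD u v : span L u -> span L v -> span L (u + v) by case: (span_sub L) => _ h _; apply: h.
have LN u : span L u -> span L (- u) by case: (span_sub L) => _ _ h; apply: h.
have LE l : L l -> span L (E l) by apply: span_letter.
have LEs l : (l <= 4)%N -> span L (E l) by move=> /L4 /LE.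
have px : prim (span L) x.
  exists (- E 0%N); first exact/LN/LEs.
  by rewrite formNr hx ?form_letter; [pairing_cases|lia|lia|exact: LEs].
have lf l m : (l < n)%N -> (m < n)%N -> <<E l, E m>> = pairing c l m by apply: form_letter.
apply: (staged_add sL (x := x)) => //; try lia.
- by rewrite lf; [rewrite /pairing ltnSn (negbTE adj)|lia..].
- by move=> l lt_ln Ll; rewrite !lf ?Lii //; lia.
- by move=> u Lu; rewrite form_skew // hx // -form_skew.
move=> X1 k f st1 kf Uk Uf Qf Ux Qe; case Qx: (Q x).
  exact: (singular_stage skew QD st1 kf Uk Uf Qf Ux Qe).
(* Since Q y = 1 and y is orthogonal to the letters 1, ..., 4, subtracting y from E_1 or E_3 makes
   it singular without changing its pairings with these four letters. Then p and q come from the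
   block {1, 2}, r and its partner E_4 - E_3 from {3, 4}. *)
have [y [Ly Qy yE]] : exists y, [/\ span L y, Q y & forall l, (0 < l <= 4)%N -> <<E l, y>> = 0].
  exists x0; split=> // [|l /andP[l0 l4]]; first by apply: (LD); [exact: LEs | exact: LE].
  have lc := leq_ltn_trans l4 c_ge5.
  have ln := ltn_trans lc c_lt; have n0 := leq_ltn_trans (leq0n l) ln.
  rewrite formDr !lf // /pairing /nonadjacent lc l0 /=.
  by rewrite ltnn !andbF.
have l4n l : (l <= 4)%N -> (l < n)%N by move=> h; apply: leq_ltn_trans h (ltn_trans c_ge5 c_lt).
have c34 : ((3 < c)%N = true) * ((4 < c)%N = true) by rewrite c_ge5 ltnW.
have f12 : <<E 1%N, E 2%N>> = 1 by rewrite lf ?l4n.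
have f13 : <<E 1%N, E 3%N>> = 0 by rewrite lf ?l4n // /pairing /nonadjacent !c34.
have f23 : <<E 2%N, E 3%N>> = 0 by rewrite lf ?l4n // /pairing /nonadjacent !c34.
have f14 : <<E 1%N, E 4%N>> = 0 by rewrite lf ?l4n // /pairing /nonadjacent !c34.
have f34 : <<E 3%N, E 4%N>> = 1 by rewrite lf ?l4n.
have := conj (yE 1%N isT) (conj (yE 2%N isT) (conj (yE 3%N isT) (yE 4%N isT))).
have := And4 (LEs 1%N isT) (LEs 2%N isT) (LEs 3%N isT) (LEs 4%N isT).
have : [/\ Q (E 1%N), Q (E 2%N), Q (E 3%N) & Q (E 4%N)] by split; apply/Q_letter/l4n.
move: f12 f13 f23 f14 f34.
move: (E 1%N) (E 2%N) (E 3%N) (E 4%N) => v1 v2 v3 v4 f12 f13 f23 f14 f34.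
move=> [Q1 Q2 Q3 Q4] [L1 L2 L3 L4'] [y1 [y2 [y3 y4]]].
have f21 : <<v2, v1>> = -1 by rewrite form_skew // f12.
have yv v : <<v, y>> = 0 -> <<y, v>> = 0 by exact: form_eq0.
apply: (nonsingular_stage skew QD st1 kf Uk Uf Qf Ux Qe px Qx (p := v1 - y) (q := v2 - v1) (r := v3 - y)).
- by apply: (LD) => //; apply: LN.
- by apply: (LD) => //; apply: LN.
- by apply: (LD) => //; apply: LN.
- by rewrite QD (QN skew QD) formNr y1 Q1 Qy.
- by rewrite QD (QN skew QD) formNr f21 Q1 Q2.
- by rewrite QD (QN skew QD) formNr y3 Q3 Qy.
- by rewrite !formE formvv // f12 !yv //; ring.
- by rewrite !formE formvv // f13 !yv // y1; ring.
- by rewrite !formE f13 f23 y1 y2; ring.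
- exists (v4 - v3); first by apply: (LD) => //; apply: LN.
  by rewrite !formE formvv // f34 !yv //; ring.
Qed.

Lemma staged_center m : (2 <= m)%N -> (m.*2 < c)%N -> staged (fun l => (l == c) || (l <= m.*2)%N).
Proof.
elim: m => // m IH m2; have [m1|m1 mc] := eqVneq m 1%N.
  by rewrite m1 => _; apply: staged3.
set L := fun l => (l == c) || (l <= m.*2)%N.
have m2' : (2 <= m)%N by clear -m2 m1; lia.
have sL : staged L by apply: IH; clear -m2' mc; lia.
apply: (@staged_ext (add_letters L m.*2.+1 m.*2.+2)); last first.
  by move=> l _; rewrite /add_letters /L; clear; lia.
have nm i : (4 < i)%N -> nonadjacent c i =1 pred0.
  move=> i4 j; rewrite /nonadjacent.
  by have -> : (i < 3)%N = false; [clear -i4; lia | rewrite /= andbF].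
have m4 : (4 < m.*2.+1)%N by clear -m2'; lia.
apply: staged_next => //; rewrite /L ?eqxx //.
- by clear -mc c_lt; lia.
- by clear -mc; lia.
- by clear -mc; lia.
- by move=> l l4; clear -m4 l4; lia.
- by rewrite nm.
have h2 : (m.*2.+2 < c)%N by clear -mc; lia.
have h1 : (m.*2.+1 < c)%N by exact: ltnW.
move=> l _ /orP[/eqP->|lm].
  by rewrite /pairing h1 h2 !(ltnNge c) (ltnW h1) (ltnW h2) !nm // ltnW.
have m3 : (1 < m.*2)%N by exact: ltnW (ltnW m4).
by rewrite /pairing /nonadjacent !ltnS lm (leqW lm) h1 h2 m3 (ltnW m3).
Qed.

Lemma staged_upto k : odd k -> (c <= k < n)%N -> staged (fun l => (l <= k)%N).
Proof.
suff h m : (c + m.*2 < n)%N -> staged (fun l => (l <= c + m.*2)%N).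
  move=> ok /andP[ck kn]; have kE : k = (c + ((k - c)./2).*2)%N.
    by clear -ok c_odd ck; lia.
  by rewrite kE; apply: h; rewrite -kE.
elim: m => [|m IH].
  (* As c is odd, [(c./2).*2] is c - 1, so the letters up to c are complete. *)
  move=> _; apply: (@staged_ext (fun l => (l == c) || (l <= (c./2).*2)%N)).
    by apply: staged_center; clear -c_odd c_ge5; lia.
  by move=> l _; rewrite addn0; clear -c_odd; lia.
move=> mn; set L := fun l => (l <= c + m.*2)%N.
apply: (@staged_ext (add_letters L (c + m.*2).+1 (c + m.*2).+2)); last first.
  by move=> l _; rewrite /add_letters /L; clear; lia.
have nc i j : (c <= j)%N -> nonadjacent c i j = false.
  by move=> cj; rewrite /nonadjacent [(j < c)%N]ltnNge cj !andbF.
have ck : (c <= (c + m.*2).+1)%N by rewrite leqW ?leq_addr.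
have ck2 := leqW ck.
apply: staged_next; rewrite /L ?leq_addr ?nc //.
- by apply: IH; clear -mn; lia.
- by clear -mn; lia.
- by clear; lia.
- by clear; lia.
- by move=> l l4; clear -l4 c_ge5; lia.
by move=> l _ ll; rewrite /pairing (nc l _ ck) (nc l _ ck2) !ltnS ll (leqW ll).
Qed.

Lemma singular_pair L : L c -> (forall l, (l <= 2)%N -> L l) ->
  exists p q, [/\ span L p, span L q, Q p = false, Q q & <<p, q>> = 1].
Proof.
move=> Lc L2; have c0 : (0 < c)%N by apply: leq_trans c_ge5.
have l2n l : (l <= 2)%N -> (l < n)%N.
  by move=> h; apply: leq_ltn_trans h (leq_ltn_trans _ c_lt); apply: leq_trans c_ge5.
have LD u v : span L u -> span L v -> span L (u + v) by case: (span_sub L) => _ h _; apply: h.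
have LN u : span L u -> span L (- u) by case: (span_sub L) => _ _ h; apply: h.
have LE l : L l -> span L (E l) by apply: span_letter.
have [c1 c2] : (1 < c)%N /\ (2 < c)%N by split; apply: leq_trans c_ge5.
have x0E l : (0 < l <= 2)%N -> <<E l, x0>> = 0.
  move=> /andP[l0 h]; have lc : (l < c)%N by apply: leq_ltn_trans h c2.
  have ln := l2n l h; have n0 := leq_ltn_trans (leq0n l) ln.
  rewrite formDr !form_letter // /pairing /nonadjacent lc l0 /=.
  by rewrite ltnn !andbF.
have f12 : <<E 1%N, E 2%N>> = 1 by rewrite form_letter ?l2n.
exists (E 1%N - x0), (E 2%N - E 1%N); split.
- by apply: (LD); [|apply/LN; apply: (LD)]; apply: LE => //; apply: L2.
- by apply: (LD); [|apply: LN]; apply/LE/L2.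
- by rewrite QD (QN skew QD) formNr x0E // Q_x0 Q_letter ?l2n.
- by rewrite QD (QN skew QD) formNr form_skew // f12 !Q_letter ?l2n.
have x0E' l : (0 < l <= 2)%N -> <<x0, E l>> = 0 by move=> /x0E/(form_eq0 skew).
by rewrite formDl formNl !formDr !formNr f12 formvv // !x0E' // subr0 oppr0 addr0 subr0.
Qed.
End Letters.

(** * Degenerate forms *)

Section Radical.
Variables (n : nat) (Om : 'M[int]_n).
Hypothesis skew : Om^T = - Om.
Local Notation V := 'rV[int]_n.
Local Notation form := Defs.form.
Local Notation "<< u , v >>" := (form Om u v) (at level 0, format "<< u ,  v >>").
Variable Q : V -> bool.
Hypothesis QD : forall u v, Q (u + v) = Q u (+) Q v (+) par <<u, v>>.
Local Notation grp := (grp Om).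
Local Notation prim := (prim Om).
Local Notation T := (Tv Om).
Implicit Types (u v w z : V) (M S : 'M[int]_n).

Variables (U X X' : V -> Prop) (x k : V) (kap : 'cV[int]_n).
Hypothesis st : stage Om Q U X.
Hypothesis rad : forall z, <<k, z>> = 0.
Hypothesis kap_k : (k *m kap) 0 0 = 1.
Hypothesis U_dec : forall z, U (z - ((z *m kap) 0 0) *: k).
Hypothesis XX' : forall v, X v -> X' v.
Hypothesis X'xk : X' (x + k).
Hypothesis Qe : Q (x + k).
Hypotheses (Ux : U x) (px : prim U x).

Let sU := st_sub st.
Let UD u v : U u -> U v -> U (u + v). Proof. by case: sU => _ h _; apply: h. Qed.
Let UN u : U u -> U (- u). Proof. by case: sU => _ _ h; apply: h. Qed.
Let radr z : <<z, k>> = 0. Proof. exact/form_eq0/rad. Qed.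

Lemma radical_dec z : exists u a, [/\ U u, (z *m kap) 0 0 = a & z = u + a *: k].
Proof. by exists (z - ((z *m kap) 0 0) *: k), ((z *m kap) 0 0); rewrite subrK. Qed.

(** S moves a vector u of U off U by the multiple <w, u> of k. Composing with the shift M brings it
    back to U, and the result is covered by fullness of U because the vectors orthogonal to U are
    the multiples of k. *)
Lemma shift_full S M w : isom Om S -> (forall u, Q (u *m S) = Q u) -> k *m S = k ->
  (forall u, U u -> <<w, u>> = (u *m (S *m kap)) 0 0) ->
  grp X' M -> (forall z, Q (z *m M) = Q z) ->
  (forall z, z *m M = z - <<w, z>> *: k) -> grp X' S.
Proof.
move=> iS QS kS wE gM QM hM.
suff gMS : grp X (M *m S).
  rewrite -(mulKmx (grp_unit skew gM) S); apply: grpM; first exact: grpV.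
  exact: grp_subset gMS.
have kMS : k *m (M *m S) = k by rewrite mulmxA hM radr scale0r subr0.
apply: (st_full st) => //.
- exact: isomM (grp_isom skew gM) iS.
- by move=> u; rewrite mulmxA QS QM.
- move=> u Uu; rewrite mulmxA hM mulmxBl -scalemxAl kS wE // mulmxA.
  exact: U_dec.
move=> z zU; have [u [a [Uu _ zE]]] := radical_dec z.
have -> : z = a *: k; last by rewrite -scalemxAl kMS.
rewrite zE; have uU w' : U w' -> <<u, w'>> = 0.
  by move=> /zU; rewrite zE formDl formZl rad mulr0 addr0.
case: (st_content st Uu) => [->|[c [w' [Uw' [v Uv w'v] uE]]]]; first by rewrite add0r.
by move: (uU v Uv); rewrite uE formZl w'v mulr1 => ->; rewrite scale0r add0r.
Qed.

Lemma radical_full1 S : Q x -> isom Om S -> (forall u, Q (u *m S) = Q u) -> k *m S = k -> grp X' S.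
Proof.
move=> Qx iS QS kS; have Qk : Q k = false.
  by move: Qe; rewrite QD Qx radr par0; case: (Q k).
have [w Uw wE] := st_dual st (S *m kap).
(* As k is in the radical, the terms with <k, z> vanish and the transformation is the same for every
   m of the right parity. *)
have [m pm] : exists m, par m = Q (- w) by exists (Q (- w) : nat); case: (Q _).
have [M gM hM] := eichlerP skew QD st (fun u _ => radr u) XX' X'xk Ux px Qx (UN Uw) pm.
have hM' z : z *m M = z - <<w, z>> *: k.
  by rewrite hM rad scale0r addr0 mulr0 addr0 formNl scaleNr.
apply: (shift_full iS QS kS wE gM _ hM') => z.
by rewrite hM' !(QE skew QD) Qk andbF addbF formNr formZr radr mulr0 oppr0 addbF.
Qed.

Variables p q : V.
Hypotheses (Up : U p) (Uq : U q) (Qp : Q p = false) (Qq : Q q) (pq : <<p, q>> = 1).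

(** For singular s, T_s need not preserve Q but T_s^2 does, so T_s^2 is in the group of U;
    multiplied by T_{s+k}^-2 it leaves the shift by -2 <s, z> k. Singular vectors span U. *)
Lemma shift2 v : Q x = false -> U v -> exists2 M, grp X' M &
  forall z, z *m M = z - (<<v, z>> + <<v, z>>) *: k.
Proof.
move=> Qx; move: v; apply: (singular_span skew QD st Up Uq Qp Qq pq).
  split.
  - by exists 1%:M => [|z]; [exact: grp1 | rewrite mulmx1 form0l addr0 scale0r subr0].
  - move=> u v [M gM hM] [S gS hS]; exists (M *m S) => [|z]; first exact: grpM.
    rewrite mulmxA hM hS !formE radr.
    by apply/rowP => i; rewrite !mxE; ring.
  - move=> u [M gM hM]; exists (invmx M) => [|z]; first exact: grpV.
    apply: (can_inj (mulmxK (grp_unit skew gM))).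
    rewrite mulmxKV ?(grp_unit skew gM) // hM !formE radr.
    by apply/rowP => i; rewrite !mxE; ring.
move=> s Us ps Qs.
have gsk := T_transport skew st (fun u _ => radr u) XX' X'xk Ux px Us ps (etrans Qs (esym Qx)).
have [M gM hM] := grp_pow skew (-2) gsk.
have gS : grp X (T s *m T s).
  have TsE z : z *m (T s *m T s) = z + (<<s, z>> + <<s, z>>) *: s.
    by rewrite mulmxA !mul_Tv // !formE formvv // mulr0 addr0 scalerDl addrA.
  apply: (st_full st).
  - by apply: isomM; apply: isom_Tv.
  - by move=> u; rewrite TsE !(QE skew QD) Qs andbF addbF formZr !parE addbb addbF.
  - by move=> u Uu; rewrite TsE; apply: UD => //; apply: subgrpZ.
  - by move=> z hz; rewrite TsE form_skew // hz // oppr0 addr0 scale0r addr0.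
exists (T s *m T s *m M) => [|z].
  by apply: grpM => //; apply: grp_subset gS.
rewrite !mulmxA hM !mul_Tv // !formE formvv // !rad.
by apply/rowP => i; rewrite !mxE; ring.
Qed.

(** Now only even shifts are available. Write w = c w' with w' primitive. If c is odd then Q w' = Q
    w = 0, so T_{w'+k} is in the group, and multiplying S by it replaces c by c + 1. *)
Lemma radical_full0 S : Q x = false ->
  (forall w, U w -> (forall u, U u -> <<w, u>> = (u *m (S *m kap)) 0 0) -> Q w = false) ->
  isom Om S -> (forall u, Q (u *m S) = Q u) -> k *m S = k -> grp X' S.
Proof.
move=> Qx hQw iS QS kS; have Qk : Q k by move: Qe; rewrite QD Qx radr addbF.
have even_shift S' v : isom Om S' -> (forall u, Q (u *m S') = Q u) -> k *m S' = k -> U v ->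
    (forall u, U u -> <<v + v, u>> = (u *m (S' *m kap)) 0 0) -> grp X' S'.
  move=> iS' QS' kS' Uv vE; have [M gM hM] := shift2 Qx Uv.
  have hM' z : z *m M = z - <<v + v, z>> *: k by rewrite hM formDl.
  apply: (shift_full iS' QS' kS' vE gM _ hM') => z.
  by rewrite hM' !(QE skew QD) formDl !formE radr mulr0 oppr0 !parE addbb /= !addbF.
have [w Uw wE] := st_dual st (S *m kap).
have Qw := hQw w Uw wE.
case: (st_content st Uw) => [w0|[c [w' [Uw' pw' wE']]]].
  by apply: (even_shift S 0); rewrite // ?addr0 -?w0.
case pc: (par c); last first.
  have [d dE] := par_evenE (negbT pc).
  apply: (even_shift S (d *: w')) => //; first exact: subgrpZ.
  by rewrite -scalerDl -dE -wE'.
have Qw' : Q w' = false by move: Qw; rewrite wE' (QZ skew QD) pc.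
have gT := T_transport skew st (fun u _ => radr u) XX' X'xk Ux px Uw' pw' (etrans Qw' (esym Qx)).
rewrite -(mulKmx (Tv_unit skew (w' + k)) S); apply: grpM; first exact: grpV.
have QT : Q (w' + k) by rewrite QD Qw' Qk radr.
have [|d dE] := @par_evenE (c + 1); first by rewrite !parE pc.
apply: (even_shift _ (d *: w')).
- by apply: isomM => //; apply: isom_Tv.
- by move=> u; rewrite mulmxA QS (Q_Tv skew QD).
- by rewrite mulmxA mul_Tv // radr scale0r addr0.
- exact: subgrpZ.
have mxD (A B : 'M[int]_1) i j : (A + B) i j = A i j + B i j by rewrite mxE.
have mxZ a (A : 'M[int]_1) i j : (a *: A) i j = a * A i j by rewrite mxE.
move=> u Uu; rewrite -scalerDl -dE -mulmxA mulmxA mul_Tv // mulmxDl -scalemxAl.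
rewrite mulmxDl [(k *m _)]mulmxA kS mxD mxZ mxD kap_k -!wE // wE'.
by rewrite !formE formvv // rad; ring.
Qed.
End Radical.

(** * The quadratic form modulo 2 *)

(* The Gauss sum N of (-1)^q satisfies N^2 = #|V| and N = (-1)^(q w) N. *)
Lemma arf_invariance (V : finZmodType) (q : V -> bool) (b : V -> V -> bool) (f : V -> V) (w : V) :
  (forall u v, q (u + v) = q u (+) q v (+) b u v) ->
  (forall u v h, b (u + v) h = b u h (+) b v h) ->
  (forall h, h != 0 -> exists u, b u h) ->
  injective f -> (forall u, q (f u) = q u (+) b u w) -> q w = false.
Proof.
move=> qD bD nd fI qf; pose s (x : bool) : int := (-1) ^+ x.
have sD x y : s (x (+) y) = s x * s y by rewrite /s signr_addb.
have ss x : s x * s x = 1 by rewrite -sD addbb.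
have q0 : q 0 = false.
  have b00 : b 0 0 = false by have := bD 0 0 0; rewrite addr0 addbb.
  by have := qD 0 0; rewrite addr0 b00 addbb.
pose N := \sum_u s (q u).
have NN : N * N = #|V|%:R.
  have -> : N * N = \sum_h s (q h) * \sum_u s (b u h).
    rewrite /N mulr_suml; under eq_bigr => u _ do rewrite (reindex_inj (addrI u)) mulr_sumr /=.
    rewrite exchange_big; apply: eq_bigr => h _; rewrite mulr_sumr; apply: eq_bigr => u _ /=.
    by rewrite qD !sD; case: (q u); case: (q h); case: (b u h).
  rewrite (bigD1 0) //= [X in _ + X]big1 => [|h h0].
    have b0 u : b u 0 = false by have := qD u 0; rewrite addr0 q0; case: (q u); case: (b u 0).
    by under eq_bigr => u _ do rewrite b0; rewrite q0 mul1r addr0 sumr_const.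
  have [u0 bu0] := nd h h0; suff -> : \sum_u s (b u h) = 0 by rewrite mulr0.
  set B := \sum_u _; have : B = - B.
    rewrite {1}/B (reindex_inj (addIr u0)) -sumrN /=; apply: eq_bigr => u _.
    by rewrite bD bu0; case: (b u h).
  by move/eqP; rewrite -addr_eq0 -mulr2n mulrn_eq0 => /eqP.
have N0 : N != 0.
  apply/negP => /eqP N0; move: NN; rewrite N0 mul0r => /esym/eqP.
  by rewrite pnatr_eq0; apply/negP; rewrite -lt0n; apply/card_gt0P; exists 0.
have : N = s (q w) * N.
  rewrite {1}/N (reindex_inj fI) /=; under eq_bigr => u _ do rewrite qf.
  rewrite [N](reindex_inj (addIr w)) /= mulr_sumr; apply: eq_bigr => u _.
  by rewrite -sD qD; case: (q u); case: (q w); case: (b u w).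
by case: (q w) => //; rewrite /s expr1 mulN1r => /eqP; rewrite -addr_eq0 -mulr2n mulrn_eq0 (negbTE N0).
Qed.

Lemma Z2_par (z : int) : (z%:~R : 'Z_2) = (par z)%:R.
Proof.
have N m : (m%:R : 'Z_2) = (odd m)%:R.
  by elim: m => // m IH; rewrite mulrS IH /=; case: (odd m); apply: val_inj.
rewrite /par; case: (intP z) => [|m|m] //; first by rewrite -pmulrn; exact: N.
rewrite mulrNz -pmulrn (N m.+1) abszN [`|m.+1|%N]/=; by case: (odd _); apply: val_inj.
Qed.

Lemma Z2_eq1 (x : 'Z_2) : x = (x == 1)%:R.
Proof. by apply/eqP; case: x => [[|[|]]]. Qed.

Lemma Z2_eq1D (x y : 'Z_2) : (x + y == 1) = (x == 1) (+) (y == 1).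
Proof. by case: x y => [[|[|x]] ?] [[|[|y]] ?]. Qed.

Lemma Z2_par_eq1 (z : int) : ((z%:~R : 'Z_2) == 1) = par z.
Proof. by rewrite Z2_par; case: (par z). Qed.

Section Forms.
Variables (n : nat) (p : pperm n).
Implicit Types (u v : 'rV['Z_2]_n).

Lemma Omega_skew : (Omega p)^T = - Omega p.
Proof.
apply/matrixP => a b; rewrite !mxE.
have [h1|h1] := boolP ((pt p a < pt p b)%N && (pb p b < pb p a)%N).
  by case/andP: h1 => /ltnW/leq_gtF-> /ltnW/leq_gtF->.
by case: ifP; rewrite ?opprK ?oppr0.
Qed.

Definition Om2 : 'M['Z_2]_n := map_mx intr (Omega p).

Lemma Om2_sym a b : Om2 a b = Om2 b a.
Proof.
rewrite !mxE; have /matrixP/(_ a b) := Omega_skew; rewrite !mxE => ->.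
by rewrite !Z2_par parN.
Qed.

Lemma Om2_diag a : Om2 a a = 0.
Proof. by rewrite !mxE !ltnn. Qed.

Hypothesis pt_inj : injective (pt p).

(** [Qform] is a linear form plus the diagonal of the bilinear form F given by half of the entries
    of Omega. Its polarization is therefore F plus its transpose, which is Omega modulo 2. *)
Lemma QformD u v : Qform p (u + v) = Qform p u + Qform p v + (u *m Om2 *m v^T) 0 0.
Proof.
pose F u v := \sum_(a < n) \sum_(b < n) (if (pt p a < pt p b)%N then u 0 a * Om2 a b * v 0 b else 0 : 'Z_2).
have QE w : Qform p w = F w w + \sum_a w 0 a.
  by rewrite /Qform; congr (_ + _); apply: eq_bigr => a _; apply: eq_bigr => b _; rewrite [Om2 _ _]mxE.
have FD u1 u2 w : F (u1 + u2) w = F u1 w + F u2 w.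
  rewrite -big_split; apply: eq_bigr => a _; rewrite -big_split; apply: eq_bigr => b _.
  by rewrite [(u1 + u2) _ _]mxE /=; case: ifP => _; rewrite ?addr0 // !mulrDl.
have FDr u1 u2 w : F w (u1 + u2) = F w u1 + F w u2.
  rewrite -big_split; apply: eq_bigr => a _; rewrite -big_split; apply: eq_bigr => b _.
  by rewrite [(u1 + u2) _ _]mxE /=; case: ifP => _; rewrite ?addr0 // !mulrDr.
have -> : (u *m Om2 *m v^T) 0 0 = F u v + F v u.
  rewrite [F v u]exchange_big -big_split /= mxE.
  under [RHS]eq_bigr => a _ do rewrite -big_split /=.
  under [LHS]eq_bigr => b _ do rewrite !mxE mulr_suml.
  rewrite exchange_big; apply: eq_bigr => a _; apply: eq_bigr => b _ /=.
  have [->|ab] := eqVneq a b; first by rewrite ltnn Om2_diag mulr0 mul0r addr0.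
  case: ltngtP => [|| /pt_inj e]; last by rewrite e eqxx in ab.
    by rewrite addr0.
  by move=> _; rewrite add0r Om2_sym; ring.
rewrite !QE FD !FDr; under eq_bigr => a _ do rewrite mxE.
rewrite big_split /=; ring.
Qed.

Definition Qint (u : 'rV[int]_n) : bool := Qform p (map_mx intr u) == 1.

Lemma form_par (u v : 'rV[int]_n) :
  ((map_mx intr u *m Om2 *m (map_mx intr v)^T) 0 0 == 1) = par (Defs.form (Omega p) u v).
Proof. by rewrite map_trmx /Om2 -!map_mxM /= mxE Z2_par_eq1. Qed.

Lemma QintD (u v : 'rV[int]_n) : Qint (u + v) = Qint u (+) Qint v (+) par (Defs.form (Omega p) u v).
Proof. by rewrite /Qint map_mxD QformD !Z2_eq1D form_par. Qed.

Lemma Qint_letter i : (i < n)%N -> Qint (letter n i).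
Proof.
move=> lt_in; rewrite /Qint /Qform.
pose j := Ordinal lt_in.
have E a : (map_mx intr (letter n i) : 'rV['Z_2]_n) 0 a = (a == j)%:R.
  by rewrite !mxE -val_eqE /=; case: (_ == _).
rewrite big1 => [|a _]; last first.
  rewrite big1 // => b _; rewrite !E; case: ifP => // ab.
  have [aj|] := eqVneq a j; last by rewrite !mul0r.
  have [bj|] := eqVneq b j; last by rewrite mulr0.
  by move: ab; rewrite aj bj ltnn.
rewrite add0r (bigD1 j) //= E eqxx big1 ?addr0 // => a aj.
by rewrite E (negbTE aj).
Qed.

Lemma lift_Z2 (u : 'rV['Z_2]_n) : exists v : 'rV[int]_n, u = map_mx intr v.
Proof.
exists (\row_j (u 0 j : nat)%:Z); apply/rowP => j; rewrite !mxE.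
by case: (u 0 j) => [[|[|]]] // h; apply: val_inj.
Qed.

Lemma OQ_red2 (S : 'M[int]_n) : S \in unitmx ->
  OQ p (red2 S) <-> forall u : 'rV[int]_n, Qint (u *m S) = Qint u.
Proof.
move=> uS; have rE (u : 'rV[int]_n) : map_mx intr u *m red2 S = map_mx intr (u *m S).
  by rewrite map_mxM.
split=> [[_ h] u|h]; first by rewrite /Qint -rE h.
split.
  by rewrite unitmxE /red2 det_map_mx rmorph_unit.
move=> u; have [v ->] := lift_Z2 u; have := h v; rewrite /Qint -rE => e.
by rewrite [LHS]Z2_eq1 e -Z2_eq1.
Qed.

Lemma arf_int (S : 'M[int]_n) (w : 'rV[int]_n) : S \in unitmx -> Omega p \in unitmx ->
  (forall u : 'rV[int]_n, Qint (u *m S) = Qint u (+) par (Defs.form (Omega p) w u)) -> Qint w = false.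
Proof.
move=> uS uO h.
apply: (@arf_invariance _ (fun u : 'rV['Z_2]_n => Qform p u == 1)
  (fun u v => (u *m Om2 *m v^T) 0 0 == 1) (fun u => u *m red2 S) (map_mx intr w)).
- by move=> u v; rewrite QformD !Z2_eq1D.
- by move=> u v z; rewrite -Z2_eq1D !mulmxDl mxE.
- move=> z z0; have uOz : Om2 *m z^T != 0.
    apply: contra z0 => /eqP e; have uO2 : Om2 \in unitmx.
      by rewrite unitmxE /Om2 det_map_mx rmorph_unit.
    by rewrite -(trmxK z) -(mulKmx uO2 z^T) e mulmx0 trmx0.
  have [i zi] : exists i, (Om2 *m z^T) i 0 != 0.
    apply/existsP; apply: contraR uOz => /existsPn e; apply/eqP/colP => i.
    by have := e i; rewrite negbK => /eqP ->; rewrite mxE.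
  exists (delta_mx 0 i); rewrite -mulmxA -rowE [row _ _ _ _]mxE.
  by move: zi; move: ((Om2 *m z^T) i 0) => [[|[|]]].
- have uS2 : red2 S \in unitmx by rewrite unitmxE /red2 det_map_mx rmorph_unit.
  exact: (can_inj (mulmxK uS2)).
- move=> u; have [v ->] := lift_Z2 u.
  have -> : map_mx intr v *m red2 S = map_mx intr (v *m S) by rewrite map_mxM.
  have := h v; rewrite /Qint => ->; congr (_ (+) _).
  by rewrite form_par (form_skew Omega_skew) parN.
Qed.
End Forms.

Lemma additive_ext n (d1 d2 : 'rV[int]_n -> bool) :
  (forall u v, d1 (u + v) = d1 u (+) d1 v) -> (forall u v, d2 (u + v) = d2 u (+) d2 v) ->
  (forall i, (i < n)%N -> d1 (letter n i) = d2 (letter n i)) -> d1 =1 d2.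
Proof.
move=> D1 D2 E.
have z (d : 'rV[int]_n -> bool) : (forall u v, d (u + v) = d u (+) d v) -> d 0 = false.
  by move=> D; have := D 0 0; rewrite addr0 addbb.
have N (d : 'rV[int]_n -> bool) : (forall u v, d (u + v) = d u (+) d v) -> forall u, d (- u) = d u.
  by move=> D u; have := D u (- u); rewrite subrr z //; case: (d u); case: (d _).
move=> u; apply: (span_ind (L := predT) (P := fun u => d1 u = d2 u)) => // [|i hi _]; last exact: E.
split=> [|v w hv hw|v hv].
- by rewrite !z.
- by rewrite D1 D2 hv hw.
- by rewrite !N.
Qed.

(** The difference of two quadratic refinements of the same form is additive. *)
Lemma quadratic_ext n (O : 'M[int]_n) (q1 q2 : 'rV[int]_n -> bool) :
  (forall u v, q1 (u + v) = q1 u (+) q1 v (+) par (Defs.form O u v)) ->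
  (forall u v, q2 (u + v) = q2 u (+) q2 v (+) par (Defs.form O u v)) ->
  (forall i, (i < n)%N -> q1 (letter n i) = q2 (letter n i)) -> q1 =1 q2.
Proof.
move=> D1 D2 E u; suff : q1 u (+) q2 u = false by case: (q1 u); case: (q2 u).
apply: (@additive_ext n (fun u => q1 u (+) q2 u) (fun _ => false)) => // [v w|i lt_in].
  by rewrite D1 D2; case: (q1 v); case: (q1 w); case: (q2 v); case: (q2 w); case: (par _).
by rewrite E // addbb.
Qed.

Lemma letter_delta n (a : 'I_n) : letter n a = delta_mx 0 a.
Proof. by apply/rowP => j; rewrite !mxE eqxx -val_eqE. Qed.

(** * Walks in the Rauzy diagram *)

Lemma det_elementary n (l w : 'I_n) : l != w -> \det (1%:M + delta_mx l w : 'M[int]_n) = 1.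
Proof.
(* C is the identity with row l replaced by row w; it has two equal rows, hence determinant 0. *)
move=> lw; pose C := \matrix_(i, j) (if i == l then (j == w)%:R else (i == j)%:R) : 'M[int]_n.
rewrite (@determinant_multilinear _ _ _ 1%:M C l 1 1) ?det1 ?mulr1 ?mul1r.
- rewrite (@determinant_alternate _ _ C l w) ?addr0 // => j.
  by rewrite !mxE eqxx (eq_sym w l) (negbTE lw) eq_sym.
- by apply/rowP => j; rewrite !mxE !eqxx !mul1r.
- apply/matrixP => i j; rewrite !mxE; have /negbTE il := neq_lift l i.
  by rewrite [lift l i == l]eq_sym il addr0.
- apply/matrixP => i j; rewrite !mxE; have /negbTE il := neq_lift l i.
  by rewrite ![lift l i == l]eq_sym il addr0.
Qed.

Lemma elementary_unit n (l w : 'I_n) : l != w -> (1%:M + delta_mx l w : 'M[int]_n) \in unitmx.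
Proof. by move=> lw; rewrite unitmxE det_elementary ?unitr1. Qed.

Definition inversion (t1 t2 b1 b2 : nat) : int :=
  if (t1 < t2)%N && (b2 < b1)%N then 1 else if (t2 < t1)%N && (b1 < b2)%N then -1 else 0.

Lemma OmegaE n (p : pperm n) a b : Omega p a b = inversion (pt p a) (pt p b) (pb p a) (pb p b).
Proof. by rewrite mxE. Qed.

(** N is the last position, held by the winner in the top row and the loser in the bottom row. The
    hypothesis [(ty == N) = (yb == wb)] says that y is the winner in both rows or in neither. *)
Lemma inversion_moved N tl ty yb wb : tl != ty -> (tl < N)%N -> (yb < N)%N -> (wb < N)%N ->
  (ty <= N)%N -> (ty == N) = (yb == wb) ->
  inversion tl ty wb.+1 (if (wb < yb)%N then yb.+1 else yb) =
  inversion tl ty N yb + inversion N ty wb yb.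
Proof.
rewrite /inversion => h1 h2 h3 h4 h5.
case: (ltngtP wb yb) => hb; case: (ltngtP tl ty) => ht; rewrite /= ?hb => h6;
  repeat match goal with |- context [if ?b then _ else _] => destruct b eqn:? end; lia.
Qed.

Section Rauzy.
Variable n : nat.
Implicit Types (p q : pperm n) (r : {ffun 'I_n -> nat}) (a w l : 'I_n) (M : 'M[int]_n).

Definition goodrow r := injective r /\ forall x, (r x < n)%N.
Definition good p := goodrow p.1 /\ goodrow p.2.
Definition swap p : pperm n := (p.2, p.1).

(** The converse serves the arrows that are traversed backwards. *)
Lemma move_after_good r w l : w != l -> r l = n.-1 -> goodrow r <-> goodrow (move_after r w l).
Proof.
move=> wl rl; have n0 := ltn_ord l.
split=> -[ri rn].
  have nl x : x != l -> (r x < n.-1)%N.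
    move=> xl; have := rn x; suff : r x != n.-1 by clear; lia.
    by apply: contra xl => /eqP e; apply/eqP/ri; rewrite rl.
  have rw := nl w wl; split=> [x y|x]; rewrite !ffunE.
    have [->|xl] := eqVneq x l; have [->|yl] := eqVneq y l => //.
    - by case: ifP => h e; [have /ri ey : r y = r w by clear -e; lia|]; rewrite ?ey; clear -h e; lia.
    - by case: ifP => h e; clear -h e; lia.
    by move=> e; apply: ri; move: e; case: ifP => h1; case: ifP => h2 e; clear -h1 h2 e; lia.
  case: eqP => [_|/eqP xl]; first by clear -rw; lia.
  by have := nl x xl; case: ifP => _; clear; lia.
have e x : x != l -> move_after r w l x = (if (r w < r x)%N then (r x).+1 else r x).
  by move=> xl; rewrite ffunE (negbTE xl).
have el : move_after r w l l = (r w).+1 by rewrite ffunE eqxx.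
have nl x : x != l -> (r x < n.-1)%N.
  move=> xl; have := rn x; have := rn l; rewrite el e //.
  by case: ifP; clear; lia.
split=> [x y exy|x].
  have [xl|xl] := eqVneq x l; have [yl|yl] := eqVneq y l; rewrite ?xl ?yl //.
  - by have := nl y yl; rewrite -exy xl rl ltnn.
  - by have := nl x xl; rewrite exy yl rl ltnn.
  by apply: ri; rewrite !e // exy.
have [->|xl] := eqVneq x l; first by rewrite rl; clear -n0; lia.
by have := nl x xl; clear; lia.
Qed.

Lemma rauzy_topP p q B : rauzy_step true p = Some (q, B) -> exists w l,
  [/\ w != l, pt p w = n.-1, pb p l = n.-1, q = (p.1, move_after p.2 w l) & B = 1%:M + delta_mx l w].
Proof.
rewrite /rauzy_step /last_top /last_bot; case: pickP => // w /eqP hw; case: pickP => // l /eqP hl.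
by case: ifP => // wl [<- <-]; exists w, l; rewrite wl.
Qed.

Lemma rauzy_top p w l : good p -> w != l -> pt p w = n.-1 -> pb p l = n.-1 ->
  rauzy_step true p = Some ((p.1, move_after p.2 w l), 1%:M + delta_mx l w).
Proof.
move=> [[ti _] [bi _]] wl hw hl; rewrite /rauzy_step /last_top /last_bot.
case: pickP => [w' /eqP hw'|/(_ w)]; last by rewrite hw eqxx.
have -> : w' = w by apply: ti; rewrite -[RHS]/(pt p w) hw.
case: pickP => [l' /eqP hl'|/(_ l)]; last by rewrite hl eqxx.
have -> : l' = l by apply: bi; rewrite -[RHS]/(pb p l) hl.
by rewrite (negbTE wl).
Qed.

Lemma rauzy_bottom p w l : good p -> w != l -> pt p w = n.-1 -> pb p l = n.-1 ->
  rauzy_step false p = Some ((move_after p.1 l w, p.2), 1%:M + delta_mx w l).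
Proof.
move=> [[ti _] [bi _]] wl hw hl; rewrite /rauzy_step /last_top /last_bot.
case: pickP => [w' /eqP hw'|/(_ w)]; last by rewrite hw eqxx.
have -> : w' = w by apply: ti; rewrite -[RHS]/(pt p w) hw.
case: pickP => [l' /eqP hl'|/(_ l)]; last by rewrite hl eqxx.
have -> : l' = l by apply: bi; rewrite -[RHS]/(pb p l) hl.
by rewrite (negbTE wl).
Qed.

(** Exchanging the rows exchanges the two types of arrows, keeps the matrix and negates Omega;
    properties of bottom arrows thus follow from those of top arrows. *)
Lemma rauzy_swap t p : rauzy_step (~~ t) (swap p) = omap (fun qB => (swap qB.1, qB.2)) (rauzy_step t p).
Proof.
rewrite /rauzy_step -[last_top (swap p)]/(last_bot p) -[last_bot (swap p)]/(last_top p).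
case: (last_top p) => [a|]; case: (last_bot p) => [b|] //.
by rewrite eq_sym; case: ifP => // _; case: t.
Qed.

Lemma swapK p : swap (swap p) = p. Proof. by case: p. Qed.

Lemma Omega_swap p : Omega (swap p) = - Omega p.
Proof.
rewrite -Omega_skew; apply/matrixP => a b; rewrite !mxE.
rewrite -[pt (swap p)]/(pb p) -[pb (swap p)]/(pt p).
by rewrite andbC [X in if X then -1 else _]andbC.
Qed.

Lemma good_swap p : good (swap p) <-> good p. Proof. by split=> -[]. Qed.

Lemma row_elementary (i l w : 'I_n) :
  row i (1%:M + delta_mx l w : 'M[int]_n) = delta_mx 0 i + (i == l)%:R *: delta_mx 0 w.
Proof.
by apply/rowP => j; rewrite !mxE eqxx /= eq_sym; case: (i == l); rewrite ?mul1r ?mul0r.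
Qed.

Lemma form_delta (O : 'M[int]_n) i j : Defs.form O (delta_mx 0 i) (delta_mx 0 j) = O i j.
Proof. by rewrite /Defs.form trmx_delta -rowE -colE !mxE. Qed.

Lemma conj_entry (O B : 'M[int]_n) i j : (B *m O *m B^T) i j = Defs.form O (row i B) (row j B).
Proof.
rewrite /Defs.form tr_row -row_mul [LHS]mxE [RHS]mxE; apply: eq_bigr => k _.
by rewrite [row _ _ _ _]mxE [col _ _ _ _]mxE.
Qed.

Lemma Omega_top p w l : good p -> w != l -> pt p w = n.-1 -> pb p l = n.-1 ->
  Omega (p.1, move_after p.2 w l) =
  (1%:M + delta_mx l w) *m Omega p *m (1%:M + delta_mx l w)^T.
Proof.
move=> [[ti tn] [bi bn]] wl hw hl; set q := (_, _).
have e x : pb q x = if x == l then (pb p w).+1 else if (pb p w < pb p x)%N then (pb p x).+1 else pb p x.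
  by rewrite /pb /q ffunE.
have et x : pt q x = pt p x by [].
apply/matrixP => i j; rewrite conj_entry !row_elementary !formE !form_delta.
have tn' x : (pt p x < n)%N by exact: tn.
have bn' x : (pb p x < n)%N by exact: bn.
have lw : l != w by rewrite eq_sym.
have tw x : x != w -> (pt p x < n.-1)%N.
  by move=> xw; have := tn' x; suff : pt p x != n.-1 by [clear; lia]; apply: contra xw => /eqP h; apply/eqP/ti; rewrite -[RHS]/(pt p w) hw.
have bl x : x != l -> (pb p x < n.-1)%N.
  by move=> xl; have := bn' x; suff : pb p x != n.-1 by [clear; lia]; apply: contra xl => /eqP h; apply/eqP/bi; rewrite -[RHS]/(pb p l) hl.
have bw : (pb p w < n.-1)%N by apply: bl.
have tneq x y : x != y -> pt p x != pt p y by apply: contra => /eqP /ti ->.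
have bneq x y : x != y -> pb p x != pb p y by apply: contra => /eqP /bi ->.
have base x y : x != l -> y != l -> Omega q x y = Omega p x y.
  move=> xl yl; rewrite !mxE !et !e (negbTE xl) (negbTE yl).
  have -> : ((if (pb p w < pb p x)%N then (pb p x).+1 else pb p x) <
    (if (pb p w < pb p y)%N then (pb p y).+1 else pb p y))%N = (pb p x < pb p y)%N.
    by case: ifP => h1; case: ifP => h2; clear -h1 h2; lia.
  have -> // : ((if (pb p w < pb p y)%N then (pb p y).+1 else pb p y) <
    (if (pb p w < pb p x)%N then (pb p x).+1 else pb p x))%N = (pb p y < pb p x)%N.
  by case: ifP => h1; case: ifP => h2; clear -h1 h2; lia.
have lrow y : y != l -> Omega q l y = Omega p l y + Omega p w y.
  move=> yl; have ly : l != y by rewrite eq_sym.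
  rewrite !OmegaE !et !e eqxx (negbTE yl) hl hw.
  apply: inversion_moved; [exact: tneq|exact: tw|exact: bl|by []|by have := tn' y; clear; lia|].
  have [->|yw] := eqVneq y w; first by rewrite hw !eqxx.
  by rewrite (negbTE (bneq _ _ yw)); apply/negbTE; have := tw y yw; clear; lia.
have skewE (p' : pperm n) x y : Omega p' x y = - Omega p' y x.
  by have /matrixP/(_ y x) := Omega_skew p'; rewrite !mxE.
have diag (p' : pperm n) x : Omega p' x x = 0 by rewrite OmegaE /inversion !ltnn.
have [->|il] := eqVneq i l; have [->|jl] := eqVneq j l.
- by rewrite !diag (skewE p l w) mulr1n; ring.
- by rewrite lrow // mulr1n mulr0n; ring.
- by rewrite skewE lrow // (skewE p i l) (skewE p i w) mulr1n mulr0n; ring.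
- by rewrite base // mulr0n; ring.
Qed.

Lemma rauzy_step_elementary t p q B : rauzy_step t p = Some (q, B) -> B \in unitmx /\ \det B = 1.
Proof.
suff h p' q' B' : rauzy_step true p' = Some (q', B') -> B' \in unitmx /\ \det B' = 1.
  case: t => [|e]; first exact: h.
  by apply: (h (swap p) (swap q)); rewrite -[true]/(~~ false) rauzy_swap e.
case/rauzy_topP => w [l [wl _ _ _ ->]]; rewrite eq_sym in wl.
by split; [apply: elementary_unit | apply: det_elementary].
Qed.

Lemma rauzy_step_good t p q B : rauzy_step t p = Some (q, B) -> good p <-> good q.
Proof.
suff h p' q' B' : rauzy_step true p' = Some (q', B') -> good p' <-> good q'.
  case: t => [|e]; first exact: h.
  rewrite -good_swap -(good_swap q); apply: (h _ _ B).
  by rewrite -[true]/(~~ false) rauzy_swap e.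
case/rauzy_topP => w [l [wl _ hl -> _]].
by rewrite /good /=; have := move_after_good wl hl; tauto.
Qed.

Lemma rauzy_step_Omega t p q B : good p -> rauzy_step t p = Some (q, B) ->
  Omega q = B *m Omega p *m B^T.
Proof.
suff h p' q' B' : good p' -> rauzy_step true p' = Some (q', B') -> Omega q' = B' *m Omega p' *m B'^T.
  case: t => [|gp e]; first exact: h.
  apply: oppr_inj; rewrite -Omega_swap (h (swap p) _ B) ?good_swap //; last first.
    by rewrite -[true]/(~~ false) rauzy_swap e.
  by rewrite Omega_swap mulmxN mulNmx.
move=> gp /rauzy_topP [w [l [wl hw hl -> ->]]]; exact: Omega_top.
Qed.

(* Two quadratic refinements of the same form that agree on the letters: the winner and the
   loser pair to 1 mod 2. *)
Lemma rauzy_step_Q t p q B : good p -> rauzy_step t p = Some (q, B) ->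
  forall u, Qint p (u *m B) = Qint q u.
Proof.
move=> gp e; have gq := (rauzy_step_good e).1 gp.
have Oq := rauzy_step_Omega gp e.
have [w [l [lw BE Olw]]] : exists w l, [/\ l != w, B = 1%:M + delta_mx l w & par (Omega p l w)].
  have top p' q' B' : good p' -> rauzy_step true p' = Some (q', B') ->
      exists w l, [/\ l != w, B' = 1%:M + delta_mx l w & par (Omega p' l w)].
    move=> [[ti tn] [bi bn]] /rauzy_topP [w [l [wl hw hl _ ->]]].
    exists w, l; rewrite eq_sym; split=> //.
    have tl : (pt p' l < pt p' w)%N.
      have := tn l; suff : pt p' l != pt p' w by rewrite hw -[p'.1 l]/(pt p' l); clear; lia.
      by apply: contra wl => /eqP/ti->.
    have bw : (pb p' w < pb p' l)%N.
      have := bn w; suff : pb p' w != pb p' l by rewrite hl -[p'.2 w]/(pb p' w); clear; lia.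
      by apply: contra wl => /eqP/bi->.
    by rewrite OmegaE /inversion tl bw.
  case: t e => e; first exact: top e.
  have [||w [l [lw BE O]]] := top (swap p) (swap q) B; first by rewrite good_swap.
    by rewrite -[true]/(~~ false) rauzy_swap e.
  by exists w, l; split=> //; move: O; rewrite Omega_swap mxE parN.
have [ti _] := gp.1; have [tqi _] := gq.1.
apply: (@quadratic_ext n (Omega q) (fun u => Qint p (u *m B))) => [v v'||i lt_in].
- rewrite mulmxDl QintD // Oq; congr (_ (+) par _).
  by rewrite /Defs.form trmx_mul !mulmxA.
- exact: QintD.
have Ql (j : 'I_n) : Qint p (delta_mx 0 j).
  by rewrite -letter_delta Qint_letter ?ltn_ord.
rewrite Qint_letter // -[i]/(val (Ordinal lt_in)) letter_delta BE -rowE row_elementary.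
case: eqP => [->|_]; last by rewrite scale0r addr0 Ql.
by rewrite scale1r QintD // !Ql form_delta Olw.
Qed.

Lemma walk_cat p q s M N : walk p q M -> walk q s N -> walk p s (N *m M).
Proof.
elim=> [p'|p' q' r' t B M' e _ IH|p' q' r' t B M' e _ IH] wN; first by rewrite mulmx1.
- by rewrite mulmxA; apply: walk_fwd e (IH wN).
- by rewrite mulmxA; apply: walk_bwd e (IH wN).
Qed.

Lemma walk_unit p q M : walk p q M -> M \in unitmx /\ \det M = 1.
Proof.
elim=> [p'|p' q' r' t B M' /rauzy_step_elementary [uB dB] _ [uM dM]|p' q' r' t B M' /rauzy_step_elementary [uB dB] _ [uM dM]].
- by rewrite unitmx1 det1.
- by rewrite unitmx_mul uM uB det_mulmx dM dB mulr1.
- by rewrite unitmx_mul uM unitmx_inv uB det_mulmx det_inv dM dB invr1 mulr1.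
Qed.

Lemma walk_rev p q M : walk p q M -> walk q p (invmx M).
Proof.
elim=> [p'|p' q' r' t B M' e w IH|p' q' r' t B M' e w IH].
- by rewrite invmx1; apply: walk_nil.
- have [uB _] := rauzy_step_elementary e; have [uM _] := walk_unit w.
  rewrite invmx_mul // -[invmx B]mul1mx; apply: walk_cat IH _.
  exact: walk_bwd e (walk_nil _).
- have [uB _] := rauzy_step_elementary e; have [uM _] := walk_unit w.
  rewrite invmx_mul ?unitmx_inv // invmxK -[B]mul1mx; apply: walk_cat IH _.
  exact: walk_fwd e (walk_nil _).
Qed.

Lemma walk_swap p q M : walk p q M -> walk (swap p) (swap q) M.
Proof.
elim=> [p'|p' q' r' t B M' e _ IH|p' q' r' t B M' e _ IH]; first exact: walk_nil.
- by apply: (walk_fwd (top := ~~ t)) IH; rewrite rauzy_swap e.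
- by apply: (walk_bwd (top := ~~ t)) IH; rewrite rauzy_swap e.
Qed.

Lemma walk_invariants p q M : good p -> walk p q M ->
  [/\ good q, Omega q = M *m Omega p *m M^T & forall u, Qint p (u *m M) = Qint q u].
Proof.
move=> gp w; elim: w gp => [p'|p' q' r' t B M' e _ IH|p' q' r' t B M' e _ IH] gp.
- by split=> // [|u]; rewrite ?mul1mx ?trmx1 ?mulmx1.
- have [gr OE QE] := IH ((rauzy_step_good e).1 gp); split=> // [|u].
    by rewrite OE (rauzy_step_Omega gp e) trmx_mul !mulmxA.
  by rewrite mulmxA (rauzy_step_Q gp e) QE.
- have gq := (rauzy_step_good e).2 gp; have [gr OE QE] := IH gq.
  have [uB _] := rauzy_step_elementary e; split=> // [|u].
    have -> : Omega p' = B *m Omega q' *m B^T by exact: rauzy_step_Omega e.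
    have E : Omega q' = invmx B *m (B *m Omega q' *m B^T) *m (invmx B)^T.
      by rewrite !mulmxA mulVmx // mul1mx -mulmxA -trmx_mul mulVmx // trmx1 mulmx1.
    by rewrite OE {1}E trmx_mul !mulmxA.
  by rewrite mulmxA -(rauzy_step_Q gq e) mulmxKV // QE.
Qed.

Lemma RV_in p S : good p -> RV p S ->
  [/\ isom (Omega p) S, \det S = 1, S \in unitmx & forall u, Qint p (u *m S) = Qint p u].
Proof. by move=> gp w; have [_ OE QE] := walk_invariants gp w; have [] := walk_unit w; split. Qed.

Lemma RV_generated p (X : 'M[int]_n -> Prop) M : (forall T, X T -> RV p T) -> generated X M -> RV p M.
Proof.
move=> XR; elim=> [|T M' /XR wT _ IH|T M' /XR wT _ IH]; first exact: walk_nil.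
- exact: walk_cat IH wT.
- by apply: walk_cat IH _; apply: walk_rev.
Qed.
End Rauzy.

(** * Closed walks that realize transvections *)

Section Loops.
Variable n : nat.
Implicit Types (p q : pperm n) (r : {ffun 'I_n -> nat}) (a w l : 'I_n) (M : 'M[int]_n).

Lemma goodrow_onto r m : goodrow r -> (m < n)%N -> exists x, r x = m.
Proof.
move=> [ri rn] mn; pose f x := Ordinal (rn x).
have fi : injective f by move=> x y /(congr1 val) /ri.
have [g _ gK] := injF_bij fi; exists (g (Ordinal mn)).
by have := gK (Ordinal mn) => /(congr1 val).
Qed.

(* The top row after [k] bottom arrows with winner [a]: the letters to its right rotate. *)
Definition rotate p a k : {ffun 'I_n -> nat} :=
  [ffun x => if (pt p x <= pt p a)%N then pt p x
             else if (pt p x + k < n)%N then (pt p x + k)%N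
             else (pt p x + k - (n.-1 - pt p a))%N].

(** With a last in the bottom row, each letter to the right of a in the top row loses once against
    a, after which the top row is restored. The product adds e_a to the rows of exactly these
    letters, and they are the letters i with <e_a, e_i> = 1, the others pairing to 0 with a. *)
Lemma bottom_loop p a : good p -> pb p a = n.-1 -> (pt p a < n.-1)%N ->
  RV p (Tv (Omega p) (e_ a)).
Proof.
move=> gp ba ta; have [[ti tn] [bi bn]] := gp.
have tn' x : (pt p x < n)%N by exact: tn.
(* The losers of the first k arrows are the letters whose original top position is at least n -
   k. *)
pose Mk k : 'M[int]_n := \matrix_(i, j) ((i == j)%:R + ((n - k <= pt p i)%N && (j == a))%:R).
have main k : (k <= n.-1 - pt p a)%N -> walk p (rotate p a k, p.2) (Mk k).
  elim: k => [_|k IH hk].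
    have -> : Mk 0%N = 1%:M.
      by apply/matrixP => i j; rewrite !mxE subn0 leqNgt tn' addr0.
    have -> : (rotate p a 0, p.2) = p; last exact: walk_nil.
    case: (p) tn' => t b /= tn'; congr (_, _); apply/ffunP => x; rewrite ffunE addn0 tn'.
    by case: ifP.
  have [l hl] : exists l, pt p l = (n.-1 - k)%N.
    by apply: (goodrow_onto (r := p.1)) gp.1 _; clear -hk ta; lia.
  have la : l != a by apply/eqP => e; move: hl hk ta; rewrite e; clear; lia.
  have wk := IH (ltnW hk).
  have [gk _ _] := walk_invariants gp wk.
  have step : rauzy_step false (rotate p a k, p.2) = Some ((rotate p a k.+1, p.2), 1%:M + delta_mx l a).
    rewrite (rauzy_bottom (w := l) (l := a) gk la) //; last first.
      rewrite /pt /= ffunE -/(pt p l) hl; case: ifP => h1; first by have := tn' l; clear -h1 hk ta hl; lia.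
      by case: ifP => h2; clear -h1 h2 hk ta; lia.
    congr (Some ((_, _), _)); apply/ffunP => x.
    rewrite /= !ffunE; case: eqP => [->|/eqP xl].
      rewrite hl leqnn; case: ifP => h1; first by clear -h1 hk ta; lia.
      by case: ifP => h2; clear -h1 h2 hk ta; lia.
    have xneq : pt p x != (n.-1 - k)%N by rewrite -hl; apply: contra xl => /eqP/ti->.
    have xn := tn' x; rewrite leqnn.
    by case: (leqP (pt p x) (pt p a)) => h1; case: (ltnP (pt p x + k)%N n) => h2;
      case: (ltnP (pt p x + k.+1)%N n) => h3; case: ifP => h4; clear -h1 h2 h3 h4 hk ta xneq xn; lia.
  have -> : Mk k.+1 = (1%:M *m (1%:M + delta_mx l a)) *m Mk k.
    rewrite mul1mx mulmxDl mul1mx; apply/matrixP => i j; rewrite [RHS]mxE.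
    have -> : (delta_mx l a *m Mk k) i j = (i == l)%:R * (a == j)%:R.
      rewrite mxE (bigD1 a) //= big1 => [|b ba']; last by rewrite mxE (negbTE ba') andbF mul0r.
      rewrite mxE eqxx andbT addr0 mxE; congr (_ * _).
      have -> : (n - k <= pt p a)%N = false by clear -hk ta; lia.
      by rewrite addr0.
    rewrite !mxE -addrA; congr (_ + _).
    have [->|il] := eqVneq i l.
      rewrite hl.
      have -> : (n - k <= n.-1 - k)%N = false by clear -hk ta; lia.
      have -> : (n - k.+1 <= n.-1 - k)%N by clear -hk ta; lia.
      by rewrite add0r mulr1n mul1r eq_sym.
    have xneq : pt p i != (n.-1 - k)%N by rewrite -hl; apply: contra il => /eqP/ti->.
    rewrite mulr0n mul0r addr0; congr ((_ && _)%:R).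
    by clear -xneq hk ta; lia.
  apply: walk_cat wk _.
  exact: walk_fwd step (walk_nil _).
have := main _ (leqnn _).
have -> : (rotate p a (n.-1 - pt p a), p.2) = p.
  rewrite [RHS]surjective_pairing; congr (_, _); apply/ffunP => x; rewrite ffunE -[p.1 x]/(pt p x).
  have := tn' x; case: ifP => // h1; case: ifP => h2; clear -h1 h2 ta; lia.
have -> // : Mk (n.-1 - pt p a)%N = Tv (Omega p) (e_ a).
apply/row_matrixP => i; rewrite [RHS]rowE mul_Tv ?form_delta ?OmegaE; last exact: Omega_skew.
apply/rowP => j; rewrite !mxE eqxx /= eq_sym; congr (_ + _).
have -> : (n - (n.-1 - pt p a) <= pt p i)%N = (pt p a < pt p i)%N.
  by have := tn' i; clear -ta; lia.
rewrite /inversion ba; case: (ltngtP (pt p a) (pt p i)) => /= [h|h|/ti->]; last 1 first.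
- by rewrite mul0r.
- have ia : i != a by apply/eqP => e; rewrite e ltnn in h.
  have -> : (pb p i < n.-1)%N.
    have bi' : pb p i != pb p a by apply: contra ia => /eqP/bi->.
    have bin : (pb p i < n)%N by exact: bn.
    by rewrite ba in bi'; clear -bi' bin; lia.
  by rewrite mul1r eq_sym.
- have -> : (n.-1 < pb p i)%N = false.
    have bin : (pb p i < n)%N by exact: bn.
    by clear -bin; lia.
  by rewrite mul0r.
Qed.

Lemma Tv_opp (O : 'M[int]_n) v : O^T = - O -> Tv (- O) v = invmx (Tv O v).
Proof.
move=> sk; have sk' : (- O)^T = - (- O) by rewrite linearN /= sk.
apply: eq_mulmx_row => u; rewrite mul_Tv // mul_TvV //.
by rewrite /Defs.form mulmxN mulNmx mxE scaleNr.
Qed.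

Lemma top_loop p a : good p -> pt p a = n.-1 -> (pb p a < n.-1)%N ->
  RV p (Tv (Omega p) (e_ a)).
Proof.
move=> gp ta ba; have /walk_swap := bottom_loop ((good_swap p).2 gp) ta ba.
rewrite swapK Omega_swap Tv_opp; last exact: Omega_skew.
by move/walk_rev; rewrite invmxK.
Qed.

(** The letter w, last on top and first at the bottom, wins every top arrow: the bottom letters
    after w rotate one place at a time until a is last. The arrows change only the rows of the
    losers, and a never loses on the way. *)
Lemma reach_last p w a : good p -> pt p w = n.-1 -> pb p w = 0%N -> a != w ->
  exists q M, [/\ walk p q M, e_ a *m M = e_ a, pb q a = n.-1 & q.1 = p.1].
Proof.
move=> gp tw bw aw; have [k] := ubnP (n.-1 - pb p a)%N; elim: k p gp tw bw => // k IH p gp tw bw kb.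
have [ba|ba] := eqVneq (pb p a) n.-1.
  by exists p, 1%:M; rewrite mulmx1; split=> //; apply: walk_nil.
have [[ti tn] [bi bn]] := gp; have ban : (pb p a < n)%N by exact: bn.
have b0 : pb p a != 0%N by apply: contra aw; rewrite -bw => /eqP/bi->.
have [l hl] : exists l, pb p l = n.-1 by apply: (goodrow_onto (r := p.2)) gp.2 _; clear -ban; lia.
have al : a != l by apply: contra ba => /eqP->; rewrite hl.
have wl : w != l by apply/eqP => e; move: hl; rewrite -e bw; clear -ban b0; lia.
have step := rauzy_top gp wl tw hl; set q := (p.1, move_after p.2 w l) in step.
have gq : good q := (rauzy_step_good step).1 gp.
have [||r [M [wM eM bM tM]]] := IH q gq tw.
- by rewrite /pb /q ffunE (negbTE wl) ltnn.
- rewrite /pb /q ffunE (negbTE al) -/(pb p w) -/(pb p a) bw lt0n b0.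
  by clear -kb ba ban; lia.
exists r, (M *m (1%:M + delta_mx l w)); split=> //; first exact: walk_fwd step wM.
rewrite mulmxA eM /e_ -rowE row_elementary (negbTE al) scale0r addr0 //.
Qed.

(** The walk M to a permutation q with a last at the bottom satisfies e_a M = e_a, so it conjugates
    the loop of a at q to the transvection T_{e_a} at p. *)
Lemma RV_transvection p w a : good p -> (1 < n)%N -> pt p w = n.-1 -> pb p w = 0%N ->
  RV p (Tv (Omega p) (e_ a)).
Proof.
move=> gp n1 tw bw; have [->|aw] := eqVneq a w.
  by apply: top_loop => //; rewrite bw; clear -n1; lia.
have [q [M [wM eM ba tE]]] := reach_last gp tw bw aw.
have [gq OE _] := walk_invariants gp wM; have [uM _] := walk_unit wM.
have ta : (pt q a < n.-1)%N.
  have [[ti tn] _] := gp; rewrite /pt tE -/(pt p a); have tna : (pt p a < n)%N by exact: tn.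
  have : pt p a != pt p w by apply: contra aw => /eqP/ti->.
  by rewrite tw; clear -tna; lia.
have loop := bottom_loop gq ba ta.
have -> : Tv (Omega p) (e_ a) = invmx M *m (Tv (Omega q) (e_ a) *m M).
  apply: eq_mulmx_row => u; rewrite mul_Tv ?Omega_skew // !mulmxA mul_Tv ?Omega_skew //.
  rewrite mulmxDl -scalemxAl mulmxKV // eM; congr (_ + _ *: _).
  rewrite OE /Defs.form !mulmxA eM trmx_mul !mulmxA.
  by rewrite -(mulmxA _ M^T) -trmx_mul mulVmx // trmx1 mulmx1.
by apply: walk_cat (walk_rev wM); apply: walk_cat wM _.
Qed.
End Loops.

(** * The families tau and sigma *)

Definition center (isTau : bool) : nat := if isTau then 5 else 7.

(* Positions and letters are 0-based. *)
Definition bottom_pos (c n a : nat) : nat :=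
  if (c <= a)%N then (n.-1 - a)%N
  else (n - c + (if a == 0 then c.-1 else if a == 1 then 1 else if a == 2 then 0 else c.+1 - a))%N.

Lemma index_decreasing (n m a : nat) (s : seq nat) : (m <= n)%N -> (a < n)%N ->
  index a.+1 ([seq (n - i)%N | i <- iota 0 m] ++ s) =
  if (n - m <= a)%N then (n.-1 - a)%N else (m + index a.+1 s)%N.
Proof.
move=> mn an; rewrite index_cat size_map size_iota.
have u : uniq [seq (n - i)%N | i <- iota 0 m].
  rewrite map_inj_in_uniq ?iota_uniq // => i j; rewrite !mem_iota; lia.
case: (leqP (n - m) a) => h.
  have hm : (n.-1 - a < m)%N by lia.
  have e : nth 0%N [seq (n - i)%N | i <- iota 0 m] (n.-1 - a) = a.+1.
    by rewrite (nth_map 0%N) ?size_iota // nth_iota //; lia.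
  have hs : (n.-1 - a < size [seq (n - i)%N | i <- iota 0 m])%N by rewrite size_map size_iota.
  rewrite -e mem_nth // index_uniq //.
case: ifP => // /mapP [i]; rewrite mem_iota; lia.
Qed.

Section Family.
Variables (isTau : bool) (n : nat).
Local Notation c := (center isTau).
Hypothesis cn : (c < n)%N.
Local Notation p := (fam isTau n).

Lemma pt_fam a : pt p a = val a.
Proof. by rewrite /fam; case: isTau; rewrite /pt ffunE. Qed.

Lemma pb_fam a : pb p a = bottom_pos c n a.
Proof.
have an := ltn_ord a.
rewrite /fam /bottom_pos; move: cn; rewrite /center; case: isTau => cn'; rewrite /pb ffunE.
- rewrite index_decreasing ?leq_subr // (subKn (ltnW cn')) -[val a]/(nat_of_ord a).
  move: (nat_of_ord a) => m.
  by case: (leqP 5 m) => // h; congr addn; case: m h => [|[|[|[|[|m]]]]].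
- rewrite index_decreasing ?leq_subr // (subKn (ltnW cn')) -[val a]/(nat_of_ord a).
  move: (nat_of_ord a) => m.
  by case: (leqP 7 m) => // h; congr addn; case: m h => [|[|[|[|[|[|[|m]]]]]]].
Qed.

Lemma center_facts : odd c /\ (5 <= c)%N. Proof. by rewrite /center; case: isTau. Qed.

Lemma bottom_pos_lt a : (a < n)%N -> (bottom_pos c n a < n)%N.
Proof.
move: cn center_facts; move: c => c' h1 [_ h2] h3; rewrite /bottom_pos.
by do ?[case: ifP => ?]; lia.
Qed.

Lemma bottom_pos_inj a b : (a < n)%N -> (b < n)%N -> bottom_pos c n a = bottom_pos c n b -> a = b.
Proof.
move: cn center_facts; move: c => c' h1 [_ h2] h3 h4; rewrite /bottom_pos.
by case: (leqP c' a) => h5; case: (leqP c' b) => h6; case: a h3 h5 => [|[|[|a]]] h3 h5;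
  case: b h4 h6 => [|[|[|b]]] h4 h6 //=; clear -h1 h2 h3 h4 h5 h6; lia.
Qed.

Lemma good_fam : good p.
Proof.
split; split.
- by move=> x y; rewrite -![p.1 _]/(pt p _) !pt_fam => /val_inj.
- by move=> x; rewrite -![p.1 _]/(pt p _) pt_fam ltn_ord.
- move=> x y; rewrite -![p.2 _]/(pb p _) !pb_fam => /bottom_pos_inj e.
  by apply: val_inj; apply: e; apply: ltn_ord.
- by move=> x; rewrite -![p.2 _]/(pb p _) pb_fam bottom_pos_lt ?ltn_ord.
Qed.

Lemma bottom_pos_order a b : (a < b < n)%N ->
  (bottom_pos c n b < bottom_pos c n a)%N = ~~ nonadjacent c a b.
Proof.
move: cn center_facts; move: c => c' h1 [_ h2] /andP[h3 h4]; rewrite /bottom_pos /nonadjacent.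
by case: (leqP c' a) => h5; case: (leqP c' b) => h6; case: a h3 h5 => [|[|[|a]]] h3 h5;
  case: b h3 h4 h6 => [|[|[|b]]] h3 h4 h6 //=; clear -h1 h2 h3 h4 h5 h6; lia.
Qed.

Lemma Omega_fam a b : Omega p a b = pairing c a b.
Proof.
rewrite OmegaE !pt_fam !pb_fam /inversion /pairing.
case: (ltngtP (val a) (val b)) => [h|h|//] /=.
- rewrite (@bottom_pos_order a b); last by rewrite h ltn_ord.
  by case: (nonadjacent _ _ _).
- rewrite (@bottom_pos_order b a); last by rewrite h ltn_ord.
  by case: (nonadjacent _ _ _).
Qed.

Lemma form_fam i j : (i < n)%N -> (j < n)%N ->
  Defs.form (Omega p) (letter n i) (letter n j) = pairing c i j.
Proof.
move=> hi hj; have E k (hk : (k < n)%N) : letter n k = delta_mx 0 (Ordinal hk).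
  by apply/rowP => l; rewrite !mxE eqxx -val_eqE.
by rewrite (E i hi) (E j hj) form_delta Omega_fam.
Qed.

Lemma pt_inj_fam : injective (pt p). Proof. by have [[]] := good_fam. Qed.

Lemma RV_fam_transvection a : RV p (Tv (Omega p) (e_ a)).
Proof.
have [_ c5] := center_facts; have hn : (n.-1 < n)%N by clear -cn; lia.
apply: (RV_transvection (w := Ordinal hn)); first exact: good_fam.
- by clear -cn c5; lia.
- by rewrite pt_fam.
- rewrite pb_fam /bottom_pos /=; have -> : (c <= n.-1)%N by clear -cn; lia.
  by rewrite subnn.
Qed.
End Family.

Lemma grp_lettersP n (O M : 'M[int]_n) :
  grp O (letters (n := n)) M <-> generated (fun T => exists a, T = Tv O (e_ a)) M.
Proof.
split; elim => [|T M' hT _ IH|T M' hT _ IH]; try exact: gen_one.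
- case: hT => _ [i hi ->] TE; apply: gen_mul => //; exists (Ordinal hi).
  by rewrite TE /e_ -letter_delta.
- case: hT => _ [i hi ->] TE; apply: gen_inv => //; exists (Ordinal hi).
  by rewrite TE /e_ -letter_delta.
- case: hT => a TE; apply: gen_mul => //; exists (letter n a); last by rewrite letter_delta.
  by exists a.
- case: hT => a TE; apply: gen_inv => //; exists (letter n a); last by rewrite letter_delta.
  by exists a.
Qed.

(** * Even dimension: the nondegenerate form *)

Section Family.
Variable isTau : bool.
Local Notation c := (center isTau).
Local Notation P n := (fam isTau n).
Local Notation Om n := (Omega (P n)).
Local Notation Q n := (Qint (P n)).

Let skew n : (Om n)^T = - Om n := Omega_skew _.

Lemma QD_fam n : (c < n)%N -> forall u v, Q n (u + v) = Q n u (+) Q n v (+) par (Defs.form (Om n) u v).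
Proof. by move=> cn u v; apply: QintD; apply: pt_inj_fam. Qed.

Lemma staged_fam n k : (c < n)%N -> odd k -> (c <= k < n)%N ->
  staged (Om n) (Q n) (fun l => (l <= k)%N).
Proof.
move=> cn ok ck; have [oc c5] := center_facts isTau.
apply: (@staged_upto n c (Om n) (skew n) (Q n)) => //.
- exact: QD_fam.
- by move=> i j hi hj; apply: form_fam.
- by move=> i hi; apply: Qint_letter.
Qed.

Lemma RV_letters n S : (c < n)%N -> grp (Om n) (letters (n := n)) S -> RV (P n) S.
Proof.
by move=> cn /grp_lettersP; apply: RV_generated => _ [a ->]; apply: RV_fam_transvection.
Qed.

Section Even.
Variable m : nat.
Hypotheses (cm : (c < m)%N) (m_even : ~~ odd m).
Local Notation O := (Om m).
Local Notation q := (Q m).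
Local Notation "<< u , v >>" := (Defs.form O u v) (at level 0, format "<< u ,  v >>").
Let QD := QD_fam cm.
Let sk := skew m.

Lemma even_stage : exists2 X : 'rV[int]_m -> Prop, stage O q (fun _ => True) X &
  forall v, X v -> grp O (letters (n := m)) (Tv O v).
Proof.
have cm1 : (c <= m.-1 < m)%N by clear -cm; lia.
have om1 : odd m.-1 by have [_ c5] := center_facts isTau; clear -cm m_even c5; lia.
have [X st XE] := staged_fam cm om1 cm1.
exists X => //; apply: stage_ext st => v; split=> // _ j; case/negP.
by have := ltn_ord j; clear; lia.
Qed.

Lemma nondegenerate z : (forall u, <<z, u>> = 0) -> z = 0.
Proof.
have [X st _] := even_stage.
case: (st_content st (I : (fun _ => True) z)) => // -[a [w [_ [w' _ ww'] ->]]] h.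
by move: (h w'); rewrite formZl ww' mulr1 => ->; rewrite scale0r.
Qed.

Lemma even_full S : isom O S -> (forall u, q (u *m S) = q u) -> grp O (letters (n := m)) S.
Proof.
move=> iS QS; have [X st XE] := even_stage.
apply: (grp_sub sk XE); apply: (st_full st) => // z hz.
by rewrite (nondegenerate (z := z)) ?mul0mx // => u; apply: hz.
Qed.

Lemma Omega_unit : O \in unitmx.
Proof.
have [X st _] := even_stage.
have /fin_all_exists [w hw] j : exists w : 'rV[int]_m, forall u, <<w, u>> = u 0 j.
  have [w _ hw] := st_dual st (delta_mx j 0); exists w => u; rewrite hw //.
  by rewrite -colE mxE.
suff /mulmx1_unit [] : \matrix_j w j *m O = 1%:M by [].
apply/row_matrixP => i; rewrite row_mul rowK row1; apply/rowP => j.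
have := hw i (delta_mx 0 j); rewrite /Defs.form trmx_delta -colE mxE => ->.
by rewrite !mxE eqxx eq_sym.
Qed.

Lemma isom_unit A : isom O A -> A \in unitmx.
Proof.
move=> iA; have /mulmx1_unit[] // : A *m (O *m A^T *m invmx O) = 1%:M.
by rewrite !mulmxA iA mulmxV // Omega_unit.
Qed.

Lemma mod2_dual (d : 'rV[int]_m -> bool) : (forall u v, d (u + v) = d u (+) d v) ->
  exists w, forall u, d u = par <<w, u>>.
Proof.
move=> dD; have [X st _] := even_stage.
have [w _ hw] := st_dual st (\col_j (d (letter m j))%:R); exists w.
apply: additive_ext => // [u v|i hi]; first by rewrite formDr parD.
rewrite hw // -[i]/(val (Ordinal hi)) letter_delta -rowE !mxE -letter_delta /=.
by case: (d _).
Qed.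

Lemma RV_even A : RV (P m) A <-> isom O A /\ forall u, q (u *m A) = q u.
Proof.
split=> [RA|[iA QA]].
  by have [] := RV_in (good_fam cm) RA.
by apply: RV_letters => //; apply: even_full.
Qed.

(* [det A] is read off the decomposition of [A] into transvections, [A] up to some [Tv w0]
   preserving the quadratic form. *)
Lemma det_isom A : isom O A -> \det A = 1.
Proof.
move=> iA.
have det1 B : isom O B -> (forall u, q (u *m B) = q u) -> \det B = 1.
  by move=> iB QB; have [] := RV_in (good_fam cm) ((RV_even B).2 (conj iB QB)).
have [w hw] : exists w, forall u, q (u *m A) (+) q u = par <<w, u>>.
  apply: mod2_dual => u v; rewrite mulmxDl !QD.
  have /isomP -> := iA.
  by case: (q (u *m A)); case: (q (v *m A)); case: (q u); case: (q v); case: (par _).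
have {}hw u : q (u *m A) = q u (+) par <<w, u>>.
  by rewrite -hw; case: (q _); case: (q u).
have qw : q w = false := arf_int (@pt_inj_fam isTau m cm) (isom_unit iA) Omega_unit hw.
have [X st _] := even_stage.
have even_case : (forall u, par <<w, u>> = false) -> \det A = 1.
  by move=> h; apply: det1 => // u; rewrite hw h addbF.
case: (st_content st (I : (fun _ => True) w)) => [w0|[a [w0 [_ [z _ w0z] wE]]]].
  by apply: even_case => u; rewrite w0 form0l.
case pa: (par a); last by apply: even_case => u; rewrite wE formZl parM pa.
have qw0 : q w0 = false by move: qw; rewrite wE (QZ sk QD) pa.
have [y qy w0y] : exists2 y, q y & <<w0, y>> = 1.
  case qz: (q z); first by exists z.
  by exists (w0 + z); [rewrite QD qw0 qz w0z | rewrite formDr formvv // w0z].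
have dy : \det (Tv O y) = 1 by apply: det1 => [|u]; [apply: isom_Tv | rewrite (Q_Tv sk QD)].
(* T_{w0} does not preserve the quadratic form, but T_y does. The product T_{w0} T_y takes y to y +
   w0 and then to w0, so the two transvections are conjugate and share their determinant. *)
have dw0 : \det (Tv O w0) = 1.
  have MU : Tv O w0 *m Tv O y \in unitmx by rewrite unitmx_mul !Tv_unit.
  have -> : w0 = y *m (Tv O w0 *m Tv O y).
    rewrite mulmxA !mul_Tv // w0y scale1r formDr formvv // form_skew // w0y add0r scaleN1r.
    by rewrite addrC addKr.
  rewrite Tv_conj //; last by apply: isomM; apply: isom_Tv.
  rewrite det_mulmx det_mulmx det_inv mulrAC mulVr ?mul1r; [exact: dy | by rewrite -unitmxE].
have : \det (Tv O w0 *m A) = 1.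
  apply: det1 => [|u]; first by apply: isomM => //; apply: isom_Tv.
  rewrite mulmxA hw mul_Tv // QD (QZ sk QD) qw0 andbF addbF wE !formE formvv // (form_skew sk u w0).
  by rewrite !mulr0 addr0 !parM pa parN; case: (par _); case: (q u).
by rewrite det_mulmx dw0 mul1r.
Qed.
End Even.
End Family.

Lemma mul_mx11 (R : comPzRingType) n (s : 'M[R]_1) (v : 'rV[R]_n) : s *m v = s 0 0 *: v.
Proof. by rewrite {1}[s]mx11_scalar mul_scalar_mx. Qed.

(** * Odd dimension *)

Section Odd.
Variables (isTau : bool) (g : nat).
Local Notation c := (center isTau).
Local Notation m := (2 * g)%N.
Local Notation d := (2 * g).+1.
Hypothesis cm : (c < m)%N.
Local Notation P n := (fam isTau n).
Local Notation O := (Omega (P d)).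
Local Notation O' := (Omega (P m)).
Local Notation Q := (Qint (P d)).
Local Notation Q' := (Qint (P m)).
Local Notation "<< u , v >>" := (Defs.form O u v) (at level 0, format "<< u ,  v >>").

Let cd : (c < d)%N := ltnW cm.
Let m_even : ~~ odd m. Proof. by rewrite mul2n odd_double. Qed.
Let QD := QD_fam cd.
Let QD' := QD_fam cm.
Let sk : O^T = - O := Omega_skew _.
Let sk' : O'^T = - O' := Omega_skew _.

Fixpoint alternating (t : nat) : 'rV[int]_d :=
  if t is t'.+1 then alternating t' + (letter d t'.*2.+2 - letter d t'.*2.+1) else letter d 0.

Let radical : 'rV[int]_d := alternating g.

(** For odd a, the letters a and a + 1 lie in the same block of the irregularity, hence pair alike
    with every other letter. *)
Lemma pairing_pair (a j : nat) : odd a -> (a.+1 < d)%N -> (j < d)%N ->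
  pairing c a.+1 j - pairing c a j = if (j == a) || (j == a.+1) then -1 else 0.
Proof.
have [oc c5] := center_facts isTau; move: c oc c5 => c' oc c5 oa ad jd.
have nE : nonadjacent c' a.+1 j = nonadjacent c' a j.
  rewrite /nonadjacent; clear -oa oc c5; lia.
have nE' : nonadjacent c' j a.+1 = nonadjacent c' j a.
  rewrite /nonadjacent; clear -oa oc c5; lia.
have n1 : nonadjacent c' a a.+1 = false by rewrite /nonadjacent; clear -oa oc c5; lia.
have n0 : nonadjacent c' a a = false by rewrite /nonadjacent; clear; lia.
rewrite /pairing nE nE'.
have [->|ja] := eqVneq j a; first by rewrite ltnn ltnSn ltnNge leqnSn /= n0.
have [->|ja1] := eqVneq j a.+1; first by rewrite ltnn ltnSn n1.
case: (ltngtP a j) ja => //= h _.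
  have -> : (a.+1 < j)%N by clear -h ja1; lia.
  by rewrite subrr.
have -> : (a.+1 < j)%N = false by clear -h; lia.
have -> : (j < a.+1)%N by clear -h; lia.
by rewrite subrr.
Qed.

(** The letter 0 pairs to 1 with all later letters, and each added difference cancels this for two
    more of them; at t = g no letter is left. *)
Lemma alternating_letter t j : (t <= g)%N -> (j < d)%N ->
  <<alternating t, letter d j>> = ((0 < j)%N && (t.*2 < j)%N)%:R.
Proof.
elim: t => [|t IH] tg jd.
  by rewrite form_fam // /pairing /nonadjacent /= andbb; case: j jd.
have h1 : (t.*2.+1.+1 < d)%N by clear -tg; lia.
rewrite /= formDl (IH (ltnW tg) jd) formDl formNl !form_fam // ?(ltnW h1) //.
rewrite pairing_pair //=; last by rewrite odd_double.
clear -tg jd; case: eqP => [->|h2] /=; first by lia.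
case: eqP => [->|h3] /=; first by lia.
by rewrite addr0; congr (_%:R); lia.
Qed.

Lemma radical_form z : <<radical, z>> = 0.
Proof.
apply: form_eq0 => //; apply: (span_perp (L := predT)) => // j jd _.
rewrite form_skew // alternating_letter //; have -> : (g.*2 < j)%N = false by clear -jd; lia.
by rewrite andbF oppr0.
Qed.

(** Each difference has Q-value 1 and is orthogonal to the preceding partial sum, so every step
    flips Q. *)
Lemma Q_alternating t : (t <= g)%N -> Q (alternating t) = ~~ odd t.
Proof.
elim: t => [|t IH] tg; first by apply: Qint_letter.
have h1 : (t.*2.+1.+1 < d)%N by clear -tg; lia.
have h2 := ltnW h1; have tg' := ltnW tg.
rewrite /= QD IH // formDr formNr !alternating_letter //.
rewrite QD (QN sk QD) !Qint_letter // formNr form_fam //.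
have -> : pairing c t.*2.+2 t.*2.+1 = -1.
  have := @pairing_pair t.*2.+1 t.*2.+1; rewrite eqxx /= odd_double => /(_ isT h1 h2).
  by rewrite {2}/pairing ltnn subr0.
have -> : (t.*2 < t.*2.+2)%N by clear; lia.
by rewrite ltnSn /= subrr; case: (odd t).
Qed.

Lemma Q_radical : Q radical = ~~ odd g. Proof. exact: Q_alternating. Qed.

Lemma alternating_last t (j : 'I_d) : (t.*2 <= j)%N -> alternating t 0 j = (val j == t.*2)%:R.
Proof.
elim: t => [|t IH] h; first by rewrite mxE.
rewrite /= !mxE IH; last by clear -h; lia.
have -> : (val j == t.*2) = false by move: h; rewrite -[val j]/(nat_of_ord j); clear; lia.
have -> : (val j == t.*2.+1) = false by move: h; rewrite -[val j]/(nat_of_ord j); clear; lia.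
by rewrite subr0 add0r.
Qed.

Definition inclusion : 'M[int]_(m, d) := \matrix_(i, j) (val i == val j)%:R.
Definition last_coord : 'cV[int]_d := delta_mx ord_max 0.
(** The last coordinate of k is 1, so Z^d is the direct sum of the span of the first 2g letters and
    Z k. The coefficient of k is read off by [last_coord], and [projection] is the projection along
    k. *)
Definition projection : 'M[int]_(d, m) := (1%:M - last_coord *m radical) *m inclusion^T.
Local Notation J := inclusion.
Local Notation kap := last_coord.
Local Notation Pr := projection.
Local Notation k := radical.

Lemma last_coordE (v : 'rV[int]_d) : (v *m kap) 0 0 = v 0 ord_max.
Proof. by rewrite -colE mxE. Qed.

Lemma J_kap : J *m kap = 0.
Proof.
apply/matrixP => i j; rewrite -colE !mxE /=; have := ltn_ord i.
by case: eqP => // ->; rewrite ltnn.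
Qed.

Lemma k_kap : k *m kap = 1%:M.
Proof.
apply/matrixP => i j; rewrite !ord1 last_coordE alternating_last /=; last by rewrite -mul2n.
by rewrite mul2n eqxx mxE.
Qed.

Lemma J_tr : J *m J^T = 1%:M.
Proof.
apply/matrixP => i j; rewrite !mxE (bigD1 (widen_ord (leqnSn m) i)) //= !mxE /= eqxx mul1r.
rewrite big1 ?addr0 => [|l li]; first by rewrite eq_sym.
rewrite !mxE; case: eqP => [e|_]; rewrite ?mul0r //.
by case/eqP: li; apply: val_inj; rewrite /= -e.
Qed.

Lemma tr_J : J^T *m J = 1%:M - kap *m kap^T.
Proof.
apply/matrixP => i j; rewrite [RHS]mxE !mxE big_ord1 !mxE !eqxx !andbT.
have [im|im] := ltnP i m.
  rewrite (bigD1 (Ordinal im)) //= !mxE /= eqxx mul1r big1 ?addr0 => [|l li].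
    have -> : (i == ord_max) = false by apply/eqP => e; move: im; rewrite e ltnn.
    by rewrite mul0r subr0.
  by rewrite !mxE; case: eqP => [e|_]; rewrite ?mul0r //; case/eqP: li; apply: val_inj.
have -> : i = ord_max by apply: val_inj => /=; have := ltn_ord i; clear -im; lia.
rewrite big1 => [|l _]; last first.
  by rewrite !mxE /=; have := ltn_ord l; case: eqP => [->|_]; rewrite ?ltnn ?mul0r.
by rewrite eqxx mul1r eq_sym subrr.
Qed.

Lemma J_Pr : J *m Pr = 1%:M.
Proof. by rewrite /projection mulmxA mulmxBr mulmx1 mulmxA J_kap mul0mx subr0 J_tr. Qed.

Lemma k_Pr : k *m Pr = 0.
Proof. by rewrite /projection mulmxA mulmxBr mulmx1 mulmxA k_kap mul1mx subrr mul0mx. Qed.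

Lemma Pr_J : Pr *m J + kap *m k = 1%:M.
Proof.
rewrite /projection -mulmxA tr_J mulmxBl mul1mx mulmxBr mulmx1.
rewrite [_ *m k *m (kap *m _)]mulmxA -(mulmxA kap k kap) k_kap mulmx1.
by rewrite opprB addrA subrK subrK.
Qed.

Lemma k_O : k *m O = 0.
Proof.
apply/rowP => j; have := radical_form (delta_mx 0 j).
by rewrite /Defs.form trmx_delta -colE !mxE.
Qed.

Lemma J_letter i : (i < m)%N -> letter m i *m J = letter d i.
Proof.
move=> im; rewrite -[i]/(val (Ordinal im)) letter_delta -rowE.
by apply/rowP => j; rewrite !mxE eq_sym.
Qed.

(** The pairing of two letters does not depend on the size of the alphabet, so the form in dimension
    2g is the restriction of the one in dimension 2g + 1. *)
Lemma O_J : O' = J *m O *m J^T.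
Proof.
apply/matrixP => i j; rewrite -(form_delta O') -!letter_delta.
have := form_fam cm (ltn_ord i) (ltn_ord j); rewrite -[val i]/(nat_of_ord i) => ->.
rewrite -(form_fam cd) ?(ltn_trans (ltn_ord _)) // -!J_letter //.
rewrite /Defs.form trmx_mul !mulmxA !letter_delta.
by rewrite trmx_delta -rowE -colE -!row_mul !mxE.
Qed.

Lemma form_J u v : <<u *m J, v *m J>> = Defs.form O' u v.
Proof. by rewrite O_J /Defs.form trmx_mul !mulmxA. Qed.

Lemma Q_J u : Q (u *m J) = Q' u.
Proof.
apply: (@quadratic_ext m O' (fun u => Q (u *m J)) Q') => [v w||i im].
- by rewrite mulmxDl QD form_J.
- exact: QD'.
- by rewrite J_letter // !Qint_letter // ltnW.
Qed.

Lemma radical_split (v : 'rV[int]_d) : exists (u : 'rV[int]_m) a, v = u *m J + a *: k.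
Proof.
exists (v *m Pr), ((v *m kap) 0 0).
rewrite -{1}[v]mulmx1 -Pr_J mulmxDr !mulmxA; congr (_ + _).
exact: mul_mx11.
Qed.

Lemma form_split u v (a b : int) : <<u *m J + a *: k, v *m J + b *: k>> = Defs.form O' u v.
Proof.
have rr z : <<z, k>> = 0 by apply/(form_eq0 sk)/radical_form.
by rewrite !formE form_J !radical_form !rr !mulr0 !addr0.
Qed.

Lemma Q_split u (a : int) : Q (u *m J + a *: k) = Q' u (+) (par a && ~~ odd g).
Proof.
have rr z : <<z, k>> = 0 by apply/(form_eq0 sk)/radical_form.
by rewrite QD (QZ sk QD) formZr rr mulr0 par0 addbF Q_J Q_radical.
Qed.

(** This is the action on the quotient by the radical; [shear_part] below records the coefficient of
    k in the images of the first 2g letters. *)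
Definition linear_part (S : 'M[int]_d) : 'M[int]_m := J *m S *m Pr.
Definition shear_part (S : 'M[int]_d) : 'cV[int]_m := J *m S *m kap.

Lemma row_shear (S : 'M[int]_d) (u : 'rV[int]_m) :
  u *m J *m S = u *m linear_part S *m J + ((u *m shear_part S) 0 0) *: k.
Proof.
rewrite -[LHS]mulmx1 -Pr_J mulmxDr /linear_part /shear_part !mulmxA; congr (_ + _).
exact: mul_mx11.
Qed.

Lemma linear_isom S : isom O S -> isom O' (linear_part S).
Proof.
move/isomP => iS; apply/isomP => u v.
by rewrite -(form_split _ _ ((u *m shear_part S) 0 0) ((v *m shear_part S) 0 0)) -!row_shear iS form_J.
Qed.

Lemma linear_Q S u : (forall v, Q (v *m S) = Q v) ->
  Q' (u *m linear_part S) = Q' u (+) (par ((u *m shear_part S) 0 0) && ~~ odd g).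
Proof.
move=> QS; have := QS (u *m J); rewrite row_shear Q_split Q_J => <-.
by case: (Q' _); case: (_ && _).
Qed.

Lemma split_Pr (u : 'rV[int]_m) (a : int) : (u *m J + a *: k) *m Pr = u.
Proof. by rewrite mulmxDl -mulmxA J_Pr mulmx1 -scalemxAl k_Pr scaler0 addr0. Qed.

Lemma split_kap (u : 'rV[int]_m) (a : int) : (u *m J + a *: k) *m kap = a%:M.
Proof. by rewrite mulmxDl -mulmxA J_kap mulmx0 add0r -scalemxAl k_kap scalemx1. Qed.

Definition assemble (A : 'M[int]_m) (psi : 'cV[int]_m) : 'M[int]_d :=
  Pr *m (A *m J + psi *m k) + kap *m k.

Lemma assembleE A psi u (a : int) :
  (u *m J + a *: k) *m assemble A psi = u *m A *m J + ((u *m psi) 0 0 + a) *: k.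
Proof.
rewrite /assemble mulmxDr mulmxA split_Pr mulmxA split_kap mul_scalar_mx mulmxDr !mulmxA mul_mx11.
by rewrite scalerDl addrA.
Qed.

Lemma assemble_parts S : k *m S = k -> assemble (linear_part S) (shear_part S) = S.
Proof.
move=> kS; apply: eq_mulmx_row => v; have [u [a ->]] := radical_split v.
by rewrite assembleE mulmxDl row_shear -scalemxAl kS scalerDl addrA.
Qed.

Lemma assemble_radical A psi : k *m assemble A psi = k.
Proof.
have := assembleE A psi 0 1; rewrite !mul0mx !add0r !scale1r mxE => ->.
by rewrite add0r scale1r.
Qed.

Lemma linear_assemble A psi : linear_part (assemble A psi) = A.
Proof.
apply: eq_mulmx_row => u; rewrite /linear_part 2!mulmxA.
have := assembleE A psi u 0; rewrite scale0r addr0 => ->.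
exact: split_Pr.
Qed.

Lemma shear_assemble A psi : shear_part (assemble A psi) = psi.
Proof.
apply: eq_mulmx_row => u; rewrite /shear_part 2!mulmxA.
have := assembleE A psi u 0; rewrite scale0r addr0 => ->.
by rewrite split_kap addr0 -mx11_scalar.
Qed.

Lemma assemble_isom A psi : isom O' A -> isom O (assemble A psi).
Proof.
move=> /isomP iA; apply/isomP => v w.
have [u [a ->]] := radical_split v; have [u' [b ->]] := radical_split w.
by rewrite !assembleE !form_split iA.
Qed.

Lemma assemble_Q A psi :
  (forall u, Q' (u *m A) = Q' u (+) (par ((u *m psi) 0 0) && ~~ odd g)) ->
  forall v, Q (v *m assemble A psi) = Q v.
Proof.
move=> h v; have [u [a ->]] := radical_split v; rewrite assembleE !Q_split h parD.
by case: (Q' u); case: (par _); case: (par a); case: (odd g).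
Qed.

Lemma odd_generated S : isom O S -> (forall u, Q (u *m S) = Q u) -> k *m S = k ->
  grp O (letters (n := d)) S.
Proof.
move=> iS QS kS; have [oc c5] := center_facts isTau.
have om1 : odd m.-1 by clear -cm m_even c5; lia.
have cm1 : (c <= m.-1 < d)%N by clear -cm; lia.
set L : pred nat := fun l => (l <= m.-1)%N.
have [X st XE] : staged O Q L := staged_fam cd om1 cm1.
(* Both terms have last coordinate 1, so x lies in the span of the first 2g letters. *)
pose x := letter d m - k.
have xk : x + k = letter d m by rewrite /x subrK.
have spanE v : span L v <-> (v *m kap) 0 0 = 0.
  rewrite last_coordE; split=> [h|h j Lj]; first by apply: h; rewrite /L /=; clear -cm; lia.
  have -> : j = ord_max by apply: val_inj => /=; have := ltn_ord j; move: Lj; rewrite /L; clear -cm; lia.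
  by [].
have kk : (k *m kap) 0 0 = 1 by rewrite k_kap mxE eqxx.
have U_dec z : span L (z - ((z *m kap) 0 0) *: k).
  by apply/spanE; rewrite mulmxBl -scalemxAl k_kap scalemx1 -mx11_scalar subrr mxE.
have Ux : span L x.
  apply/spanE; rewrite mulmxBl k_kap mxE last_coordE !mxE eqxx.
  by rewrite -[_ ord_max]/m eqxx subrr.
have Qxk : Q (x + k) by rewrite xk; apply: Qint_letter.
have px : prim O (span L) x.
  exists (- letter d 0).
    by have [_ _] := @span_sub d L; apply; apply: span_letter.
  rewrite formNr formDl formNl radical_form oppr0 addr0 form_fam //.
  have m0 : (0 < m)%N by apply: leq_ltn_trans cm.
  by rewrite /pairing ltn0 m0.
pose X' v := X v \/ v = x + k.
apply: (@grp_sub _ _ sk X') => [v [Xv|->]|]; first exact: XE.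
  by rewrite xk; apply: letter_unit.
have XX' v : X v -> X' v by left.
have X'xk : X' (x + k) by right.
(* Since Q (x + k) = 1 and k is in the radical, Q x = 1 means Q k = 0, that is, g odd. *)
case Qx: (Q x); first exact: (radical_full1 (kap := kap) sk QD st radical_form U_dec XX' X'xk Qxk Ux px).
have [||p [q [Up Uq Qp Qq pq]]] := singular_pair (L := L) sk QD (@form_fam isTau d cd) (fun i hi => Qint_letter (P d) hi) oc c5 cd.
- by rewrite /L; clear -cm; lia.
- by move=> l l2; rewrite /L; clear -cm c5 l2; lia.
apply: (radical_full0 (kap := kap) sk QD st radical_form kk U_dec XX' X'xk Qxk Ux px Up Uq Qp Qq pq) => // w Uw wE.
have [w' wJ] : exists w', w = w' *m J.
  have [w' [a wE']] := radical_split w; exists w'; move/spanE: Uw.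
  rewrite wE' mulmxDl -mulmxA J_kap mulmx0 add0r -scalemxAl k_kap scalemx1 mxE eqxx mulr1n => ->.
  by rewrite scale0r addr0.
have Qk : ~~ odd g.
  move: Qxk; rewrite QD Qx Q_radical; have -> : <<x, k>> = 0; last by case: (odd g).
  exact/(form_eq0 sk)/radical_form.
have iA := linear_isom iS; rewrite wJ Q_J.
apply: (arf_int (@pt_inj_fam isTau m cm) (isom_unit cm m_even iA) (Omega_unit cm m_even)) => u.
rewrite linear_Q // Qk andbT; congr (_ (+) par _).
rewrite -form_J -wJ wE; last by apply/spanE; rewrite -mulmxA J_kap mulmx0 mxE.
by rewrite /shear_part !mulmxA.
Qed.

(** An isometry preserves the radical, so k S = a k. In the basis formed by k and the first 2g
    letters, S is block triangular with diagonal blocks a and its linear part; the latter is an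
    isometry in even dimension, of determinant 1, so a = det S. *)
Lemma radical_fixed S : isom O S -> \det S = 1 -> k *m S = k.
Proof.
move=> iS dS; have uS : S \in unitmx by rewrite unitmxE dS unitr1.
have kSO : k *m S *m O = 0.
  apply: (can_inj (mulmxK (_ : S^T \in unitmx))); first by rewrite unitmx_tr.
  by rewrite mul0mx -!mulmxA [S *m (O *m _)]mulmxA iS k_O.
have [u [a kE]] := radical_split (k *m S).
have u0 : u = 0.
  apply: (nondegenerate cm m_even) => v.
  have := form_split u v a 0; rewrite scale0r addr0 -kE => <-.
  by rewrite /Defs.form kSO mul0mx mxE.
rewrite u0 mul0mx add0r in kE; rewrite kE.
suff -> : a = 1 by rewrite scale1r.
pose B : 'M[int]_(1 + m) := col_mx k J.
have BS : B *m (S : 'M_(1 + m)) = block_mx a%:M 0 (shear_part S) (linear_part S) *m B.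
  rewrite mul_col_mx mul_block_col mul0mx addr0 mul_scalar_mx -kE; congr col_mx.
  apply: eq_mulmx_row => v; rewrite mulmxA row_shear mulmxDr addrC mulmxA.
  by rewrite [v *m (linear_part S *m J)]mulmxA mul_mx11.
have uB : \det B != 0.
  have : B *m (row_mx kap Pr : 'M_(1 + m)) = 1%:M.
    by rewrite mul_col_row k_kap k_Pr J_kap J_Pr -scalar_mx_block.
  move/(congr1 determinant); rewrite det_mulmx det1 => e.
  by apply/eqP => e0; move: e; rewrite e0 mul0r.
have := congr1 determinant BS; rewrite !det_mulmx det_lblock det_scalar1.
rewrite (det_isom cm m_even (linear_isom iS)) mulr1 [\det (S : 'M_(1 + m))]dS mulr1 => e.
by apply: (mulIf uB); rewrite -e mul1r.
Qed.

Lemma RV_odd S : RV (P d) S <->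
  [/\ isom O S, forall u, Q (u *m S) = Q u & k *m S = k].
Proof.
split=> [RS|[iS QS kS]]; last exact/RV_letters/odd_generated.
by have [iS dS uS QS] := RV_in (good_fam cd) RS; split=> //; apply: radical_fixed.
Qed.

Lemma RV_odd_SpSL S : RV (P d) S <-> SpSL O S /\ OQ (P d) (red2 S).
Proof.
split=> [RS|[[[uS iS] dS] oQ]].
  have [iS dS uS QS] := RV_in (good_fam cd) RS; split=> //.
  exact/OQ_red2.
by apply/RV_odd; split=> //; [apply/OQ_red2 | apply: radical_fixed].
Qed.

Lemma RV_odd_generated S : RV (P d) S <->
  generated (fun T => exists a, T = Tv O (e_ a)) S.
Proof.
rewrite -grp_lettersP; split=> [/RV_odd [iS QS kS]|]; first exact: odd_generated.
exact: RV_letters.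
Qed.

(** * Semidirect product structure *)

Let W := (invmx O')^T.
Let uO : O' \in unitmx := Omega_unit cm m_even.

(* The cocycle [shear_part] is turned into a row vector on which [linear_part] acts
   on the right by means of the form: [shear_part S = A O' r^T]. *)
Definition affine_part (S : 'M[int]_d) : 'M[int]_m * 'rV[int]_m :=
  (linear_part S, (shear_part S)^T *m W *m linear_part S).

(** For odd g the second condition says that A preserves the quadratic form and leaves r free; for
    even g it ties r modulo 2 to the defect of A. *)
Definition affine_image (x : 'M[int]_m * 'rV[int]_m) : Prop :=
  isom O' x.1 /\
  forall u, Q' (u *m x.1) = Q' u (+) (par (Defs.form O' (u *m x.1) x.2) && ~~ odd g).

Lemma shear_affine S : isom O S -> shear_part S = linear_part S *m O' *m (affine_part S).2^T.
Proof.
move=> /linear_isom; rewrite /affine_part /=.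
move: (linear_part S) (shear_part S) => A s iA.
by rewrite !trmx_mul trmxK /W trmxK !mulmxA iA mulmxV // mul1mx.
Qed.

(** This identity turns the left action of A on columns in the cocycle of [shear_mul] into right
    multiplication on rows, as the semidirect product requires. *)
Lemma isom_W A : isom O' A -> A^T *m W *m A = W.
Proof.
move=> iA; have /mulmx1C h : A *m (O' *m A^T *m invmx O') = 1%:M.
  by rewrite !mulmxA iA mulmxV.
have : A^T *m invmx O' *m A = invmx O'.
  by rewrite -[LHS](mulKmx uO) (mulmxA O') (mulmxA O') h mulmx1.
by move/(congr1 trmx); rewrite !trmx_mul trmxK -/W mulmxA.
Qed.

Lemma linear_mul S T : k *m T = k -> linear_part (S *m T) = linear_part S *m linear_part T.
Proof.
move=> kT; apply: eq_mulmx_row => u; rewrite {1}/linear_part 2!mulmxA (mulmxA _ S).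
by rewrite row_shear mulmxDl row_shear -scalemxAl kT -addrA -scalerDl split_Pr mulmxA.
Qed.

Lemma shear_mul S T : k *m T = k ->
  shear_part (S *m T) = linear_part S *m shear_part T + shear_part S.
Proof.
move=> kT; apply: eq_mulmx_row => u; rewrite {1}/shear_part 2!mulmxA (mulmxA _ S).
rewrite row_shear mulmxDl row_shear -scalemxAl kT -addrA -scalerDl split_kap.
by rewrite mulmxDr [u *m (linear_part S *m _)]mulmxA [RHS]mx11_scalar [in RHS]mxE.
Qed.

Lemma affine_iso : group_iso (@mulmx int _ _ _) (@sd_mul m) (RV (P d)) affine_image affine_part.
Proof.
have RV_iso S : RV (P d) S -> isom O S by case/RV_odd.
split.
- move=> S /RV_odd [iS QS kS]; split; first exact: linear_isom.
  move=> u; rewrite linear_Q // {1}(shear_affine iS).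
  by rewrite /Defs.form !mulmxA.
- move=> [A r] [/= iA QA]; pose psi := A *m O' *m r^T.
  exists (assemble A psi).
    apply/RV_odd; split; [exact: assemble_isom | | exact: assemble_radical].
    by apply: assemble_Q => u; rewrite QA /Defs.form /psi !mulmxA.
  rewrite /affine_part linear_assemble shear_assemble; congr (_, _).
  rewrite /psi !trmx_mul trmxK -!mulmxA [A^T *m _]mulmxA isom_W //.
  by rewrite /W -trmx_mul mulVmx // trmx1 mulmx1.
- move=> S T RS RT; case=> eA er.
  have eS : shear_part S = shear_part T.
    by rewrite (shear_affine (RV_iso _ RS)) (shear_affine (RV_iso _ RT)) /= er eA.
  have [_ _ kS] := (RV_odd S).1 RS; have [_ _ kT] := (RV_odd T).1 RT.
  by rewrite -(assemble_parts kS) -(assemble_parts kT) eA eS.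
- move=> S T RS RT; have [iT _ kT] := (RV_odd T).1 RT.
  have iS := linear_isom (RV_iso _ RS).
  rewrite /affine_part /sd_mul /= linear_mul // shear_mul //; congr (_, _).
  rewrite linearD /= trmx_mul mulmxDl mulmxDl addrC; congr (_ + _); first by rewrite mulmxA.
  move: (shear_part T)^T (linear_part S) (linear_part T) iS => t A B iS.
  by rewrite mulmxA -!(mulmxA t) isom_W.
Qed.

Lemma affine_image_odd x : odd g -> affine_image x <-> RV (P m) x.1.
Proof.
move=> og; rewrite (RV_even cm m_even); split=> -[iA QA]; split=> // u.
  by rewrite QA og andbF addbF.
by rewrite QA og andbF addbF.
Qed.

(** For any isometry A and any r, the failure of the defining condition is an additive functional
    modulo 2, hence of the form <w, u>. Only w modulo 2 matters, so finitely many translations, by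
    the vectors with entries 0 and 1, meet every coset. *)
Lemma affine_image_finite_index : ~~ odd g ->
  sd_finite_index_subgroup (fun x => Sp O' x.1) affine_image.
Proof.
move=> eg; have unitA := isom_unit cm m_even.
have HE x : affine_image x <-> isom O' x.1 /\
    forall u, Q' (u *m x.1) = Q' u (+) par (Defs.form O' (u *m x.1) x.2).
  by split=> -[iA QA]; split=> // u; rewrite QA eg andbT.
split.
- by move=> x [iA _]; split=> //; apply: unitA.
- apply/HE; split=> [|u]; first exact: isom1.
  by rewrite /= mulmx1 form0r addbF.
- move=> [A r] [B s] /HE [/= iA QA] /HE [/= iB QB]; apply/HE; split=> [|u]; first exact: isomM.
  rewrite /= mulmxA QB QA formDr parD; move/isomP: iB => ->.
  by rewrite addbA.
- move=> [A r] /HE [/= iA QA]; have uA := unitA _ iA.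
  have iV := isomV uA iA; apply/HE; split=> [|u] //=.
  have := QA (u *m invmx A); rewrite mulmxKV // => ->.
  rewrite formNr parN; move/isomP: iV => ->.
  by case: (Q' _); case: (par _).
pose lift (t : 'rV[bool]_m) : 'rV[int]_m := map_mx (fun b : bool => (b : nat)%:Z) t.
exists [seq (1%:M, lift t) | t <- enum {: 'rV[bool]_m}]; split.
  by move=> _ /mapP [t _ ->]; split; [exact: unitmx1 | exact: isom1].
move=> [A r] [/= uA iA].
have [|w hw] := mod2_dual cm m_even (d := fun u => Q' (u *m A) (+) Q' u (+) par (Defs.form O' (u *m A) r)).
  move=> u v; rewrite mulmxDl !QD' formDl parD; move/isomP: iA => ->.
  case: (Q' (u *m A)); case: (Q' (v *m A)); case: (Q' u); case: (Q' v);
    by case: (par (Defs.form O' u v)); case: (par _); case: (par _).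
pose t : 'rV[bool]_m := map_mx par w.
exists (1%:M, lift t); first by apply/mapP; exists t; rewrite ?mem_enum.
apply/HE; rewrite /sd_mul /sd_inv /= invmx1 !mulmx1 mul1mx; split=> // u.
have [z zE] : exists z : 'rV[int]_m, w = lift t + (z + z).
  have /fin_all_exists [z hz] j : exists z : int, w 0 j = (par (w 0 j) : nat)%:Z + (z + z).
    have [|z zE] := @par_evenE (w 0 j - (par (w 0 j) : nat)%:Z).
      by rewrite !parE; case: (par (w 0 j)).
    by exists z; rewrite -zE addrC subrK.
  by exists (\row_j z j); apply/rowP => j; rewrite !mxE.
have tE : par (Defs.form O' (lift t) u) = par (Defs.form O' w u).
  by rewrite zE !formDl !parD addbb addbF.
rewrite formDr mulNmx formNr parD parN; move/isomP: (iA) => ->.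
rewrite (form_skew sk') parN tE -hw.
by case: (Q' (u *m A)); case: (Q' u); case: (par _).
Qed.
End Odd.

Theorem theorem5p1 (g : nat) (isTau : bool) :
  (3 <= g)%N ->
  (~~ isTau -> (8 <= (2 * g).+1)%N) ->
  [/\ (* RV = preimage of O(Q) in Sp ∩ SL *)
      (forall S : 'M[int]_((2 * g).+1),
         RV (fam isTau (2 * g).+1) S <->
         (SpSL (Omega (fam isTau (2 * g).+1)) S /\
          OQ (fam isTau (2 * g).+1) (red2 S))),
      (* g odd: RV(pi^(d)) ≅ RV(pi^(d-1)) ⋉ Z^(d-1) *)
      (odd g ->
         exists f : 'M[int]_((2 * g).+1) -> 'M[int]_(2 * g) * 'rV[int]_(2 * g),
           group_iso (@mulmx int _ _ _) (@sd_mul (2 * g))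
             (RV (fam isTau (2 * g).+1))
             (fun x => RV (fam isTau (2 * g)) x.1) f),
      (* g even: RV(pi^(d)) ≅ a finite-index subgroup of Sp(Omega^(d-1), Z) ⋉ Z^(d-1) *)
      (~~ odd g ->
         exists (H : 'M[int]_(2 * g) * 'rV[int]_(2 * g) -> Prop)
                (f : 'M[int]_((2 * g).+1) -> 'M[int]_(2 * g) * 'rV[int]_(2 * g)),
           sd_finite_index_subgroup
             (fun x => Sp (Omega (fam isTau (2 * g))) x.1) H /\
           group_iso (@mulmx int _ _ _) (@sd_mul (2 * g))
             (RV (fam isTau (2 * g).+1)) H f) &
      (* generation by the transvections T_{e_alpha} *)
      (forall S : 'M[int]_((2 * g).+1),
         RV (fam isTau (2 * g).+1) S <->
         generated (fun T => exists a, T = Tv (Omega (fam isTau (2 * g).+1)) (e_ a)) S)].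
Proof.
(* For sigma, 8 <= 2g + 1 gives 7 < 2g by parity, so the family keeps its shape in dimension 2g as
   well. *)
move=> g3 g4; have cm : (center isTau < 2 * g)%N.
  by move: g4; rewrite /center; case: isTau => /= [_|/(_ isT)]; lia.
split=> [S|og|eg|S].
- exact: RV_odd_SpSL.
- have [fP fS fI fM] := affine_iso cm; exists (@affine_part isTau g); split=> //.
  + by move=> S /fP /(affine_image_odd cm _ og).
  + by move=> x /(affine_image_odd cm _ og) /fS.
- exists (@affine_image isTau g), (@affine_part isTau g).
  by split; [apply: affine_image_finite_index | apply: affine_iso].
- exact: RV_odd_generated.
Qed.
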